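(* For $n$ large enough, there is an algorithm that, given $k$-fold simultaneous unweighted Max-Cut instances on $n$ vertices, runs in time $2^{2^{2^{O(k)}}}\cdot\mathrm{poly}(n)$ and computes a $\left(\frac12+\Omega\left(\frac1{k^2}\right)\right)$-minimum approximation.
   Context: A $k$-fold simultaneous unweighted Max-Cut instance consists of $k$ graphs $G_\ell=(V,E_\ell)$ on a common vertex set $V$ with $|V|=n$; in instance $\ell$ every edge has weight $1/|E_\ell|$ (so total weight $1$). For a cut (assignment $f:V\to\{0,1\}$), $\mathrm{val}(f,G_\ell)$ is the total weight of edges of $G_\ell$ whose endpoints get different values. Let $\mathrm{OPT}=\max_f\min_{\ell\in[k]}\mathrm{val}(f,G_\ell)$. An $\alpha$-minimum approximation is a cut $f$ with $\min_\ell \mathrm{val}(f,G_\ell)\ge\alpha\cdot\mathrm{OPT}$. *)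

(* Defs.v *)
From HB Require Import structures.
From mathcomp Require Import all_boot all_order all_algebra.

Set Implicit Arguments.
Unset Strict Implicit.
Unset Printing Implicit Defensive.

Import Order.TTheory GRing.Theory Num.Theory.
Local Open Scope ring_scope.

(** * Simultaneous unweighted Max-Cut *)

(* Edges are two-element sets of vertices: no loops, no multiple edges. *)
Record graph (n : nat) := Graph {
  edges : {set {set 'I_n}};
  edges_card2 : [forall e in edges, #|e| == 2%N]
}.

Definition cut (n : nat) := {ffun 'I_n -> bool}.

Definition is_cut (n : nat) (f : cut n) (e : {set 'I_n}) : bool :=
  [exists x in e, exists y in e, f x != f y].

Definition val_cut (n : nat) (f : cut n) (G : graph n) : rat :=
  \sum_(e in edges G | is_cut f e) #|edges G|%:R^-1.

(* Every [val_cut f G] lies in [0, 1], so for k > 0 the default value 1 of the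
   minimum is harmless, as is the default value 0 of the maximum in [opt]. *)
Definition min_val (n k : nat) (f : cut n) (G : 'I_k -> graph n) : rat :=
  \big[Num.min/1]_(l < k) val_cut f (G l).

Definition opt (n k : nat) (G : 'I_k -> graph n) : rat :=
  \big[Num.max/0]_(f : cut n) min_val f G.

Definition min_approx (n k : nat) (alpha : rat) (G : 'I_k -> graph n)
  (f : cut n) : bool := alpha * opt G <= min_val f G.

(** * Random access machine

   Structured programs over an unbounded memory of natural numbers, with
   direct and indirect addressing.  Each instruction and each test costs one
   unit of time.  There is no multiplication, so t steps lengthen the binary
   representation of the largest number in memory by at most t bits, up to
   the constants of the program; unit-cost time is therefore polynomially
   related to Turing machine time. *)

Definition memory := nat -> nat.

Inductive program :=
| Skip
| Const of nat & nat
| Add of nat & nat & nat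
| Sub of nat & nat & nat
| Half of nat & nat
| Read of nat & nat
| Write of nat & nat
| Seq of program & program
| If of nat & program & program
| While of nat & program.

(* [exec p m t m']: from memory m, the program p halts in exactly t time units
   with memory m'.  Subtraction is truncated and halving rounds down. *)
Inductive exec : program -> memory -> nat -> memory -> Prop :=
| ExecSkip m : exec Skip m 1 m
| ExecConst i c m : exec (Const i c) m 1 [eta m with i |-> c]
| ExecAdd i j l m : exec (Add i j l) m 1 [eta m with i |-> (m j + m l)%N]
| ExecSub i j l m : exec (Sub i j l) m 1 [eta m with i |-> (m j - m l)%N]
| ExecHalf i j m : exec (Half i j) m 1 [eta m with i |-> (m j)./2]
| ExecRead i j m : exec (Read i j) m 1 [eta m with i |-> m (m j)]
| ExecWrite i j m : exec (Write i j) m 1 [eta m with m i |-> m j]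
| ExecSeq p q m1 m2 m3 t1 t2 :
    exec p m1 t1 m2 -> exec q m2 t2 m3 -> exec (Seq p q) m1 (t1 + t2) m3
| ExecIfTrue i p q m m' t :
    m i != 0%N -> exec p m t m' -> exec (If i p q) m t.+1 m'
| ExecIfFalse i p q m m' t :
    m i = 0%N -> exec q m t m' -> exec (If i p q) m t.+1 m'
| ExecWhileStop i p m : m i = 0%N -> exec (While i p) m 1 m
| ExecWhileStep i p m1 m2 m3 t1 t2 :
    m1 i != 0%N -> exec p m1 t1 m2 -> exec (While i p) m2 t2 m3 ->
    exec (While i p) m1 (t1 + t2).+1 m3.

(* n, k, then the k adjacency matrices in row-major order: the entry (i, j) of
   the l-th matrix is in cell 2 + l * n ^ 2 + i * n + j. *)
Definition encode (n k : nat) (G : 'I_k -> graph n) : seq nat :=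
  n :: k :: flatten
    [seq [seq nat_of_bool ([set i; j] \in edges (G l))
         | i <- enum 'I_n, j <- enum 'I_n]
    | l <- enum 'I_k].

Definition input (s : seq nat) : memory := nth 0%N s.

Definition output (n : nat) (m : memory) : cut n :=
  [ffun v : 'I_n => m v != 0%N].

(* Main.v *)
From Pilot Require Import Defs.
From HB Require Import structures.
From mathcomp Require Import all_boot all_order all_algebra.
From mathcomp Require Import zify ring lra.

Set Implicit Arguments.
Unset Strict Implicit.
Unset Printing Implicit Defensive.

Import Order.TTheory GRing.Theory Num.Theory.
Import Pilot.Defs.

(** Two kinds of cuts are tried and the best one, for the minimum of the values,
    is kept.

    If OPT >= 1 - O(1/k^2), the union of the graphs, weighted so that all have
    total weight about 1, is nearly bipartite, up to a fraction O(1/k^2).  The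
    power method for I - D^-1 A, started at all the unit vectors, followed by
    the rounding of Cheeger's inequality, gives a set of vertices with a
    2-colouring for which only a fraction O(1/k) of the incident weight is not
    cut.  These vertices are coloured for ever and one iterates, dropping each
    graph as soon as three quarters of its edges have a coloured end.  The loss
    of each graph is then at most k O(1/k), which is at most 1/16, so that all
    the graphs are cut to 11/16.

    Otherwise it suffices to reach min(OPT, 1/2 - O(1/k^2)).  By the pigeonhole
    principle there is a threshold such that every graph above it has many more
    edges than the square of the number S of vertices touched by the graphs below
    it, with S at most 2^2^O(k).  All 2^S partial cuts of these vertices are
    tried, and extended greedily so that the conditional expectation of the
    squared imbalance of the large graphs, under a uniform extension, does not
    increase; initially it is small, as in Chebyshev's inequality.

    The program is written in a small language with parallel assignments to
    arrays and loops of at most M = n^4 2^2^2^(64k) turns, which is compiled to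
    the random access machine; the running time is a power of M. *)

(** * From a structured language to the random access machine *)

(** The square in 1/k^2 has two sources. Cheeger's inequality turns a deficiency e into sqrt e, and
    one graph may bear the loss of the whole union, so sqrt e must be O(1/k). In the other regime e
    only provides slack: if OPT < 1 - e then (1/2 + e/8) OPT < 1/2 - e/8, so a large graph need only
    be cut almost in half.

    The triple exponential comes from asking for a gap relative to the square of S: successive
    thresholds then grow by cubing, k of them reach 2^2^O(k), and the subsets of S vertices are
    enumerated.

    The machine has neither division nor signed numbers. Hence the cleared denominators of the walk,
    its splitting into a positive and a negative part, integer weights that equalize the graphs only
    up to a factor 2, and quotients compared by cross-multiplication.

    No eigenvector is ever used: monotonicity of Rayleigh quotients follows from Cauchy-Schwarz. The
    good starting vector, the unknown cut itself, is a signed sum of unit vectors, and one of these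
    must serve as well; this replaces a random start. *)

Definition wp (p : program) (B : nat) (Q : memory -> Prop) m :=
  exists t m', [/\ exec p m t m', t <= B & Q m'].

Lemma wp_mono p B B' (Q Q' : memory -> Prop) m :
  wp p B Q m -> B <= B' -> (forall m', Q m' -> Q' m') -> wp p B' Q' m.
Proof.
move=> [t [m' [ex le q]]] leB imp; exists t, m'; split=> //.
  exact: leq_trans leB.
exact: imp.
Qed.

Lemma wp_skip (Q : memory -> Prop) m : Q m -> wp Skip 1 Q m.
Proof. by move=> q; exists 1, m; split=> //; constructor. Qed.

Lemma wp_const i c (Q : memory -> Prop) (m : memory) :
  Q [eta m with i |-> c] -> wp (Const i c) 1 Q m.
Proof. by move=> q; exists 1, [eta m with i |-> c]; split=> //; constructor. Qed.

Lemma wp_add i j l (Q : memory -> Prop) (m : memory) :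
  Q [eta m with i |-> m j + m l] -> wp (Add i j l) 1 Q m.
Proof. by move=> q; eexists 1, _; split; [constructor| |exact: q]. Qed.

Lemma wp_sub i j l (Q : memory -> Prop) (m : memory) :
  Q [eta m with i |-> m j - m l] -> wp (Sub i j l) 1 Q m.
Proof. by move=> q; eexists 1, _; split; [constructor| |exact: q]. Qed.

Lemma wp_half i j (Q : memory -> Prop) (m : memory) :
  Q [eta m with i |-> (m j)./2] -> wp (Half i j) 1 Q m.
Proof. by move=> q; eexists 1, _; split; [constructor| |exact: q]. Qed.

Lemma wp_read i j (Q : memory -> Prop) (m : memory) :
  Q [eta m with i |-> m (m j)] -> wp (Read i j) 1 Q m.
Proof. by move=> q; eexists 1, _; split; [constructor| |exact: q]. Qed.

Lemma wp_write i j (Q : memory -> Prop) (m : memory) :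
  Q [eta m with m i |-> m j] -> wp (Write i j) 1 Q m.
Proof. by move=> q; eexists 1, _; split; [constructor| |exact: q]. Qed.

Lemma wp_seq p q B1 B2 (Q : memory -> Prop) m :
  wp p B1 (wp q B2 Q) m -> wp (Seq p q) (B1 + B2) Q m.
Proof.
move=> [t1 [m1 [e1 l1 [t2 [m2 [e2 l2 q2]]]]]].
by exists (t1 + t2), m2; split=> //; [apply: ExecSeq e1 e2 | apply: leq_add].
Qed.

Lemma wp_if i p q B (Q : memory -> Prop) m :
  (m i != 0 -> wp p B Q m) -> (m i = 0 -> wp q B Q m) -> wp (If i p q) B.+1 Q m.
Proof.
move=> h1 h2; have [z|nz] := eqVneq (m i) 0.
  have [t [m' [e l r]]] := h2 z.
  by exists t.+1, m'; split=> //; apply: ExecIfFalse.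
have [t [m' [e l r]]] := h1 nz.
by exists t.+1, m'; split=> //; apply: ExecIfTrue.
Qed.

(** The actual number [N] of turns may depend on the memory; [N'] enters the cost only, so that
    costs can be stated in terms of [M]. *)
Lemma wp_while c p N N' B (I : nat -> memory -> Prop) (Q : memory -> Prop) m :
  (forall i m, i < N -> I i m -> m c != 0 /\ wp p B (I i.+1) m) ->
  (forall m, I N m -> m c = 0) ->
  I 0 m -> (forall m, I N m -> Q m) -> N <= N' ->
  wp (While c p) (N' * B.+1).+1 Q m.
Proof.
move=> step stop I0 hQ leN; apply: (@wp_mono _ (N * B.+1).+1) hQ; last first.
  by rewrite ltnS leq_mul2r leN orbT.
move: I0.
suff H d i m1 : i + d = N -> I i m1 -> wp (While c p) (d * B.+1).+1 (I N) m1.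
  exact: (H N 0).
elim: d i m1 => [|d IH] i m1.
  rewrite addn0 => -> IN; exists 1, m1; split=> //.
  by apply: ExecWhileStop; apply: stop.
move=> eN Ii.
have [|nz [t [m2 [e l I2]]]] := step i m1 _ Ii; first by rewrite -eN; lia.
have [|t2 [m3 [e2 l2 I3]]] := IH i.+1 m2 _ I2; first by rewrite -eN; lia.
exists (t + t2).+1, m3; split=> //; first exact: ExecWhileStep e2.
by rewrite mulSn; lia.
Qed.

(* Registers are the cells below [R]; the array [a] occupies the cells
   [M + 16 i + a], where [M], kept in register 0, also bounds every loop. *)
Definition R := 200.

(** * Expressions and their compilation *)

Inductive expr :=
| Cst of nat
| Var of nat
| Arr of nat & expr
| Inp of expr
| Plus of expr & expr
| Minus of expr & expr
| Div2 of expr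
| Times of expr & expr
| Cond of bexpr & expr & expr
| Fold of nat & expr & expr & expr
with bexpr :=
| Ble of expr & expr
| Bnot of bexpr
| Band of bexpr & bexpr
| Bor of bexpr & bexpr.

Scheme expr_mut := Induction for expr Sort Prop
  with bexpr_mut := Induction for bexpr Sort Prop.
Combined Scheme expr_bexpr_ind from expr_mut, bexpr_mut.

Definition arrays := nat -> nat -> nat.

Section Eval.
Variables (M : nat) (inp : nat -> nat) (s : arrays).

(** Products are computed by repeated addition in at most [M] turns, hence the cut-off first factor;
    the second one is unrestricted, as the huge entries of the walk require. [Inp] gives 0 outside
    the cells from [R] to [M]: registers lie below, arrays above. *)
Fixpoint eval (env : nat -> nat) (e : expr) : nat :=
  match e with
  | Cst c => c
  | Var x => env x
  | Arr a e => s a (eval env e)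
  | Inp e => if (R <= eval env e) && (eval env e < M) then inp (eval env e) else 0
  | Plus e1 e2 => eval env e1 + eval env e2
  | Minus e1 e2 => eval env e1 - eval env e2
  | Div2 e => (eval env e)./2
  | Times e1 e2 => minn (eval env e1) M * eval env e2
  | Cond b e1 e2 => if beval env b then eval env e1 else eval env e2
  | Fold x b e0 e1 =>
      iteri (minn (eval env b) M)
        (fun i z => eval [eta env with x |-> i, x.+1 |-> z] e1) (eval env e0)
  end
with beval (env : nat -> nat) (b : bexpr) : bool :=
  match b with
  | Ble e1 e2 => eval env e1 <= eval env e2
  | Bnot b => ~~ beval env b
  | Band b1 b2 => beval env b1 && beval env b2
  | Bor b1 b2 => beval env b1 || beval env b2
  end.
End Eval.

(** The result goes to register [r], and only registers from [r] on are used. A copy is an addition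
    to 0, a multiplication by 16 four doublings, and truncated subtraction gives both the
    comparisons and the minima, as a - (a - M) = min a M. *)
Fixpoint ecomp (r : nat) (e : expr) : program :=
  match e with
  | Cst c => Const r c
  | Var x => Seq (Const r 0) (Add r r x)
  | Arr a e =>
      Seq (ecomp r e) (Seq (Add r r r) (Seq (Add r r r) (Seq (Add r r r)
        (Seq (Add r r r) (Seq (Const r.+1 a) (Seq (Add r r r.+1)
        (Seq (Add r r 0) (Read r r))))))))
  | Inp e =>
      Seq (ecomp r e) (Seq (Const r.+1 1) (Seq (Add r.+1 r r.+1)
        (Seq (Const r.+2 R) (Seq (Sub r.+1 r.+1 r.+2)
        (If r.+1 (Seq (Sub r.+1 0 r) (If r.+1 (Read r r) (Const r 0)))
           (Const r 0))))))
  | Plus e1 e2 => Seq (ecomp r e1) (Seq (ecomp r.+1 e2) (Add r r r.+1))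
  | Minus e1 e2 => Seq (ecomp r e1) (Seq (ecomp r.+1 e2) (Sub r r r.+1))
  | Div2 e => Seq (ecomp r e) (Half r r)
  | Times e1 e2 =>
      Seq (ecomp r e1) (Seq (ecomp r.+1 e2) (Seq (Sub r.+2 r 0)
        (Seq (Sub r r r.+2) (Seq (Const r.+2 0) (Seq (Const r.+3 1)
        (Seq (While r (Seq (Add r.+2 r.+2 r.+1) (Sub r r r.+3)))
        (Seq (Const r.+1 0) (Add r r.+2 r.+1))))))))
  | Cond b e1 e2 => Seq (bcomp r b) (If r (ecomp r e1) (ecomp r e2))
  | Fold x b e0 e1 =>
      Seq (ecomp x b) (Seq (Sub x.+1 x 0) (Seq (Sub x.+2 x x.+1)
        (Seq (ecomp x.+3 e0) (Seq (Const x 0) (Seq (Add x.+1 x.+3 x)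
        (Seq (While x.+2
          (Seq (ecomp x.+3 e1) (Seq (Const x.+4 0) (Seq (Add x.+1 x.+3 x.+4)
            (Seq (Const x.+4 1) (Seq (Add x x x.+4) (Sub x.+2 x.+2 x.+4)))))))
        (Seq (Const x.+2 0) (Add r x.+1 x.+2))))))))
  end
with bcomp (r : nat) (b : bexpr) : program :=
  match b with
  | Ble e1 e2 => Seq (ecomp r e1) (Seq (ecomp r.+1 e2) (Seq (Sub r r r.+1)
                   (If r (Const r 0) (Const r 1))))
  | Bnot b => Seq (bcomp r b) (If r (Const r 0) (Const r 1))
  | Band b1 b2 => Seq (bcomp r b1) (If r (bcomp r b2) Skip)
  | Bor b1 b2 => Seq (bcomp r b1) (If r Skip (bcomp r b2))
  end.

(* [vs] lists the registers holding live variables, all below [r]. *)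
Fixpoint ewf (vs : seq nat) (r : nat) (e : expr) : bool :=
  (r + 8 < R) &&
  match e with
  | Cst _ => true
  | Var x => x \in vs
  | Arr a e => (a < 15) && ewf vs r e
  | Inp e | Div2 e => ewf vs r e
  | Plus e1 e2 | Minus e1 e2 | Times e1 e2 => ewf vs r e1 && ewf vs r.+1 e2
  | Cond b e1 e2 => [&& bwf vs r b, ewf vs r e1 & ewf vs r e2]
  | Fold x b e0 e1 => [&& r <= x, ewf vs x b, ewf vs x.+3 e0 &
                          ewf (x :: x.+1 :: vs) x.+3 e1]
  end
with bwf (vs : seq nat) (r : nat) (b : bexpr) : bool :=
  (r + 8 < R) &&
  match b with
  | Ble e1 e2 => ewf vs r e1 && ewf vs r.+1 e2
  | Bnot b => bwf vs r b
  | Band b1 b2 | Bor b1 b2 => bwf vs r b1 && bwf vs r b2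
  end.

Definition sim (M : nat) (inp : nat -> nat) (s : arrays) m :=
  [/\ m 0 = M, forall a i, a < 15 -> m (M + 16 * i + a) = s a i
    & forall ad, R <= ad < M -> m ad = inp ad].

Definition frame (r : nat) (m m' : memory) :=
  forall ad, (ad < r) || (R <= ad) -> m' ad = m ad.

Definition computes p r v B m := wp p B (fun m' => m' r = v /\ frame r m m') m.

Lemma sim_frame M inp s m m' r :
  0 < r -> R <= M -> frame r m m' -> sim M inp s m -> sim M inp s m'.
Proof.
move=> r0 RM fr [h0 ha hi]; split.
- by rewrite fr ?r0.
- by move=> a i lta; rewrite fr ?ha //; apply/orP; right; lia.
- by move=> ad had; rewrite fr ?hi //; apply/orP; right; lia.
Qed.

Lemma frame_trans r m1 m2 m3 : frame r m1 m2 -> frame r m2 m3 -> frame r m1 m3.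
Proof. by move=> h1 h2 ad h; rewrite h2 // h1. Qed.

Lemma frame_le r r' m1 m2 : r <= r' -> frame r' m1 m2 -> frame r m1 m2.
Proof.
move=> le h ad /orP[h1|h1]; apply: h; apply/orP; [left|right] => //.
exact: leq_trans le.
Qed.

Lemma frame_upd r x v m m' :
  r <= x < R -> frame r m m' -> frame r m [eta m' with x |-> v].
Proof.
move=> hx h ad hd /=; case: eqP => [e|_]; last exact: h.
by subst; move: hx hd; rewrite /R; lia.
Qed.

Definition pre M inp s env (vs : seq nat) r (m : memory) :=
  [/\ 2 <= M, R <= M, 0 < r, (forall y, y \in vs -> y < r) &
      sim M inp s m /\ (forall y, y \in vs -> m y = env y)].

Lemma pre_frame M inp s env vs r m m' :
  pre M inp s env vs r m -> frame r m m' -> pre M inp s env vs r m'.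
Proof.
move=> [M2 RM r0 hv [hs hm]] fr; split=> //; split; first exact: sim_frame fr hs.
by move=> y hy; rewrite fr ?hv // hm.
Qed.

Lemma pre_le M inp s env vs r r' m :
  r <= r' -> pre M inp s env vs r m -> pre M inp s env vs r' m.
Proof.
move=> le [M2 RM r0 hv [hs hm]]; split=> //; first exact: leq_trans le.
by move=> y /hv h; apply: leq_trans le.
Qed.

Lemma pre_fold M inp s env vs r m x i z :
  r <= x -> pre M inp s env vs r m -> m x = i -> m x.+1 = z ->
  pre M inp s [eta env with x |-> i, x.+1 |-> z] (x :: x.+1 :: vs) x.+3 m.
Proof.
move=> rx [M2 RM r0 hv [hs hm]] hi hz; split=> //.
  by move=> y; rewrite !inE => /or3P[/eqP->|/eqP->|/hv] //; lia.
split=> // y; rewrite !inE /=.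
case: eqP => [->|_] //=; case: eqP => [->|_] //=.
exact: hm.
Qed.

Definition pbound M K B := B <= M ^ K.

Lemma pbound_const M c : 2 <= M -> pbound M c c.
Proof.
move=> M2; rewrite /pbound; apply: leq_trans (ltnW (ltn_expl c (isT : 1 < 2))) _.
by case: c => [|c]; [rewrite !expn0 | rewrite leq_exp2r].
Qed.

Lemma pbound_add M K1 K2 B1 B2 : 2 <= M ->
  pbound M K1 B1 -> pbound M K2 B2 -> pbound M (K1 + K2).+1 (B1 + B2).
Proof.
rewrite /pbound => M2 h1 h2; apply: leq_trans (leq_add h1 h2) _.
rewrite expnS expnD.
have := expn_gt0 M K1; have := expn_gt0 M K2; rewrite (ltnW M2) /= => p2 p1.
have h : M ^ K1 + M ^ K2 <= 2 * (M ^ K1 * M ^ K2) by nia.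
by apply: leq_trans h _; rewrite leq_mul2r M2 orbT.
Qed.

Lemma pbound_S M K B : 2 <= M -> pbound M K B -> pbound M K.+2 B.+1.
Proof.
move=> M2 h; have := pbound_add M2 h (pbound_const 1 M2).
by rewrite !addn1.
Qed.

Lemma pbound_loop M K B N : 2 <= M -> N <= M ->
  pbound M K B -> pbound M K.+3 (N * B.+1).+1.
Proof.
rewrite /pbound => M2 NM h; rewrite !expnS.
have := expn_gt0 M K; rewrite (ltnW M2) /= => p.
have : (N * B.+1).+1 <= (M * (M ^ K).+1).+1 by rewrite ltnS; apply: leq_mul.
move=> h1; apply: leq_trans h1 _.
have : M * (M ^ K).+1 + 1 <= M * (M * (2 * M ^ K)).
  apply: (@leq_trans (M * (2 * (2 * M^K)))); last by rewrite leq_mul2l leq_mul2r; lia.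
  by nia.
move=> h2; apply: (@leq_trans (M * (M * (2 * M ^ K)))); first by lia.
by rewrite !leq_mul2l leq_mul2r M2 !orbT.
Qed.

Lemma computes_frame p r v B m (Q : memory -> Prop) :
  computes p r v B m ->
  (forall m', m' r = v -> frame r m m' -> Q m') -> wp p B Q m.
Proof. by move=> h hq; apply: wp_mono h _ _ => // m' [h1 h2]; apply: hq. Qed.

(** [K] is chosen before [M], the input and the memory: a fixed program then runs within a fixed
    power of [M]. *)
Definition ecorrect e := exists K, forall M inp s env vs r m,
  pre M inp s env vs r m -> ewf vs r e ->
  computes (ecomp r e) r (eval M inp s env e) (M ^ K) m.

Definition bcorrect b := exists K, forall M inp s env vs r m,
  pre M inp s env vs r m -> bwf vs r b ->
  computes (bcomp r b) r (beval M inp s env b) (M ^ K) m.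

Ltac wstep :=
  first [apply: wp_seq | apply: wp_const | apply: wp_add | apply: wp_sub
    | apply: wp_half | apply: wp_read | apply: wp_write | apply: wp_skip].
Ltac wsteps := repeat wstep.
Ltac pb M2 := repeat first
  [ eassumption | exact: leqnn | apply: (pbound_const _ M2) | apply: (pbound_add M2)
  | apply: (pbound_loop M2) | apply: (pbound_S M2) ].
Ltac upd := rewrite /=; repeat (case: eqP => ?); try lia.

Ltac neqs := repeat match goal with |- context [@eq_op ?T ?a ?b] =>
  first [ have -> : (@eq_op T a b) = false by lia | have -> : (@eq_op T a b) = true by lia ] end.

Lemma frame_refl r m : frame r m m.
Proof. by []. Qed.

Lemma ewf_lt vs r e : ewf vs r e -> r + 8 < R.
Proof. by case: e => [?|?|? ?|?|? ?|? ?|?|? ?|? ? ?|? ? ? ?] /= /andP[]. Qed.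

Ltac fr := repeat first [ exact: frame_refl | assumption
  | apply: frame_upd; first lia ].

(** In the composite cases the exponent stays an existential variable until the cost of the code is
    known; [pb] then builds it along the shape of that cost. *)
Lemma ebcorrect : (forall e, ecorrect e) /\ (forall b, bcorrect b).
Proof.
apply: expr_bexpr_ind.
- move=> c; exists 1 => M inp s env vs r m pr /= /andP[rR _].
  case: (pr) => M2 _ _ _ _.
  apply: wp_mono (_ : wp _ 1 _ _) _ (fun _ h => h); last by rewrite expn1 ltnW.
  by wsteps; split; [rewrite /= eqxx | fr].
- move=> x; exists 2 => M inp s env vs r m pr /= /andP[rR xvs].
  case: (pr) => M2 _ _ hv [_ hm].
  apply: wp_mono (_ : wp _ 2 _ _) _ (fun _ h => h); last exact: pbound_const.
  apply: (@wp_seq _ _ 1 1); wsteps; split; last by fr.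
  have := hv _ xvs; rewrite /= !eqxx => xr.
  by rewrite -(hm _ xvs); upd.
- move=> a e [K IH]; eexists=> M inp s env vs r m pr /= /andP[rR /andP[a15 we]].
  case: (pr) => M2 RM r0 hv [sm hm].
  apply: wp_mono; last by move=> ?; exact.
    apply: wp_seq; apply: computes_frame (IH _ _ _ _ _ _ _ pr we) _ => m' hr hf.
    have [h0 ha _] := sim_frame r0 RM hf sm.
    wsteps; split; last by fr.
    rewrite /=; neqs.
    rewrite hr h0 -(ha a (eval M inp s env e)) //.
    set v := eval _ _ _ _ _.
    have -> : v + v + (v + v) + (v + v + (v + v)) +
      (v + v + (v + v) + (v + v + (v + v))) + a + M = M + 16 * v + a by lia.
    by neqs.
  by pb M2.
- move=> e [K IH]; eexists=> M inp s env vs r m pr /= /andP[rR we].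
  case: (pr) => M2 RM r0 hv [sm hm].
  apply: wp_mono; last by move=> ?; exact.
    apply: wp_seq; apply: computes_frame (IH _ _ _ _ _ _ _ pr we) _ => m' hr hf.
    have [h0 ha hi] := sim_frame r0 RM hf sm.
    set v := eval _ _ _ _ _ in hr *.
    wsteps.
    apply: (@wp_if _ _ _ 3); rewrite /=; neqs; rewrite hr => c1.
      apply: (@wp_seq _ _ 1 2); wsteps.
      apply: (@wp_if _ _ _ 1); rewrite /=; neqs; rewrite h0 hr => c2;
        wsteps; (split; last by fr); rewrite /=; neqs.
        have -> : (R <= v) && (v < M) by apply/andP; split; lia.
        by rewrite hr; neqs; rewrite hi //; apply/andP; split; lia.
      by case: ifP => // /andP[]; lia.
    apply: wp_mono (_ : wp _ 1 _ _) _ (fun _ h => h); last by [].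
    wsteps; (split; last by fr); rewrite /=; neqs.
    by case: ifP => // /andP[]; lia.
  by pb M2.
- move=> e1 [K1 IH1] e2 [K2 IH2]; eexists=> M inp s env vs r m pr /= /and3P[rR w1 w2].
  case: (pr) => M2 RM r0 hv [sm hm].
  apply: wp_mono; last by move=> ?; exact.
    apply: wp_seq; apply: computes_frame (IH1 _ _ _ _ _ _ _ pr w1) _ => m1 hr hf.
    have pr1 := pre_le (leqnSn r) (pre_frame pr hf).
    apply: wp_seq; apply: computes_frame (IH2 _ _ _ _ _ _ _ pr1 w2) _ => m2 hr2 hf2.
    wsteps; split; first by rewrite /= eqxx hr2 hf2 ?ltnSn // hr.
    apply: frame_upd; first lia.
    by apply: frame_trans hf (frame_le _ hf2); lia.
  by pb M2.
- move=> e1 [K1 IH1] e2 [K2 IH2]; eexists=> M inp s env vs r m pr /= /and3P[rR w1 w2].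
  case: (pr) => M2 RM r0 hv [sm hm].
  apply: wp_mono; last by move=> ?; exact.
    apply: wp_seq; apply: computes_frame (IH1 _ _ _ _ _ _ _ pr w1) _ => m1 hr hf.
    have pr1 := pre_le (leqnSn r) (pre_frame pr hf).
    apply: wp_seq; apply: computes_frame (IH2 _ _ _ _ _ _ _ pr1 w2) _ => m2 hr2 hf2.
    wsteps; split; first by rewrite /= eqxx hr2 hf2 ?ltnSn // hr.
    apply: frame_upd; first lia.
    by apply: frame_trans hf (frame_le _ hf2); lia.
  by pb M2.
- move=> e [K IH]; eexists=> M inp s env vs r m pr /= /andP[rR we].
  case: (pr) => M2 RM r0 hv [sm hm].
  apply: wp_mono; last by move=> ?; exact.
    apply: wp_seq; apply: computes_frame (IH _ _ _ _ _ _ _ pr we) _ => m1 hr hf.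
    wsteps; split; first by rewrite /= eqxx hr.
    by fr.
  by pb M2.
- move=> e1 [K1 IH1] e2 [K2 IH2]; eexists=> M inp s env vs r m pr /= /and3P[rR w1 w2].
  case: (pr) => M2 RM r0 hv [sm hm].
  apply: wp_mono; last by move=> ?; exact.
    apply: wp_seq; apply: computes_frame (IH1 _ _ _ _ _ _ _ pr w1) _ => m1 hr hf.
    have pr1 := pre_le (leqnSn r) (pre_frame pr hf).
    apply: wp_seq; apply: computes_frame (IH2 _ _ _ _ _ _ _ pr1 w2) _ => m2 hr2 hf2.
    have hf3 : frame r m m2 by apply: frame_trans hf (frame_le _ hf2); lia.
    have [h0 _ _] := sim_frame r0 RM hf3 sm.
    have hr' : m2 r = eval M inp s env e1 by rewrite hf2 ?ltnSn.
    move: (eval M inp s env e1) (eval M inp s env e2) hr' hr2 => v1 v2 hr' hr2.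
    wsteps.
    match goal with |- wp _ _ _ ?x => set m3 := x end.
    apply: (@wp_while _ _ (minn v1 M) M _
      (fun i m' => [/\ frame r m m', m' r = minn v1 M - i, m' r.+1 = v2,
         m' r.+3 = 1 & m' r.+2 = i * v2])).
    + move=> i m' hi [i1 i2 i3 i4 i5]; split; first by rewrite i2; lia.
      apply: (@wp_seq _ _ 1 1); wsteps; split; [by fr | | | |];
        by rewrite /=; neqs; rewrite ?i2 ?i3 ?i4 ?i5 ?mulSn; try lia.
    + by move=> m' [_ -> _ _ _]; rewrite subnn.
    + split; rewrite /m3; [by fr | | | |]; rewrite /=; neqs; rewrite ?hr' ?h0; try lia.
    + move=> m' [i1 i2 i3 i4 i5]; wsteps; split; last by fr.
      by rewrite /=; neqs; rewrite i5; lia.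
    + exact: geq_minr.
  rewrite /pbound; pb M2.
- move=> b [K IH] e1 [K1 IH1] e2 [K2 IH2]; eexists=> M inp s env vs r m pr /=.
  move=> /and4P[rR w w1 w2]; case: (pr) => M2 RM r0 hv [sm hm].
  apply: wp_mono; last by move=> ?; exact.
    apply: wp_seq; apply: computes_frame (IH _ _ _ _ _ _ _ pr w) _ => m1 hr hf.
    have pr1 := pre_frame pr hf.
    apply: (@wp_if _ _ _ (M ^ K1 + M ^ K2)); rewrite hr => h.
      have -> : beval M inp s env b by move: h; case: beval.
      apply: wp_mono (IH1 _ _ _ _ _ _ _ pr1 w1) (leq_addr _ _) _ => m2 [h1 h2].
      by split=> //; apply: frame_trans hf h2.
    have -> : beval M inp s env b = false by move: h; case: beval.
    apply: wp_mono (IH2 _ _ _ _ _ _ _ pr1 w2) (leq_addl _ _) _ => m2 [h1 h2].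
    by split=> //; apply: frame_trans hf h2.
  by pb M2.
- move=> x b [K IH] e0 [K0 IH0] e1 [K1 IH1]; eexists=> M inp s env vs r m pr /=.
  move=> /andP[rR /and4P[rx wb w0 w1]]; case: (pr) => M2 RM r0 hv [sm hm].
  have xR := ewf_lt wb; have xR' := ewf_lt w0.
  apply: wp_mono; last by move=> ?; exact.
    have prx := pre_le rx pr.
    apply: wp_seq; apply: computes_frame (IH _ _ _ _ _ _ _ prx wb) _ => m1 hr /(frame_le rx) hf.
    have [h0 _ _] := sim_frame r0 RM hf sm.
    move: (eval M inp s env b) hr => v hr.
    apply: wp_seq; wstep; apply: wp_seq; wstep.
    match goal with |- wp _ _ _ ?x => set m2 := x end.
    have hf2 : frame r m m2 by rewrite /m2; fr.
    have m2c : m2 x.+2 = minn v M by rewrite /m2 /=; neqs; rewrite hr h0; lia.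
    have pr2 : pre M inp s env vs x.+3 m2.
      by apply: pre_le (pre_frame pr hf2); lia.
    apply: wp_seq; apply: computes_frame (IH0 _ _ _ _ _ _ _ pr2 w0) _ => m3 hr3 hf3.
    have hf3' : frame r m m3 by apply: frame_trans hf2 (frame_le _ hf3); lia.
    have m3c : m3 x.+2 = minn v M by rewrite hf3 //; lia.
    move: (eval M inp s env e0) hr3 => z0 hr3.
    apply: wp_seq; wstep; apply: wp_seq; wstep.
    match goal with |- wp _ _ _ ?x => set m4 := x end.
    apply: wp_seq.
    pose g i z := eval M inp s [eta env with x |-> i, x.+1 |-> z] e1.
    apply: (@wp_while _ _ (minn v M) M _
      (fun i m' => [/\ frame r m m', m' x.+2 = minn v M - i, m' x = i
                     & m' x.+1 = iteri i g z0])).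
    + move=> i m' hi [i1 i2 i3 i4]; split; first by rewrite i2; lia.
      have pr' := pre_fold rx (pre_frame pr i1) i3 i4.
      apply: wp_seq; apply: computes_frame (IH1 _ _ _ _ _ _ _ pr' w1) _ => m5 hr5 hf5.
      wsteps; split.
      * by fr; apply: frame_trans i1 (frame_le _ hf5); lia.
      * by rewrite /=; neqs; rewrite (hf5 x.+2) ?i2; lia.
      * by rewrite /=; neqs; rewrite (hf5 x) ?i3; lia.
      * by rewrite /=; neqs; rewrite hr5 addn0.
    + by move=> m' [_ -> _ _]; rewrite subnn.
    + split; rewrite /m4; [by fr | | |]; rewrite /=; neqs => //=.
      - by rewrite m3c subn0.
      - by rewrite hr3 addn0.
    + move=> m' [i1 i2 i3 i4]; wsteps; split; last by fr.
      by rewrite /=; neqs; rewrite i4 addn0.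
    + exact: geq_minr.
  by rewrite /pbound; pb M2.
- move=> e1 [K1 IH1] e2 [K2 IH2]; eexists=> M inp s env vs r m pr /= /and3P[rR w1 w2].
  case: (pr) => M2 RM r0 hv [sm hm].
  apply: wp_mono; last by move=> ?; exact.
    apply: wp_seq; apply: computes_frame (IH1 _ _ _ _ _ _ _ pr w1) _ => m1 hr hf.
    have pr1 := pre_le (leqnSn r) (pre_frame pr hf).
    apply: wp_seq; apply: computes_frame (IH2 _ _ _ _ _ _ _ pr1 w2) _ => m2 hr2 hf2.
    have hf3 : frame r m m2 by apply: frame_trans hf (frame_le _ hf2); lia.
    have hr' : m2 r = eval M inp s env e1 by rewrite hf2 ?ltnSn.
    wsteps; apply: (@wp_if _ _ _ 1); rewrite /=; neqs; rewrite hr' hr2 => h;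
      wsteps; (split; last by fr); rewrite /=; neqs; rewrite leqNgt; lia.
  by pb M2.
- move=> b [K IH]; eexists=> M inp s env vs r m pr /= /andP[rR we].
  case: (pr) => M2 RM r0 hv [sm hm].
  apply: wp_mono; last by move=> ?; exact.
    apply: wp_seq; apply: computes_frame (IH _ _ _ _ _ _ _ pr we) _ => m1 hr hf.
    apply: (@wp_if _ _ _ 1) => h; wsteps; (split; last by fr); rewrite /=; neqs.
      by move: h; rewrite hr; case: beval.
    by move: h; rewrite hr; case: beval.
  by pb M2.
- move=> b1 [K1 IH1] b2 [K2 IH2]; eexists=> M inp s env vs r m pr /= /and3P[rR w1 w2].
  case: (pr) => M2 RM r0 hv [sm hm].
  apply: wp_mono; last by move=> ?; exact.
    apply: wp_seq; apply: computes_frame (IH1 _ _ _ _ _ _ _ pr w1) _ => m1 hr hf.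
    apply: (@wp_if _ _ _ (M ^ K2)); rewrite hr => h.
      have -> : beval M inp s env b1 by move: h; case: beval.
      apply: computes_frame (IH2 _ _ _ _ _ _ _ (pre_frame pr hf) w2) _ => m2 hr2 hf2.
      by split; [exact: hr2 | exact: frame_trans hf hf2].
    apply: (wp_mono (B := 1)) _ _ (fun _ h => h); last by rewrite expn_gt0; lia.
    by wsteps; split=> //; rewrite hr; move: h; case: beval.
  by pb M2.
- move=> b1 [K1 IH1] b2 [K2 IH2]; eexists=> M inp s env vs r m pr /= /and3P[rR w1 w2].
  case: (pr) => M2 RM r0 hv [sm hm].
  apply: wp_mono; last by move=> ?; exact.
    apply: wp_seq; apply: computes_frame (IH1 _ _ _ _ _ _ _ pr w1) _ => m1 hr hf.
    apply: (@wp_if _ _ _ (M ^ K2)); rewrite hr => h.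
      have hb : beval M inp s env b1 by move: h; case: beval.
      apply: (wp_mono (B := 1)) _ _ (fun _ h => h); last by rewrite expn_gt0; lia.
      by wsteps; split=> //; rewrite hr hb.
    have -> : beval M inp s env b1 = false by move: h; case: beval.
    apply: computes_frame (IH2 _ _ _ _ _ _ _ (pre_frame pr hf) w2) _ => m2 hr2 hf2.
    by split; [exact: hr2 | exact: frame_trans hf hf2].
  by pb M2.
Qed.

(** * Statements: parallel array assignments and bounded loops *)

Inductive stmt :=
| Fill of nat & nat & expr & expr
| SSeq of stmt & stmt
| SIf of bexpr & stmt
| SFor of nat & expr & stmt.

Fixpoint den (M : nat) (inp : nat -> nat) (env : nat -> nat) (p : stmt)
    (s : arrays) : arrays :=
  match p with
  | Fill a x b e => fun a' i =>
      if (a' == a) && (i < minn (eval M inp s env b) M)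
      then eval M inp s [eta env with x |-> i] e else s a' i
  | SSeq p q => den M inp env q (den M inp env p s)
  | SIf b p => if beval M inp s env b then den M inp env p s else s
  | SFor x b p => iteri (minn (eval M inp s env b) M)
      (fun i s => den M inp [eta env with x |-> i] p s) s
  end.

Definition cell_address x a q := Seq (Const x.+4 0) (Seq (Add x.+4 x.+4 x)
  (Seq (Add x.+4 x.+4 x.+4) (Seq (Add x.+4 x.+4 x.+4)
  (Seq (Add x.+4 x.+4 x.+4) (Seq (Add x.+4 x.+4 x.+4)
  (Seq (Const x.+4.+1 a) (Seq (Add x.+4 x.+4 x.+4.+1)
  (Seq (Add x.+4 x.+4 0) q)))))))).

Lemma wp_cell_address x a q B Q m : 0 < x ->
  (forall m', m' x.+4 = m 0 + 16 * m x + a ->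
    (forall ad, ad != x.+4 -> ad != x.+4.+1 -> m' ad = m ad) -> wp q B Q m') ->
  wp (cell_address x a q) (9 + B) Q m.
Proof.
move=> x0 H; do 9 (apply: (@wp_seq _ _ 1); wstep); apply: H => [|ad h1 h2].
  by rewrite /=; neqs; lia.
by rewrite /= (negbTE h1) (negbTE h2).
Qed.

(* The values are first stored in the scratch array 15, so that [Fill] is a
   parallel assignment. *)
Fixpoint scomp (r : nat) (p : stmt) : program :=
  match p with
  | Fill a x b e =>
      let next := Seq (Const x.+3 1) (Seq (Add x x x.+3) (Sub x.+1 x.+1 x.+3)) in
      Seq (ecomp x b) (Seq (Sub x.+1 x 0) (Seq (Sub x.+1 x x.+1)
        (Seq (Const x 0) (Seq (Add x.+2 x.+1 x)
        (Seq (While x.+1 (Seq (ecomp x.+3 e) (cell_address x 15 (Seq (Write x.+4 x.+3) next))))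
        (Seq (Const x 0) (Seq (Add x.+1 x.+2 x)
        (While x.+1 (cell_address x 15 (Seq (Read x.+3 x.+4) (Seq (Const x.+4.+1 (15 - a))
          (Seq (Sub x.+4 x.+4 x.+4.+1) (Seq (Write x.+4 x.+3) next)))))))))))))
  | SSeq p q => Seq (scomp r p) (scomp r q)
  | SIf b p => Seq (bcomp r b) (If r (scomp r p) Skip)
  | SFor x b p =>
      Seq (ecomp x b) (Seq (Sub x.+1 x 0) (Seq (Sub x.+1 x x.+1)
        (Seq (Const x 0)
        (While x.+1 (Seq (scomp x.+2 p) (Seq (Const x.+2 1)
          (Seq (Add x x x.+2) (Sub x.+1 x.+1 x.+2))))))))
  end.

Fixpoint swf (vs : seq nat) (r : nat) (p : stmt) : bool :=
  match p with
  | Fill a x b e => [&& a < 15, r <= x, ewf vs x b & ewf (x :: vs) x.+3 e]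
  | SSeq p q => swf vs r p && swf vs r q
  | SIf b p => bwf vs r b && swf vs r p
  | SFor x b p => [&& r <= x, ewf vs x b & swf (x :: vs) x.+2 p]
  end.

Lemma pre_var M inp s env vs r m x i r' :
  r <= x < r' -> pre M inp s env vs r m -> m x = i ->
  pre M inp s [eta env with x |-> i] (x :: vs) r' m.
Proof.
move=> /andP[rx xr] [M2 RM r0 hv [hs hm]] hi; split=> //; first lia.
  by move=> y; rewrite !inE => /orP[/eqP->|/hv] //; lia.
split=> // y; rewrite !inE /=; case: eqP => [->|_] //=; exact: hm.
Qed.

Lemma pre_sim M inp s s' env vs r m m' :
  pre M inp s env vs r m -> sim M inp s' m' ->
  (forall ad, ad < r -> m' ad = m ad) -> pre M inp s' env vs r m'.
Proof.
move=> [M2 RM r0 hv [hs hm]] hs' fr; split=> //; split=> // y hy.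
by rewrite fr ?hm ?hv.
Qed.

Definition scorrect p := exists K, forall M inp s env vs r m,
  pre M inp s env vs r m -> swf vs r p ->
  wp (scomp r p) (M ^ K) (fun m' => sim M inp (den M inp env p s) m' /\
     forall ad, ad < r -> m' ad = m ad) m.

Lemma address_inj M i j a b : a < 16 -> b < 16 ->
  (M + 16 * i + a == M + 16 * j + b) = (i == j) && (a == b).
Proof. by move=> ha hb; apply/idP/idP => [|/andP[/eqP-> /eqP->]] //; lia. Qed.

Lemma fill_correct a x b e : scorrect (Fill a x b e).
Proof.
have [[Kb IHb] [K IH]] := (ebcorrect.1 b, ebcorrect.1 e).
eexists=> M inp s env vs r m pr /= /and4P[a15 rx wb we].
case: (pr) => M2 RM r0 hv [sm hm].
have xR := ewf_lt we.
apply: wp_mono; last by move=> ?; exact.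
  have prx := pre_le rx pr.
  apply: wp_seq; apply: computes_frame (IHb _ _ _ _ _ _ _ prx wb) _ => m1 hr hf.
  have [h0 ha hi] := sim_frame r0 RM (frame_le rx hf) sm.
  set N := eval M inp s env b in hr *.
  wsteps.
  match goal with |- wp _ _ _ ?x => set m2 := x end.
  have hf2 : frame x m m2 by rewrite /m2; fr.
  have m2i : m2 x = 0 by rewrite /m2 /=; neqs.
  have m2c : m2 x.+1 = minn N M by rewrite /m2 /=; neqs; rewrite hr h0; lia.
  have m2d : m2 x.+2 = minn N M by rewrite /m2 /=; neqs; rewrite hr h0; lia.
  move: m2 hf2 m2i m2c m2d; clear m1 hr hf h0 ha hi => m2 hf2 m2i m2c m2d.
  pose v i := eval M inp s [eta env with x |-> i] e.
  apply: (@wp_while _ _ (minn N M) M _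
    (fun i m' => [/\ (forall ad, ad < x -> m' ad = m ad), m' x.+2 = minn N M,
      m' x = i, m' x.+1 = minn N M - i & sim M inp s m' /\
      forall j, j < i -> m' (M + 16 * j + 15) = v j])).
  + move=> i m' hiN [i1 i2 i3 i4 [i5 i6]]; split; first by rewrite i4; lia.
    have pr' : pre M inp s [eta env with x |-> i] (x :: vs) x.+3 m'.
      apply: (@pre_var _ _ _ _ _ r) => //; first lia.
      by apply: pre_sim pr i5 _ => ad h; apply: i1; lia.
    apply: wp_seq; apply: computes_frame (IH _ _ _ _ _ _ _ pr' we) _ => m5 hr5 hf5.
    have [s0 sa si] := sim_frame (ltn0Sn x.+2) RM hf5 i5.
    have hx : m5 x = i by rewrite hf5 ?i3 //; lia.
    apply: wp_cell_address => [|m6]; first lia.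
    rewrite hx s0 => h6 hf6.
    wsteps.
    rewrite /=; neqs; rewrite /= h6 (hf6 x.+3) ?hr5; try lia.
    split.
    * by move=> ad had /=; neqs; rewrite hf6 ?hf5 ?i1 //; lia.
    * by rewrite /=; neqs; rewrite hf6 ?hf5 ?i2 //; lia.
    * by rewrite /=; neqs; rewrite hf6 ?hx ?addn1 //; lia.
    * by rewrite /=; neqs; rewrite hf6 ?hf5 ?i4 //; lia.
    * split; last first.
        move=> j hj /=; neqs.
        rewrite address_inj // andbT; case: eqP => [->|ne] //.
        by rewrite hf6 ?hf5 ?i6; lia.
      split.
      - by rewrite /=; neqs; rewrite hf6 ?s0 //; lia.
      - move=> a' j ha' /=; neqs.
        by rewrite hf6 ?sa //; lia.
      - by move=> ad had /=; neqs; rewrite hf6 ?si //; lia.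
  + by move=> m' [_ _ _ -> _]; rewrite subnn.
  + split=> //; first by move=> ad had; rewrite hf2 // had.
      by rewrite m2c subn0.
    by split=> //; apply: sim_frame (frame_le rx hf2) sm.
  + move=> m3 [i1 i2 i3 i4 [i5 i6]]; wsteps.
    match goal with |- wp _ _ _ ?x => set m4 := x end.
    have p1 : forall ad, (ad < x) || (R <= ad) -> m4 ad = m3 ad.
      by move=> ad had; rewrite /m4 /=; neqs.
    have p2 : m4 x.+2 = minn N M by rewrite /m4 /=; neqs.
    have p3 : m4 x = 0 by rewrite /m4 /=; neqs.
    have p4 : m4 x.+1 = minn N M by rewrite /m4 /=; neqs; rewrite i2 addn0.
    apply: (@wp_while _ _ (minn N M) M _
      (fun i m' => [/\ (forall ad, ad < x -> m' ad = m ad), m' x = i,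
        m' x.+1 = minn N M - i,
        sim M inp (fun a' j => if (a' == a) && (j < i) then v j else s a' j) m' &
        forall j, j < minn N M -> m' (M + 16 * j + 15) = v j])).
    - move=> i m' hiN [q1 q2 q3 [s0 sa si] q5]; split; first by rewrite q3; lia.
      apply: wp_cell_address => [|m6]; first lia.
      rewrite q2 s0 => h6 hf6.
      wsteps; rewrite /=; neqs; rewrite /= h6; neqs.
      rewrite (hf6 (M + 16 * i + 15)) ?q5 //; try lia.
      have -> : M + 16 * i + 15 - (15 - a) = M + 16 * i + a by lia.
      split.
      * by move=> ad had /=; neqs; rewrite hf6 ?q1 //; lia.
      * by rewrite /=; neqs; rewrite hf6 ?q2 ?addn1 //; lia.
      * by rewrite /=; neqs; rewrite hf6 ?q3; lia.
      * split.
        - by rewrite /=; neqs; rewrite hf6 ?s0 //; lia.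
        - move=> a' j ha' /=; neqs.
          rewrite address_inj; [|lia|lia].
          rewrite hf6 ?sa // ?ltnS; try lia.
          case: (a' =P a) => [->|ne] /=; last by rewrite andbF.
          rewrite andbT; case: (ltngtP j i) => [||->] //.
        - by move=> ad had /=; neqs; rewrite hf6 ?si //; lia.
      * by move=> j hj /=; neqs; rewrite hf6 ?q5 //; lia.
    - by move=> m' [_ _ -> _ _]; rewrite subnn.
    - split=> //.
      * by move=> ad had; rewrite p1 ?had // i1.
      * by rewrite p4 subn0.
      * case: i5 => s0 sa si; split.
        - by rewrite p1 ?s0 //; lia.
        - by move=> a' j ha'; rewrite ltn0 andbF p1 ?sa //; lia.
        - by move=> ad had; rewrite p1 ?si //; lia.
      * by move=> j hj; rewrite p1 ?i6 //; lia.
    - by move=> m' [q1 q2 q3 q4 q5]; split=> // ad had; apply: q1; lia.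
    - exact: geq_minr.
  + exact: geq_minr.
by rewrite /pbound; pb M2.
Qed.

Lemma stmt_correct p : scorrect p.
Proof.
elim: p => [a x b e|p [K1 IH1] q [K2 IH2]|b p [K IH]|x b p [K IH]].
- exact: fill_correct.
- eexists=> M inp s env vs r m pr /= /andP[w1 w2].
  case: (pr) => M2 RM r0 hv [sm hm].
  apply: wp_mono; last by move=> ?; exact.
    apply: wp_seq; apply: wp_mono (IH1 _ _ _ _ _ _ _ pr w1) (leqnn _) _ => m1 [s1 h1].
    apply: wp_mono (IH2 _ _ _ _ _ _ _ (pre_sim pr s1 h1) w2) (leqnn _) _ => m2 [s2 h2].
    by split=> // ad had; rewrite h2 ?h1.
  by rewrite /pbound; pb M2.
- have [Kb IHb] := ebcorrect.2 b.
  eexists=> M inp s env vs r m pr /= /andP[w1 w2].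
  case: (pr) => M2 RM r0 hv [sm hm].
  apply: wp_mono; last by move=> ?; exact.
    apply: wp_seq; apply: computes_frame (IHb _ _ _ _ _ _ _ pr w1) _ => m1 hr hf.
    apply: (@wp_if _ _ _ (M ^ K)); rewrite hr => h.
      have -> : beval M inp s env b by move: h; case: beval.
      apply: wp_mono (IH _ _ _ _ _ _ _ (pre_frame pr hf) w2) (leqnn _) _ => m2 [s2 h2].
      by split=> // ad had; rewrite h2 ?hf ?had.
    have -> : beval M inp s env b = false by move: h; case: beval.
    apply: (wp_mono (B := 1)) _ _ (fun _ h => h); last by rewrite expn_gt0; lia.
    wsteps; split; first exact: sim_frame hf sm.
    by move=> ad had; rewrite hf ?had.
  by rewrite /pbound; pb M2.
- have [Kb IHb] := ebcorrect.1 b.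
  eexists=> M inp s env vs r m pr /= /and3P[rx wb w2].
  case: (pr) => M2 RM r0 hv [sm hm].
  have xR := ewf_lt wb.
  apply: wp_mono; last by move=> ?; exact.
    have prx := pre_le rx pr.
    apply: wp_seq; apply: computes_frame (IHb _ _ _ _ _ _ _ prx wb) _ => m1 hr hf.
    have [h0 ha hi] := sim_frame r0 RM (frame_le rx hf) sm.
    set N := eval M inp s env b in hr *.
    wsteps.
    match goal with |- wp _ _ _ ?x => set m2 := x end.
    have hf2 : frame x m m2 by rewrite /m2; fr.
    have m2i : m2 x = 0 by rewrite /m2 /=; neqs.
    have m2c : m2 x.+1 = minn N M by rewrite /m2 /=; neqs; rewrite hr h0; lia.
    move: m2 hf2 m2i m2c; clear m1 hr hf h0 ha hi => m2 hf2 m2i m2c.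
    pose g i s := den M inp [eta env with x |-> i] p s.
    apply: (@wp_while _ _ (minn N M) M _
      (fun i m' => [/\ (forall ad, ad < x -> m' ad = m ad),
        m' x = i, m' x.+1 = minn N M - i & sim M inp (iteri i g s) m'])).
    + move=> i m' hiN [i1 i2 i3 i4]; split; first by rewrite i3; lia.
      have pr' : pre M inp (iteri i g s) [eta env with x |-> i] (x :: vs) x.+2 m'.
        apply: (@pre_var _ _ _ _ _ r) => //; first lia.
        by apply: pre_sim pr i4 _ => ad h; apply: i1; lia.
      apply: wp_seq; apply: wp_mono (IH _ _ _ _ _ _ _ pr' w2) (leqnn _) _ => m5 [s5 h5].
      wsteps; split.
      * by move=> ad had /=; neqs; rewrite h5 ?i1 //; lia.
      * by rewrite /=; neqs; rewrite h5 ?i2 //; lia.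
      * by rewrite /=; neqs; rewrite h5 ?i3 //; lia.
      * rewrite /=; case: s5 => s0 sa si; split; rewrite /=.
        - by neqs.
        - by move=> a' j ha'; neqs; rewrite sa.
        - by move=> ad had; neqs; rewrite si.
    + by move=> m' [_ _ -> _]; rewrite subnn.
    + split=> //; first by move=> ad had; rewrite hf2 // had.
        by rewrite m2c subn0.
      exact: sim_frame (frame_le rx hf2) sm.
    + by move=> m' [i1 i2 i3 i4]; split=> // ad had; apply: i1; lia.
    + exact: geq_minr.
  by rewrite /pbound; pb M2.
Qed.

(** * Computing the loop bound and writing the output *)

Definition rep_add c z w o := While c (Seq (Add z z w) (Sub c c o)).

Lemma wp_rep_add c z w o N (Q : memory -> Prop) m :
  c != z -> o != z -> o != c -> w != z -> w != c -> m o = 1 -> m c <= N ->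
  (forall m', m' z = m z + m c * m w ->
     (forall ad, ad != z -> ad != c -> m' ad = m ad) -> Q m') ->
  wp (rep_add c z w o) (N * 3).+1 Q m.
Proof.
move=> cz oz oc wz wc ho hN H.
apply: (@wp_while _ _ (m c) N 2 (fun i m' => [/\ m' c = m c - i,
  m' z = m z + i * m w & forall ad, ad != z -> ad != c -> m' ad = m ad])) => //.
- move=> i m' hi [h1 h2 h3]; split; first by rewrite h1; lia.
  apply: (@wp_seq _ _ 1 1); wsteps; split.
  + by rewrite /=; neqs; rewrite h1 h3 // ho; lia.
  + by rewrite /=; neqs; rewrite h2 h3 // mulSn; lia.
  + by move=> ad h4 h5 /=; rewrite (negbTE h4) (negbTE h5) h3.
- by move=> m' [-> _ _]; rewrite subnn.
- by split; rewrite ?subn0 ?addn0.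
- by move=> m' [_ h2 h3]; apply: H.
Qed.

(** With the accumulator as its own summand, the multiplication loop doubles it at each turn: this
    yields the exponentials. *)
Lemma wp_rep_double c z o N (Q : memory -> Prop) m :
  c != z -> o != z -> o != c -> m o = 1 -> m c <= N ->
  (forall m', m' z = m z * 2 ^ m c ->
     (forall ad, ad != z -> ad != c -> m' ad = m ad) -> Q m') ->
  wp (rep_add c z z o) (N * 3).+1 Q m.
Proof.
move=> cz oz oc ho hN H.
apply: (@wp_while _ _ (m c) N 2 (fun i m' => [/\ m' c = m c - i,
  m' z = m z * 2 ^ i & forall ad, ad != z -> ad != c -> m' ad = m ad])) => //.
- move=> i m' hi [h1 h2 h3]; split; first by rewrite h1; lia.
  apply: (@wp_seq _ _ 1 1); wsteps; split.
  + by rewrite /=; neqs; rewrite h1 h3 // ho; lia.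
  + by rewrite /=; neqs; rewrite h2 expnS; lia.
  + by move=> ad h4 h5 /=; rewrite (negbTE h4) (negbTE h5) h3.
- by move=> m' [-> _ _]; rewrite subnn.
- by split; rewrite ?subn0 ?expn0 ?muln1.
- by move=> m' [_ h2 h3]; apply: H.
Qed.

(** [2 ^ (2 ^ (64 * k))] bounds the number of vertices touched by the small graphs (see
    [threshold_le]), so [tower k] bounds the number of their partial cuts. The factor [n ^ 4] in
    [fuel] covers the polynomial quantities of [bounds]. *)
Definition tower k := 2 ^ (2 ^ (2 ^ (64 * k))).
Definition fuel n k := n ^ 4 * tower k.

(** [n] and [k] first move up by one cell, to free register 0 for [M]. *)
Definition setup : program :=
  Seq (Const 3 0) (Seq (Add 2 1 3) (Seq (Add 1 0 3) (Seq (Const 3 1)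
  (Seq (Const 4 64) (Seq (Const 5 0) (Seq (Const 7 0) (Seq (Add 6 2 7)
  (Seq (rep_add 6 5 4 3) (Seq (Const 7 1) (Seq (rep_add 5 7 7 3)
  (Seq (Const 8 1) (Seq (rep_add 7 8 8 3) (Seq (Const 9 1) (Seq (rep_add 8 9 9 3)
  (Seq (Const 10 0) (Seq (Const 5 0) (Seq (Add 5 5 1) (Seq (rep_add 5 10 9 3)
  (Seq (Const 9 0) (Seq (Const 5 0) (Seq (Add 5 5 1) (Seq (rep_add 5 9 10 3)
  (Seq (Const 10 0) (Seq (Const 5 0) (Seq (Add 5 5 1) (Seq (rep_add 5 10 9 3)
  (Seq (Const 0 0) (Seq (Const 5 0) (Seq (Add 5 5 1)
    (rep_add 5 0 10 3)))))))))))))))))))))))))))))).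

Lemma leq_exp2 a : a <= 2 ^ a.
Proof. exact/ltnW/ltn_expl. Qed.

Ltac far f := let ad := fresh in let h := fresh in let h' := fresh in
  move=> ad h; have h' : 200 <= ad := h;
  rewrite f; [rewrite /=; neqs | lia | lia].

Lemma setup_correct : exists K, forall n k (m : memory), 0 < n -> m 0 = n -> m 1 = k ->
  wp setup (fuel n k ^ K) (fun m' => [/\ m' 0 = fuel n k, m' 1 = n, m' 2 = k
    & forall ad, R <= ad -> m' ad = m ad]) m.
Proof.
eexists=> n k m n0 hn hk.
have n4 : 0 < n ^ 4 by rewrite expn_gt0 n0.
have l1 : 64 * k <= 2 ^ (64 * k) := leq_exp2 _.
have l2 : 2 ^ (64 * k) <= 2 ^ (2 ^ (64 * k)) := leq_exp2 _.
have l3 : 2 ^ (2 ^ (64 * k)) <= tower k := leq_exp2 _.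
have l4 : tower k <= fuel n k by rewrite /fuel leq_pmull.
have l5 : n <= fuel n k.
  have := expn_gt0 2 (2 ^ (2 ^ (64 * k))); rewrite -/(tower k) /fuel /= => t0.
  apply: leq_trans (leq_pmulr _ t0); rewrite expnS leq_pmulr //.
  by rewrite expn_gt0 n0.
have M2 : 2 <= fuel n k.
  by apply: leq_trans l4; rewrite /tower -{1}(expn1 2) leq_exp2l // expn_gt0.
apply: wp_mono; last by move=> ?; exact.
  do 8 (apply: wp_seq; wstep).
  apply: wp_seq; apply: (@wp_rep_add _ _ _ _ (fuel n k)) => //.
    by rewrite /= hk; lia.
  move=> m1 /= h1 f1; rewrite !addn0 add0n hk in h1.
  have m13 : m1 3 = 1 by rewrite f1.
  have m11 : m1 1 = n by rewrite f1 // /= hn addn0.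
  have m12 : m1 2 = k by rewrite f1 // /= hk addn0.
  have g1 : forall ad, R <= ad -> m1 ad = m ad.
    by far f1.
  clear f1.
  apply: wp_seq; wstep.
  apply: wp_seq; apply: (@wp_rep_double _ _ _ (fuel n k)) => //=; first by rewrite h1; lia.
  move=> m2 /= h2 f2; rewrite mul1n h1 (mulnC k) in h2.
  have m23 : m2 3 = 1 by rewrite f2.
  have m21 : m2 1 = n by rewrite f2 // /= hn addn0.
  have m22 : m2 2 = k by rewrite f2 // /= hk addn0.
  have g2 : forall ad, R <= ad -> m2 ad = m ad.
    by far f2; apply: g1.
  clear f2 g1 m11 m12 m13 h1.
  apply: wp_seq; wstep.
  apply: wp_seq; apply: (@wp_rep_double _ _ _ (fuel n k)) => //=; first by rewrite h2; lia.
  move=> m3 /= h3 f3; rewrite mul1n h2 in h3.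
  have m33 : m3 3 = 1 by rewrite f3.
  have m31 : m3 1 = n by rewrite f3 // /= hn addn0.
  have m32 : m3 2 = k by rewrite f3 // /= hk addn0.
  have g3 : forall ad, R <= ad -> m3 ad = m ad.
    by far f3; apply: g2.
  clear f3 g2 m21 m22 m23 h2.
  apply: wp_seq; wstep.
  apply: wp_seq; apply: (@wp_rep_double _ _ _ (fuel n k)) => //=; first by rewrite h3; lia.
  move=> m4 /= h4 f4; rewrite mul1n h3 -/(tower k) in h4.
  have m43 : m4 3 = 1 by rewrite f4.
  have m41 : m4 1 = n by rewrite f4 // /= hn addn0.
  have m42 : m4 2 = k by rewrite f4 // /= hk addn0.
  have g4 : forall ad, R <= ad -> m4 ad = m ad.
    by far f4; apply: g3.
  clear f4 g3 m31 m32 m33 h3.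
  do 3 (apply: wp_seq; wstep).
  apply: wp_seq; apply: (@wp_rep_add _ _ _ _ (fuel n k)) => //=; first by rewrite m41 add0n.
  move=> m5 /= h5 f5; rewrite m41 !add0n h4 in h5.
  have m53 : m5 3 = 1 by rewrite f5.
  have m51 : m5 1 = n by rewrite f5 // /= hn addn0.
  have m52 : m5 2 = k by rewrite f5 // /= hk addn0.
  have g5 : forall ad, R <= ad -> m5 ad = m ad.
    by far f5; apply: g4.
  clear f5 g4 m41 m42 m43 h4.
  do 3 (apply: wp_seq; wstep).
  apply: wp_seq; apply: (@wp_rep_add _ _ _ _ (fuel n k)) => //=; first by rewrite m51 add0n.
  move=> m6 /= h6 f6; rewrite m51 !add0n h5 in h6.
  have m63 : m6 3 = 1 by rewrite f6.
  have m61 : m6 1 = n by rewrite f6 // /= hn addn0.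
  have m62 : m6 2 = k by rewrite f6 // /= hk addn0.
  have g6 : forall ad, R <= ad -> m6 ad = m ad.
    by far f6; apply: g5.
  clear f6 g5 m51 m52 m53 h5.
  do 3 (apply: wp_seq; wstep).
  apply: wp_seq; apply: (@wp_rep_add _ _ _ _ (fuel n k)) => //=; first by rewrite m61 add0n.
  move=> m7 /= h7 f7; rewrite m61 !add0n h6 in h7.
  have m73 : m7 3 = 1 by rewrite f7.
  have m71 : m7 1 = n by rewrite f7 // /= hn addn0.
  have m72 : m7 2 = k by rewrite f7 // /= hk addn0.
  have g7 : forall ad, R <= ad -> m7 ad = m ad.
    by far f7; apply: g6.
  clear f7 g6 m61 m62 m63 h6.
  do 3 (apply: wp_seq; wstep).
  apply: (@wp_rep_add _ _ _ _ (fuel n k)) => //=; first by rewrite m71 add0n.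
  move=> m8 /= h8 f8; rewrite m71 !add0n h7 in h8.
  split.
  - by rewrite h8 /fuel !expnS expn0 muln1 !mulnA.
  - by rewrite f8.
  - by rewrite f8.
  - by far f8; apply: g7.
by rewrite /pbound; pb M2.
Qed.

(** The cut has to end up in the cells below [n], which include the registers. The loop copies the
    cells from [R] on while it still has registers to work with; straight-line code then overwrites
    these, register 0 last because it holds the base address [M]. *)
Definition output_loop : program :=
  Seq (Const 4 R) (Seq (Sub 3 1 4) (Seq (Const 5 1)
  (While 3 (cell_address 4 0 (Seq (Read 7 8)
    (Seq (Write 4 7) (Seq (Add 4 4 5) (Sub 3 3 5)))))))).

Definition output_registers (vs : seq nat) : program :=
  foldr (fun v q => Seq (Const v (16 * v)) (Seq (Add v v 0) (Seq (Read v v) q)))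
    (Read 0 0) vs.

Lemma output_registers_correct M f vs (m : memory) :
  R <= M -> {in vs, forall v, 0 < v < R} -> uniq vs ->
  m 0 = M -> (forall j, m (M + 16 * j) = f j) ->
  wp (output_registers vs) (3 * size vs).+1 (fun m' => m' 0 = f 0 /\
    (forall v, 0 < v -> m' v = if v \in vs then f v else m v)) m.
Proof.
move=> RM; elim: vs m => [|v vs IH] m hvs /=.
  move=> _ h0 hf; wstep; split=> [|v v0] /=.
    by rewrite h0 -hf muln0 addn0.
  by neqs.
move=> /andP[vvs u] h0 hf.
have /andP[v0 vR] := hvs v (mem_head _ _).
have -> : (3 * (size vs).+1).+1 = 1 + (1 + (1 + (3 * size vs).+1)) by lia.
do 3 (apply: wp_seq; wstep).
apply: wp_mono (IH _ _ u _ _) (leqnn _) _.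
- by move=> x hx; apply: hvs; rewrite inE hx orbT.
- by rewrite /=; neqs.
- by move=> j /=; neqs; rewrite -hf.
move=> m' [h1 h2]; split=> // x x0; rewrite h2 // inE /=; neqs.
have [->|ne] := eqVneq x v; first by rewrite (negbTE vvs) h0 addnC -hf; neqs.
by [].
Qed.

Lemma output_correct : exists K, forall M f n (m : memory),
  R <= n -> n <= M -> m 0 = M -> m 1 = n -> (forall j, m (M + 16 * j) = f j) ->
  wp (Seq output_loop (output_registers (iota 1 R.-1))) (M ^ K)
    (fun m' => forall v, v < n -> m' v = f v) m.
Proof.
eexists=> M f n m Rn nM h0 h1 hf.
have M2 : 2 <= M by apply: leq_trans nM; apply: leq_trans Rn.
have RR : 8 < R by [].
apply: wp_mono; last by move=> ?; exact.
  apply: wp_seq; do 3 (apply: wp_seq; wstep).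
  apply: (@wp_while _ _ (n - R) M _ (fun i m' => [/\ m' 0 = M, m' 3 = n - R - i,
     m' 4 = R + i, m' 5 = 1 & (forall j, m' (M + 16 * j) = f j) /\
       forall v, R <= v < R + i -> m' v = f v])).
  - move=> i m' hi [i0 i3 i4 i5 [i6 i7]]; split; first by rewrite i3; lia.
    apply: wp_cell_address => // m5; rewrite i0 i4 addn0 => h8 f5.
    have R8 : 200 <= R by [].
    have [e0 e3 e4 e5] : [/\ m5 0 = M, m5 3 = n - R - i, m5 4 = R + i & m5 5 = 1].
      by rewrite !f5.
    have e6 j : m5 (M + 16 * j) = f j by rewrite f5 ?i6 //; lia.
    have e7 v : R <= v < R + i -> m5 v = f v by move=> hv; rewrite f5 ?i7 //; lia.
    wsteps; rewrite /= e4; neqs; rewrite /= e0 e3 e5 h8.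
    neqs; rewrite e6; split.
    + by [].
    + by neqs; lia.
    + by neqs; lia.
    + by neqs.
    + split=> [j|x hx]; neqs; rewrite ?e6 //.
      by case: eqP => [->|] // ne; rewrite e7 //; lia.
  - by move=> m' [_ -> _ _ _]; rewrite subnn.
  - split=> //=; first by rewrite h1 subn0.
    split=> [j|v]; last by lia.
    by rewrite /=; neqs; rewrite hf.
  - move=> m' [i0 i3 i4 i5 [i6 i7]].
    apply: wp_mono (output_registers_correct _ _ _ i0 i6) (leqnn _) _.
    + exact: leq_trans Rn nM.
    + by move=> v; rewrite mem_iota; rewrite /R; lia.
    + exact: iota_uniq.
    move=> m2 [g0 g1] v vn; case: (posnP v) => [->|v0]; first exact: g0.
    rewrite g1 // mem_iota v0 /=; case: ltnP => // hv.
    by rewrite i7 //; apply/andP; split; move: hv; rewrite /R; lia.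
  - by lia.
by rewrite /pbound; pb M2.
Qed.

(** The power multiplies the exponent [2 ^ (2 ^ (64 * k))] by [K <= 2 ^ K]; as [k > 0], a larger
    constant in place of 64 absorbs this. *)
Lemma fuel_exp n k K : 0 < k ->
  fuel n k ^ K <= 2 ^ (2 ^ (2 ^ ((K.+1 + 64) * k))) * n ^ (4 * K).
Proof.
move=> k0; rewrite /fuel /tower expnMn -expnM mulnC leq_mul2r; apply/orP; right.
rewrite -expnM leq_exp2l //.
apply: (@leq_trans (2 ^ (2 ^ (64 * k)) * 2 ^ K)).
  by rewrite leq_mul2l leq_exp2 orbT.
rewrite -expnD leq_exp2l // mulnDl expnD addnC.
have h1 : K < 2 ^ (K.+1 * k).
  by apply: leq_trans (leq_exp2 K.+1) _; rewrite leq_exp2l // leq_pmulr.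
have h2 : 2 <= 2 ^ (64 * k).
  by rewrite -{1}(expn1 2) leq_exp2l // muln_gt0.
by nia.
Qed.

Definition base_env M n k : nat -> nat := nth 0 [:: M; n; k].

Lemma machine p : swf [:: 0; 1; 2] 3 p -> exists prog C d, forall n k (s : seq nat),
  R <= n -> 0 < k -> size s <= fuel n k -> nth 0 s 0 = n -> nth 0 s 1 = k ->
  exists t m, [/\ exec prog (input s) t m,
    t <= 2 ^ (2 ^ (2 ^ (C * k))) * n ^ d &
    forall v, v < n ->
      m v = den (fuel n k) (input s) (base_env (fuel n k) n k) p (fun _ _ => 0) 0 v].
Proof.
move=> wfp; have [K1 H1] := setup_correct; have [K2 H2] := stmt_correct p.
have [K3 H3] := output_correct.
pose K := (K1 + (K2 + K3).+1).+1.
exists (Seq setup (Seq (scomp 3 p) (Seq output_loop (output_registers (iota 1 R.-1))))).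
exists (K.+1 + 64), (4 * K) => n k s Rn k0 sz s0 s1.
have n0 : 0 < n by apply: leq_trans Rn.
have n4 : n <= n ^ 4 by rewrite expnS leq_pmulr // expn_gt0 n0.
have nM : n <= fuel n k.
  by apply: leq_trans n4 _; rewrite /fuel leq_pmulr // /tower expn_gt0.
have RM := leq_trans Rn nM.
have M2 : 2 <= fuel n k by apply: leq_trans RM.
set M := fuel n k in nM RM M2 sz *.
suff [t [m [h1 h2 h3]]] : wp (Seq setup (Seq (scomp 3 p)
    (Seq output_loop (output_registers (iota 1 R.-1))))) (M ^ K1 + (M ^ K2 + M ^ K3))
   (fun m => forall v, v < n -> m v = den M (input s) (base_env M n k) p (fun _ _ => 0) 0 v)
   (input s).
  exists t, m; split=> //; apply: leq_trans h2 _; apply: leq_trans (fuel_exp n K k0).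
  by apply: pbound_add => //; apply: leqnn || apply: pbound_add; try exact: leqnn.
apply: wp_seq; apply: wp_mono (H1 n k _ n0 s0 s1) (leqnn _) _ => m1 [q0 q1 q2 q3].
have sm : sim M (input s) (fun _ _ => 0) m1.
  split=> //; last by move=> ad /andP[had _]; apply: q3.
  move=> a i ha; rewrite q3 /input ?nth_default //; last by lia.
  by apply: leq_trans sz _; lia.
have pr : pre M (input s) (fun _ _ => 0) (base_env M n k) [:: 0; 1; 2] 3 m1.
  split=> //; first by move=> y; rewrite !inE; lia.
  by split=> // y; rewrite !inE => /or3P[] /eqP ->.
apply: wp_seq; apply: wp_mono (H2 _ _ _ _ _ _ _ pr wfp) (leqnn _) _ => m2 [[a0 a1 a2] h].
apply: wp_mono (H3 M _ n m2 Rn nM a0 _ _) (leqnn _) (fun _ h => h).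
- by rewrite h // q1.
- by move=> j; rewrite -(a1 0 j) // addn0.
Qed.

(** * Near-bipartite pieces from the power method *)

Section CauchySchwarz.
Local Open Scope ring_scope.

(** Lagrange's identity: the difference of the two sides is half of a weighted sum of squares. *)
Lemma cauchy_schwarz (F : realFieldType) (I : finType) (w a b : I -> F) :
  (forall i, 0 <= w i) ->
  (\sum_i w i * (a i * b i)) ^+ 2 <=
  (\sum_i w i * a i ^+ 2) * (\sum_i w i * b i ^+ 2).
Proof.
move=> w0.
have h : 0 <= \sum_i \sum_j w i * w j * (a i * b j - a j * b i) ^+ 2.
  apply: sumr_ge0 => i _; apply: sumr_ge0 => j _.
  by rewrite mulr_ge0 ?sqr_ge0 // mulr_ge0.
suff e : \sum_i \sum_j w i * w j * (a i * b j - a j * b i) ^+ 2 =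
   2%:R * ((\sum_i w i * a i ^+ 2) * (\sum_i w i * b i ^+ 2)) -
   2%:R * (\sum_i w i * (a i * b i)) ^+ 2 by move: h; rewrite e; lra.
rewrite expr2 !big_distrlr /=.
rewrite (_ : 2%:R * \sum_i \sum_j _ =
    \sum_i \sum_j (w i * a i ^+ 2 * (w j * b j ^+ 2)) +
    \sum_i \sum_j (w j * a j ^+ 2 * (w i * b i ^+ 2))); last first.
  by rewrite [X in _ + X]exchange_big /=; ring.
rewrite mulr_sumr -big_split -sumrB /=; apply: eq_bigr => i _.
rewrite mulr_sumr -big_split -sumrB /=; apply: eq_bigr => j _.
by ring.
Qed.

Lemma cauchy_schwarz2 (F : realFieldType) (I : finType) (w a b : I -> I -> F) :
  (forall i j, 0 <= w i j) ->
  (\sum_i \sum_j w i j * (a i j * b i j)) ^+ 2 <=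
  (\sum_i \sum_j w i j * a i j ^+ 2) * (\sum_i \sum_j w i j * b i j ^+ 2).
Proof.
move=> w0; rewrite !pair_bigA /=.
exact: (@cauchy_schwarz _ _ (fun p : I * I => w p.1 p.2) (fun p => a p.1 p.2) (fun p => b p.1 p.2)).
Qed.

End CauchySchwarz.

Section Walk.
Local Open Scope ring_scope.
Variables (n : nat) (w : 'I_n -> 'I_n -> rat) (co : 'I_n -> rat) (N : rat).
Hypothesis w0 : forall u v, 0 <= w u v.
Hypothesis wC : forall u v, w u v = w v u.
Hypothesis N0 : 0 < N.

Let d u := \sum_v w u v.
Hypothesis coE : forall u, d u != 0 -> co u * d u = N.

(** With co u = N / d u this is the operator N (I - D^-1 A). Its spectrum lies in [0, 2N], and
    values near 2N signal a nearly bipartite piece. Below, [energy] is the squared norm weighted by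
    the degrees, and [form] the bilinear form of the operator for that inner product. *)
Definition walk_step (y : 'I_n -> rat) u := co u * \sum_v w u v * (y u - y v).
Let energy y := \sum_u d u * y u ^+ 2.
Let form x y := \sum_u d u * (x u * walk_step y u).
Let W := \sum_u \sum_v w u v.

Let d_ge0 u : 0 <= d u. Proof. exact: sumr_ge0. Qed.

Lemma walk_stepE y u : d u * walk_step y u = N * \sum_v w u v * (y u - y v).
Proof.
rewrite /walk_step mulrA; have [du|du] := eqVneq (d u) 0; last by rewrite (mulrC (d u)) coE.
rewrite du !mul0r big1 ?mulr0 // => v _.
by move/eqP: du; rewrite psumr_eq0 // => /allP/(_ v (mem_index_enum _))/eqP->; rewrite mul0r.
Qed.

Lemma formE x y :
  form x y = N / 2%:R * \sum_u \sum_v w u v * ((x u - x v) * (y u - y v)).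
Proof.
have e1 : form x y = N * \sum_u \sum_v w u v * (x u * (y u - y v)).
  rewrite /form mulr_sumr; apply: eq_bigr => u _.
  rewrite mulrCA walk_stepE mulrCA; congr (_ * _).
  by rewrite mulr_sumr; apply: eq_bigr => v _; ring.
have e2 : \sum_u \sum_v w u v * (x u * (y u - y v)) =
          \sum_u \sum_v w u v * (x v * (y v - y u)).
  by rewrite exchange_big; apply: eq_bigr => u _; apply: eq_bigr => v _; rewrite wC.
have -> : \sum_u \sum_v w u v * ((x u - x v) * (y u - y v)) =
   \sum_u \sum_v w u v * (x u * (y u - y v)) + \sum_u \sum_v w u v * (x v * (y v - y u)).
  rewrite -big_split; apply: eq_bigr => u _; rewrite -big_split; apply: eq_bigr => v _ /=.
  by ring.
by rewrite -e2 e1; field.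
Qed.

Lemma energyE y : energy y = \sum_u \sum_v w u v * y u ^+ 2.
Proof. by apply: eq_bigr => u _; rewrite mulr_suml. Qed.

Lemma energyE2 y : 2%:R * energy y = \sum_u \sum_v w u v * (y u ^+ 2 + y v ^+ 2).
Proof.
have e : energy y = \sum_u \sum_v w u v * y v ^+ 2.
  by rewrite energyE exchange_big; apply: eq_bigr => u _; apply: eq_bigr => v _; rewrite wC.
rewrite (_ : 2%:R * energy y = energy y + energy y); last by ring.
rewrite {2}e energyE -big_split; apply: eq_bigr => u _.
by rewrite -big_split; apply: eq_bigr => v _; rewrite mulrDr.
Qed.

Lemma energy_ge0 y : 0 <= energy y.
Proof. by apply: sumr_ge0 => u _; rewrite mulr_ge0 ?sqr_ge0. Qed.

Lemma form_ge0 y : 0 <= form y y.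
Proof.
rewrite formE mulr_ge0 ?divr_ge0 ?(ltW N0) //.
by apply: sumr_ge0 => u _; apply: sumr_ge0 => v _; rewrite mulr_ge0 // -expr2 sqr_ge0.
Qed.

(** The deficit of the Rayleigh quotient below 2N is the signless form: it is small when y u is
    close to - y v along most of the weight. *)
Lemma form_sum y : 4%:R * energy y - 2%:R / N * form y y =
  \sum_u \sum_v w u v * (y u + y v) ^+ 2.
Proof.
rewrite formE mulrA (_ : 2%:R / N * (N / 2%:R) = 1); last by field; rewrite ?gt_eqF.
rewrite (_ : 4%:R * energy y = 2%:R * (2%:R * energy y)); last by ring.
rewrite energyE2 mul1r mulr_sumr -sumrB; apply: eq_bigr => u _.
rewrite mulr_sumr -sumrB; apply: eq_bigr => v _; ring.
Qed.

Lemma form_le y : form y y <= 2%:R * N * energy y.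
Proof.
have h : 0 <= 4%:R * energy y - 2%:R / N * form y y.
  rewrite form_sum; apply: sumr_ge0 => u _; apply: sumr_ge0 => v _.
  by rewrite mulr_ge0 ?sqr_ge0.
rewrite -subr_ge0 (_ : _ - _ = N / 2%:R * (4%:R * energy y - 2%:R / N * form y y)).
  by rewrite mulr_ge0 // divr_ge0 // ltW.
by field; rewrite gt_eqF.
Qed.

Lemma form_cs x y : form x y ^+ 2 <= form x x * form y y.
Proof.
rewrite !formE exprMn.
have h := cauchy_schwarz2 (fun u v => x u - x v) (fun u v => y u - y v) w0.
set A := \sum_u _ in h *; set B := \sum_u _ in h *.
set C := (X in _ <= _ * X * (_ * _)).
set D := (X in _ <= _ * (_ * X)).
have -> : C = \sum_u \sum_v w u v * (x u - x v) ^+ 2.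
  by apply: eq_bigr => u _; apply: eq_bigr => v _; rewrite expr2.
have -> : D = \sum_u \sum_v w u v * (y u - y v) ^+ 2.
  by apply: eq_bigr => u _; apply: eq_bigr => v _; rewrite expr2.
rewrite [leRHS]mulrACA -[N / _ * (N / _)]expr2 ler_pM2l //.
by rewrite exprn_gt0 // divr_gt0.
Qed.

Lemma energy_step y : energy (walk_step y) = form (walk_step y) y.
Proof. by apply: eq_bigr => u _; rewrite expr2. Qed.

Lemma form_energy_cs y : form y y ^+ 2 <= energy y * energy (walk_step y).
Proof. by apply: cauchy_schwarz. Qed.

(** For the operator L of the walk this is L^2 <= 2N L. Cauchy-Schwarz for [form] at L y and y,
    together with [form_le], replaces a diagonalization. *)
Lemma energy_step_le y : energy (walk_step y) <= 2%:R * N * form y y.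
Proof.
have h := form_cs (walk_step y) y; rewrite -energy_step in h.
have h2 := form_le (walk_step y).
have h3 := energy_ge0 (walk_step y).
have h4 := form_ge0 y.
have [e0|e0] := eqVneq (energy (walk_step y)) 0.
  by rewrite e0 !mulr_ge0 // ltW.
have p : 0 < energy (walk_step y) by rewrite lt_neqAle eq_sym e0.
rewrite -(ler_pM2l p) -expr2; apply: le_trans h _.
apply: le_trans (ler_wpM2r h4 h2) _.
by rewrite le_eqVlt; apply/orP; left; apply/eqP; ring.
Qed.

(** The numbers energy y, form y y, energy (L y), form (L y) (L y) are successive moments of L,
    hence log-convex by Cauchy-Schwarz. Their successive ratios increase, so a lower bound on the
    Rayleigh quotient persists along the walk. *)
Lemma form_step_ge y rho : 0 <= rho -> 0 < energy y ->
  rho * energy y <= form y y ->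
  rho ^+ 2 * energy y <= energy (walk_step y) /\
  rho * energy (walk_step y) <= form (walk_step y) (walk_step y).
Proof.
move=> r0 e0 h.
have h1 := form_energy_cs y.
have h4 := form_ge0 y.
have q2 : rho * form y y <= energy (walk_step y).
  rewrite -(ler_pM2l e0); apply: le_trans h1.
  by rewrite expr2 mulrA ler_wpM2r // mulrC.
have q1 : rho ^+ 2 * energy y <= energy (walk_step y).
  by apply: le_trans q2; rewrite expr2 -mulrA ler_wpM2l.
split=> //.
have h2 := form_cs (walk_step y) y; rewrite -energy_step in h2.
have h3 := form_ge0 (walk_step y).
have [r00|rn] := eqVneq rho 0; first by rewrite r00 mul0r.
have rp : 0 < rho by rewrite lt_neqAle eq_sym rn.
have fp : 0 < form y y by apply: lt_le_trans h; rewrite mulr_gt0.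
rewrite -(ler_pM2r fp); apply: le_trans h2.
by rewrite mulrAC expr2 ler_wpM2r // energy_ge0.
Qed.

Definition walk (y : 'I_n -> rat) j := iter j walk_step y.
Definition delta (s : 'I_n) : 'I_n -> rat := fun u => (u == s)%:R.

Lemma walk_sum x j u : walk x j u = \sum_s x s * walk (delta s) j u.
Proof.
elim: j u => [|j IH] u /=.
  rewrite (bigD1 u) //= /delta eqxx mulr1 big1 ?addr0 // => s su.
  by rewrite eq_sym (negbTE su) mulr0.
rewrite [LHS](_ : _ = co u * \sum_v w u v * (walk x j u - walk x j v)) //.
have -> : \sum_v w u v * (walk x j u - walk x j v) =
    \sum_s x s * \sum_v w u v * (walk (delta s) j u - walk (delta s) j v).
  under [RHS]eq_bigr => s _ do rewrite mulr_sumr.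
  rewrite exchange_big; apply: eq_bigr => v _ /=.
  rewrite !IH -sumrB mulr_sumr; apply: eq_bigr => s _; ring.
rewrite mulr_sumr; apply: eq_bigr => s _ /=.
rewrite [X in _ = _ * X](_ : _ = co u *
   \sum_v w u v * (walk (delta s) j u - walk (delta s) j v)) //.
by rewrite mulrCA.
Qed.

(** The factor [n] is the price for passing from an unknown sign vector to single unit vectors; a
    longer walk pays for it. *)
Lemma energy_sum (x : 'I_n -> rat) (y : 'I_n -> 'I_n -> rat) :
  (forall s, x s ^+ 2 = 1) ->
  energy (fun u => \sum_s x s * y s u) <= n%:R * \sum_s energy (y s).
Proof.
move=> x1; rewrite /energy exchange_big mulr_sumr; apply: ler_sum => u _ /=.
rewrite -mulr_sumr [leRHS]mulrCA ler_wpM2l //.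
have h := @cauchy_schwarz _ _ (fun=> 1) x (fun s => y s u) (fun=> ler01).
rewrite (eq_bigr (fun s => x s * y s u)) in h; last by move=> *; rewrite mul1r.
apply: le_trans h _.
rewrite (eq_bigr (fun=> 1)); last by move=> *; rewrite mul1r x1.
rewrite sumr_const card_ord; apply: ler_wpM2l => //.
by apply: ler_sum => s _; rewrite mul1r.
Qed.

Lemma energy_delta s : energy (delta s) = d s.
Proof.
rewrite /energy (bigD1 s) //= /delta eqxx expr1n mulr1 big1 ?addr0 // => u us.
by rewrite (negbTE us) expr0n mulr0.
Qed.

(* If no walk ever had a large Rayleigh quotient, the energy of all walks would
   decay at rate [1 - eta]; but the walk started at a nearly alternating
   [x = sum_s x_s delta_s] decays only at rate [(1 - dl)^2]. *)
Lemma walk_exists (x : 'I_n -> rat) (dl eta : rat) T :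
  (forall s, x s ^+ 2 = 1) -> 0 < W -> 0 < dl -> eta = 4%:R * dl -> eta < 1 ->
  2%:R * N * (1 - dl) * W <= form x x ->
  n%:R <= 2%:R * dl * T%:R ->
  exists s j, (j < T)%N /\
    2%:R * N * (1 - eta) * energy (walk (delta s) j) <
    form (walk (delta s) j) (walk (delta s) j).
Proof.
move=> x1 Wp dl0 etaE eta1 hx hT.
case: (boolP [exists s : 'I_n, exists j : 'I_T,
    2%:R * N * (1 - eta) * energy (walk (delta s) j) <
    form (walk (delta s) j) (walk (delta s) j)]) => [/existsP[s /existsP[j h]]|].
  by exists s, j; split.
move=> hno; exfalso.
have decay s j : (j <= T)%N ->
    energy (walk (delta s) j) <= (4%:R * N ^+ 2 * (1 - eta)) ^+ j * d s.
  elim: j => [|j IH] hj; first by rewrite /= energy_delta expr0 mul1r.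
  have hs := energy_step_le (walk (delta s) j).
  have hq : form (walk (delta s) j) (walk (delta s) j) <=
     2%:R * N * (1 - eta) * energy (walk (delta s) j).
    rewrite leNgt; apply: contra hno => h; apply/existsP; exists s.
    by apply/existsP; exists (Ordinal hj).
  rewrite /= in hs *; apply: le_trans hs _.
  apply: (@le_trans _ _ (2%:R * N * (2%:R * N * (1 - eta) * energy (walk (delta s) j)))).
    by rewrite ler_wpM2l // mulr_ge0 // ltW.
  rewrite (_ : 2%:R * N * _ = (4%:R * N ^+ 2 * (1 - eta)) * energy (walk (delta s) j)); last by ring.
  rewrite (exprS (4%:R * N ^+ 2 * (1 - eta))) -[leRHS]mulrA.
  apply: ler_wpM2l; last by apply/IH/ltnW.
  by rewrite mulr_ge0 ?subr_ge0 ?(ltW eta1) // mulr_ge0 ?sqr_ge0.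
have ex : energy x = W.
  by rewrite energyE; apply: eq_bigr => u _; apply: eq_bigr => v _; rewrite x1 mulr1.
pose rho := 2%:R * N * (1 - dl).
have dl1 : dl < 1 by move: eta1 dl0; rewrite etaE; lra.
have rho0 : 0 < rho by rewrite mulr_gt0 ?subr_gt0 // mulr_gt0.
have grow j : (rho ^+ 2) ^+ j * W <= energy (walk x j) /\
    rho * energy (walk x j) <= form (walk x j) (walk x j).
  elim: j => [|j [IH1 IH2]] /=; first by rewrite expr0 mul1r ex.
  have ep : 0 < energy (walk x j).
    by apply: lt_le_trans IH1; rewrite mulr_gt0 // exprn_gt0 // exprn_gt0.
  have [h1 h2] := form_step_ge (ltW rho0) ep IH2; split=> //.
  rewrite (exprS (rho ^+ 2)) -mulrA; apply: le_trans h1; rewrite ler_wpM2l // ltW //.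
  by rewrite exprn_gt0.
have [g _] := grow T.
have e2 : energy (walk x T) <= n%:R * ((4%:R * N ^+ 2 * (1 - eta)) ^+ T * W).
  have -> : energy (walk x T) = energy (fun u => \sum_s x s * walk (delta s) T u).
    by apply: eq_bigr => u _; rewrite walk_sum.
  apply: le_trans (energy_sum _ x1) _; rewrite ler_wpM2l //.
  by rewrite mulr_sumr; apply: ler_sum => s _; apply: decay.
have h := le_trans g e2.
rewrite mulrA ler_pM2r // in h.
have a0 : 0 < 4%:R * N ^+ 2 * (1 - eta).
  by rewrite mulr_gt0 ?subr_gt0 // mulr_gt0 ?exprn_gt0.
(* (1 - dl)^2 - (1 - 4 dl)(1 + 2 dl) = 9 dl^2: the choice eta = 4 dl lets the combination outgrow
   the bound on the unit vectors by 1 + 2 dl at each step. *)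
have k1 : (4%:R * N ^+ 2 * (1 - eta)) * (1 + 2%:R * dl) <= rho ^+ 2.
  rewrite (_ : rho ^+ 2 = 4%:R * N ^+ 2 * (1 - dl) ^+ 2); last by rewrite /rho; ring.
  rewrite -[leLHS]mulrA.
  rewrite ler_pM2l ?mulr_gt0 ?exprn_gt0 // etaE -subr_ge0.
  rewrite (_ : _ - _ = 9%:R * dl ^+ 2); last by ring.
  by rewrite mulr_ge0 // sqr_ge0.
have k2 : (1 + 2%:R * dl) ^+ T <= n%:R.
  have hh : (4%:R * N ^+ 2 * (1 - eta)) ^+ T * (1 + 2%:R * dl) ^+ T <= (rho ^+ 2) ^+ T.
    rewrite -exprMn; apply: lerXn2r => //; rewrite nnegrE ?sqr_ge0 //.
    by rewrite mulr_ge0 ?(ltW a0) //; move: dl0; lra.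
  by have := le_trans hh h; rewrite mulrC ler_pM2r // exprn_gt0.
(* Bernoulli's inequality. It requires T of order n / dl, where log n / dl would do, but the fuel
   allows for it. *)
have k3 : 1 + 2%:R * dl * T%:R <= (1 + 2%:R * dl) ^+ T.
  elim: (T) => [|t IH]; first by rewrite mulr0 addr0 expr0.
  rewrite exprS -natr1; apply: (@le_trans _ _ ((1 + 2%:R * dl) * (1 + 2%:R * dl * t%:R))).
    have : 0 <= dl * dl * t%:R by rewrite !mulr_ge0 // ltW.
    by lra.
  by rewrite ler_wpM2l //; move: dl0; lra.
by move: k2 k3 hT; lra.
Qed.

End Walk.

(** * Rounding a vector to a nearly bipartite set *)

Section Threshold.

(** Equivalently, the edge meets the set without being an edge inside it whose ends have opposite
    signs. This form follows the case distinction of [signed_dist]. *)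
Definition bad (inu inv su sv : bool) :=
  ((su == sv) && (inu || inv)) || ((su != sv) && (inu != inv)).

Lemma sum_ltn a B : a <= B -> \sum_(t < B) (t < a) = a.
Proof.
move=> aB; transitivity (\sum_(t < B | t < a) 1).
  by rewrite [RHS]big_mkcond; apply: eq_bigr => t _; case: (t < a).
by rewrite -(big_ord_widen _ (fun=> 1)) // sum1_card card_ord.
Qed.

Definition signed_dist (s s' : bool) (a a' : nat) :=
  if s == s' then a + a' else (a - a') + (a' - a).

(** Layer-cake counting: with equal signs an edge is bad for the thresholds below the larger of [a]
    and [a'], with opposite signs for those between the two. *)
Lemma layer_bad s s' a a' B : a <= B -> a' <= B ->
  \sum_(t < B) bad (t < a) (t < a') s s' <= signed_dist s s' a a'.
Proof.
move=> aB a'B; rewrite /signed_dist /bad; case: (s == s') => /=.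
  apply: (@leq_trans (\sum_(t < B) ((t < a) + (t < a')))).
    by apply: leq_sum => t _; case: (t < a); case: (t < a').
  by rewrite big_split /= !sum_ltn.
wlog le : a a' aB a'B / a <= a'.
  move=> H; case: (leqP a a') => [|/ltnW] h; first exact: H.
  rewrite addnC; apply: leq_trans (H _ _ a'B aB h); apply: leq_sum => t _.
  by rewrite eq_sym.
rewrite (_ : a - a' = 0) ?add0n; last by apply/eqP.
rewrite -{2}(sum_ltn aB) -{2}(sum_ltn a'B) leq_subRL; last first.
  by apply: leq_sum => t _; case: ltnP => // h; rewrite (leq_trans h le).
rewrite -big_split /=; apply: leq_sum => t _.
by move: (fun h : t < a => leq_trans h le); case: (t < a); case: (t < a') => // /(_ isT).
Qed.

Local Open Scope ring_scope.

Lemma signed_natE (p q : nat) :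
  p%:R - q%:R = (if (q < p)%N then 1 else -1) * ((p - q) + (q - p))%N%:R :> rat.
Proof.
case: ltnP => h; rewrite natrD.
  by rewrite natrB ?(ltnW h) // (eqP (ltnW h)) mul1r addr0.
by rewrite (eqP h) natrB // add0r mulN1r opprB.
Qed.

(** The distance is at most |y + y'| (b + b'), for opposite signs because b^2 - b'^2 = (b - b') (b +
    b'). AM-GM with the parameter [K] then separates the two factors; Cauchy-Schwarz would leave a
    square root. *)
Lemma signed_dist_le (p q p' q' : nat) (K : rat) : 0 < K ->
  let b := ((p - q) + (q - p))%N in let b' := ((p' - q') + (q' - p'))%N in
  let y := p%:R - q%:R : rat in let y' := p'%:R - q'%:R : rat in
  2%:R * (signed_dist (q < p)%N (q' < p')%N (b ^ 2) (b' ^ 2))%:R <=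
     4%:R * K * (y + y') ^+ 2 + (y ^+ 2 + y' ^+ 2) / (2%:R * K).
Proof.
move=> K0; rewrite !signed_natE /=.
move: (p - q + (q - p))%N (p' - q' + (q' - p'))%N => b b'.
move: (q < p)%N (q' < p')%N => s s'.
suff h : (signed_dist s s' (b ^ 2) (b' ^ 2))%:R <=
   `|(if s then 1 else -1) * b%:R + (if s' then 1 else -1) * b'%:R| * (b%:R + b'%:R) :> rat.
  set z := _ + _ in h *.
  have sq (c : bool) (x : rat) : ((if c then 1 else -1) * x) ^+ 2 = x ^+ 2.
    by case: c; ring.
  rewrite !sq -(real_normK (num_real z)).
  have z0 := normr_ge0 z; move: (`|z|) z0 h => {}z z0 h.
  have h2 : (b%:R + b'%:R) ^+ 2 <= 2%:R * (b%:R ^+ 2 + b'%:R ^+ 2) :> rat.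
    rewrite -subr_ge0 (_ : _ - _ = (b%:R - b'%:R) ^+ 2) ?sqr_ge0 //; ring.
  have h3 : 2%:R * (z * (b%:R + b'%:R)) <= 4%:R * K * z ^+ 2 + (b%:R + b'%:R) ^+ 2 / (4%:R * K).
    rewrite -subr_ge0 (_ : _ - _ = (4%:R * K * z - (b%:R + b'%:R)) ^+ 2 / (4%:R * K)).
      by rewrite divr_ge0 ?sqr_ge0 // mulr_ge0 // ltW.
    by field; rewrite gt_eqF.
  have h4 : (b%:R + b'%:R) ^+ 2 / (4%:R * K) <= (b%:R ^+ 2 + b'%:R ^+ 2) / (2%:R * K).
    rewrite (_ : (b%:R ^+ 2 + b'%:R ^+ 2) / (2%:R * K) =
       (2%:R * (b%:R ^+ 2 + b'%:R ^+ 2)) / (4%:R * K)); last by field; rewrite gt_eqF.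
    by rewrite ler_wpM2r // invr_ge0 mulr_ge0 // ltW.
  by lra.
rewrite /signed_dist.
have b0 : 0 <= b%:R :> rat by [].
have b0' : 0 <= b'%:R :> rat by [].
have sm : 0 <= b%:R + b'%:R :> rat by rewrite addr_ge0.
have d1 : (b <= b')%N -> (b ^ 2 - b' ^ 2 + (b' ^ 2 - b ^ 2))%:R =
    (b'%:R - b%:R) * (b%:R + b'%:R) :> rat.
  move=> h; have h2 : (b ^ 2 <= b' ^ 2)%N by rewrite leq_exp2r.
  by rewrite (eqP h2) add0n natrB // !natrX; ring.
have d2 : (b' <= b)%N -> (b ^ 2 - b' ^ 2 + (b' ^ 2 - b ^ 2))%:R =
    (b%:R - b'%:R) * (b%:R + b'%:R) :> rat.
  move=> h; have h2 : (b' ^ 2 <= b ^ 2)%N by rewrite leq_exp2r.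
  by rewrite (eqP h2) addn0 natrB // !natrX; ring.
have d3 : `|b%:R - b'%:R| * (b%:R + b'%:R) = (b ^ 2 - b' ^ 2 + (b' ^ 2 - b ^ 2))%:R :> rat.
  case: (leqP b b') => [h|/ltnW h].
    by rewrite d1 // distrC ger0_norm // subr_ge0 ler_nat.
  by rewrite d2 // ger0_norm // subr_ge0 ler_nat.
have d4 : (b ^ 2 + b' ^ 2)%:R <= (b%:R + b'%:R) * (b%:R + b'%:R) :> rat.
  rewrite natrD !natrX -subr_ge0 (_ : _ - _ = 2%:R * (b%:R * b'%:R)); last by ring.
  by rewrite !mulr_ge0.
case: s; case: s' => /=; rewrite ?mul1r ?mulN1r.
- by rewrite ger0_norm.
- by rewrite d3.
- by rewrite addrC distrC d3.
- by rewrite -opprD normrN ger0_norm.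
Qed.

(* Cheeger's inequality in the form of Trevisan's rounding: if the integer
   vector [p - q] has Rayleigh quotient close to the maximum then one of its
   signed threshold sets is nearly bipartite. *)
Lemma threshold_exists (n : nat) (w : 'I_n -> 'I_n -> nat) (p q : 'I_n -> nat) (K : nat) :
  (0 < K)%N -> (forall u v, w u v = w v u) ->
  let b u := ((p u - q u) + (q u - p u))%N in
  let y u := (p u)%:R - (q u)%:R : rat in
  let energy := \sum_u \sum_v (w u v)%:R * y u ^+ 2 in
  0 < energy ->
  4%:R * K%:R ^+ 2 * (\sum_u \sum_v (w u v)%:R * (y u + y v) ^+ 2) <= energy ->
  exists th : 'I_n, let inY u := (0 < b u)%N && (b th <= b u)%N in
   (K * (\sum_u \sum_v w u v * bad (inY u) (inY v) (q u < p u) (q v < p v)) <=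
      \sum_u \sum_v w u v * (inY u || inY v))%N /\
   (0 < \sum_u \sum_v w u v * (inY u || inY v))%N.
Proof.
move=> K0 wC b y energy e0 hE.
(* Thresholds are put on the squares, so that summing over them gives the energy. *)
pose a u := (b u ^ 2)%N.
pose s u := (q u < p u)%N.
have ya u : y u ^+ 2 = (a u)%:R.
  by rewrite /y signed_natE natrX exprMn -/(b u); case: ifP => _; ring.
pose B := (\sum_u a u)%N.
have aB u : (a u <= B)%N by rewrite /B (bigD1 u) //= leq_addr.
have KR : 0 < K%:R :> rat by rewrite ltr0n.
have eN : energy = (\sum_u \sum_v w u v * a u)%N%:R.
  rewrite /energy natr_sum; apply: eq_bigr => u _; rewrite natr_sum.
  by apply: eq_bigr => v _; rewrite ya natrM.
have eN' : energy = \sum_u \sum_v (w u v)%:R * y v ^+ 2.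
  by rewrite /energy exchange_big; apply: eq_bigr => u _; apply: eq_bigr => v _; rewrite wC.
have hD : (K * \sum_u \sum_v w u v * signed_dist (s u) (s v) (a u) (a v) <=
    \sum_u \sum_v w u v * a u)%N.
  rewrite -(ler_nat rat) -eN natrM.
  have h : 2%:R * (\sum_u \sum_v w u v * signed_dist (s u) (s v) (a u) (a v))%N%:R <=
     4%:R * K%:R * (\sum_u \sum_v (w u v)%:R * (y u + y v) ^+ 2) +
     (energy + energy) / (2%:R * K%:R) :> rat.
    rewrite {2}eN' /energy -big_split /= mulr_suml natr_sum !mulr_sumr -big_split /=.
    apply: ler_sum => u _; rewrite -big_split /= mulr_suml natr_sum !mulr_sumr -big_split /=.
    apply: ler_sum => v _; rewrite natrM.
    have w0 : 0 <= (w u v)%:R :> rat by [].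
    have := ler_wpM2l w0 (@signed_dist_le (p u) (q u) (p v) (q v) K%:R KR).
    rewrite /= -/(y u) -/(y v) /s /a /b mulrCA => h1; apply: le_trans h1 _.
    by rewrite le_eqVlt; apply/orP; left; apply/eqP; ring.
  have h2 : K%:R * (4%:R * K%:R * (\sum_u \sum_v (w u v)%:R * (y u + y v) ^+ 2)) <= energy.
    by move: hE; lra.
  have := ler_wpM2l (ltW KR) h; rewrite mulrDr.
  rewrite (_ : K%:R * ((energy + energy) / (2%:R * K%:R)) = energy).
    by move: h2; set X := _ * (4%:R * _ * _); lra.
  by field; rewrite gt_eqF.
pose bd t := (\sum_u \sum_v w u v * bad (t < a u) (t < a v) (s u) (s v))%N.
pose tc t := (\sum_u \sum_v w u v * ((t < a u) || (t < a v)))%N.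
have hb : (\sum_(t < B) bd t <= \sum_u \sum_v w u v * signed_dist (s u) (s v) (a u) (a v))%N.
  rewrite /bd exchange_big; apply: leq_sum => u _; rewrite exchange_big; apply: leq_sum => v _.
  by rewrite -big_distrr leq_mul2l layer_bad ?orbT.
have ht : (\sum_u \sum_v w u v * a u <= \sum_(t < B) tc t)%N.
  rewrite /tc [leqRHS]exchange_big; apply: leq_sum => u _.
  rewrite [leqRHS]exchange_big; apply: leq_sum => v _.
  rewrite -big_distrr leq_mul2l /= -{1}(sum_ltn (aB u)); apply/orP; right.
  by apply: leq_sum => t _; case: (t < a u)%N.
have tp : (0 < \sum_(t < B) tc t)%N.
  by apply: leq_trans ht; rewrite -(ltr0n rat) -eN.
have [t h1 h2] : exists2 t : 'I_B, (K * bd t <= tc t)%N & (0 < tc t)%N.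
  case: (boolP [exists t : 'I_B, (K * bd t <= tc t)%N && (0 < tc t)%N]).
    by move=> /existsP[t /andP[h1 h2]]; exists t.
  move=> /existsPn hno; exfalso.
  have : (\sum_(t < B) tc t < K * \sum_(t < B) bd t)%N.
    have h0 (t : 'I_B) : (tc t <= K * bd t)%N.
      have := hno t; case: (leqP (K * bd t) (tc t)) => /= [_|/ltnW //].
      by rewrite -leqNgt leqn0 => /eqP ->.
    have [t ht0] : exists t : 'I_B, (0 < tc t)%N.
      apply/existsP; apply: contraLR tp => /existsPn h; rewrite -leqNgt.
      by rewrite big1 // => t _; apply/eqP; have := h t; rewrite -leqNgt leqn0.
    have hs : (tc t < K * bd t)%N.
      by have := hno t; rewrite ht0 andbT -ltnNge.
    rewrite big_distrr (bigD1 t) //= [X in (_ < X)%N](bigD1 t) //=.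
    by rewrite -addSn; apply: leq_add => //; apply: leq_sum.
  apply/negP; rewrite -leqNgt; apply: leq_trans ht; apply: leq_trans hD.
  by rewrite leq_mul2l hb orbT.
have [u0 hu0] : exists u0, (t < a u0)%N.
  apply/existsP; apply: contraLR h2 => /existsPn h; rewrite -leqNgt.
  by rewrite /tc big1 // => u _; rewrite big1 // => v _; rewrite (negbTE (h u)) (negbTE (h v)) muln0.
(* The integer threshold is replaced by a vertex with least [b] above it, so that the program has
   only [n] thresholds to try. *)
have [th hth hmin] := @arg_minnP _ u0 (fun u => t < a u)%N b hu0.
exists th => inY.
have inE u : inY u = (t < a u)%N.
  apply/idP/idP => [/andP[h3 h4]|h].
    by apply: leq_trans hth _; rewrite /a leq_exp2r.
  rewrite /inY hmin // andbT; move: h; rewrite /a; case: (b u) => //.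
rewrite (_ : (\sum_u \sum_v w u v * (inY u || inY v))%N = tc t); last first.
  by apply: eq_bigr => u _; apply: eq_bigr => v _; rewrite !inE.
rewrite (_ : (\sum_u \sum_v w u v * bad (inY u) (inY v) (q u < p u) (q v < p v))%N = bd t) //.
by apply: eq_bigr => u _; apply: eq_bigr => v _; rewrite !inE.
Qed.
End Threshold.

Section Candidate.
Variables (n : nat) (w : 'I_n -> 'I_n -> nat) (co : 'I_n -> nat) (N K T : nat).
Variables (x : 'I_n -> bool) (p q : 'I_n -> nat -> 'I_n -> nat).
Hypotheses (N0 : 0 < N) (K0 : 0 < K) (wC : forall u v, w u v = w v u).
Hypothesis coE : forall u, \sum_v w u v != 0 -> co u * \sum_v w u v = N.
Hypothesis p0 : forall s u, p s 0 u = (u == s).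
Hypothesis q0 : forall s u, q s 0 u = 0.
Hypothesis pS : forall s j u, p s j.+1 u = co u * \sum_v w u v * (p s j u + q s j v).
Hypothesis qS : forall s j u, q s j.+1 u = co u * \sum_v w u v * (q s j u + p s j v).
Hypothesis W0 : 0 < \sum_u \sum_v w u v.
Hypothesis hx : 64 * K ^ 2 * (\sum_u \sum_v w u v * (x u == x v)) <= \sum_u \sum_v w u v.
Hypothesis hT : 32 * n * K ^ 2 <= T.

Let b s j u := (p s j u - q s j u) + (q s j u - p s j u).

(** Take dl = 1 / (64 K^2). A Rayleigh quotient above 2N (1 - 4 dl) makes the signless form at most
    16 dl = 1 / (4 K^2) of the energy, as [threshold_exists] asks, and n / (2 dl) = 32 n K^2 steps
    are enough for [walk_exists]. The walk is carried by [p] and [q] in natural numbers: each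
    receives the other's values at the neighbours, since these enter with a minus sign. *)
Lemma candidate_exists : exists s j th, let inY u := (0 < b s j u) && (b s j th <= b s j u) in
  [/\ j < T,
   K * (\sum_u \sum_v w u v * bad (inY u) (inY v) (q s j u < p s j u) (q s j v < p s j v)) <=
      \sum_u \sum_v w u v * (inY u || inY v) &
   0 < \sum_u \sum_v w u v * (inY u || inY v)].
Proof.
Local Open Scope ring_scope.
pose wr u v : rat := (w u v)%:R.
pose cr u : rat := (co u)%:R.
pose xr u : rat := if x u then 1 else -1.
have KR : 0 < K%:R :> rat by rewrite ltr0n.
have KR1 : 1 <= K%:R :> rat by rewrite ler1n.
(* In [rat], [done] would evaluate the numeral. *)
have [c [c0 cE]] : exists c : rat, 0 < c /\ c = 64%:R.
  by exists 64%:R; split; [rewrite ltr0n | reflexivity].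
have [dl [dl0 dlE]] : exists dl : rat, 0 < dl /\ dl * (c * K%:R ^+ 2) = 1.
  exists (c * K%:R ^+ 2)^-1; have k0 : 0 < c * K%:R ^+ 2 by rewrite mulr_gt0 ?exprn_gt0.
  by rewrite invr_gt0; split; last exact: (mulVf (lt0r_neq0 k0)).
have WE : \sum_u \sum_v wr u v = (\sum_u \sum_v w u v)%N%:R.
  by rewrite natr_sum; apply: eq_bigr => u _; rewrite natr_sum.
have wp0 : 0 < \sum_u \sum_v wr u v by rewrite WE ltr0n.
have wr0 u v : 0 <= wr u v by [].
have wrC u v : wr u v = wr v u by rewrite /wr wC.
have NR : 0 < N%:R :> rat by rewrite ltr0n.
have crE u : \sum_v wr u v != 0 -> cr u * \sum_v wr u v = N%:R.
  by rewrite -natr_sum pnatr_eq0 => /coE <-; rewrite natrM.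
have xr1 s : xr s ^+ 2 = 1 by rewrite /xr; case: ifP => _; ring.
have e4 : 4%:R * dl < 1.
  have k1 : 1 <= K%:R ^+ 2 :> rat by rewrite exprn_ege1.
  have h := ler_wpM2l (ltW dl0) k1; rewrite mulr1 in h.
  have e : c * (dl * K%:R ^+ 2) = 1 by rewrite mulrCA.
  by move: e h dl0; set z := dl * _; rewrite cE; lra.
have hform : 2%:R * N%:R * (1 - dl) * (\sum_u \sum_v wr u v) <=
   \sum_u (\sum_v wr u v) * (xr u * walk_step wr cr xr u).
  rewrite (formE wr0 wrC crE).
  have -> : \sum_u \sum_v wr u v * ((xr u - xr v) * (xr u - xr v)) =
     4%:R * (\sum_u \sum_v wr u v) - 4%:R * (\sum_u \sum_v w u v * (x u == x v))%N%:R.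
    rewrite natr_sum !mulr_sumr -sumrB; apply: eq_bigr => u _.
    rewrite natr_sum !mulr_sumr -sumrB; apply: eq_bigr => v _.
    by rewrite natrM /wr /xr; case: (x u); case: (x v) => /=; ring.
  have hx' : (\sum_u \sum_v w u v * (x u == x v))%N%:R <= dl * \sum_u \sum_v wr u v.
    have h : c * K%:R ^+ 2 * (\sum_u \sum_v w u v * (x u == x v))%N%:R <= \sum_u \sum_v wr u v.
      by rewrite WE cE -natrX -!natrM ler_nat.
    by apply: le_trans (ler_wpM2l (ltW dl0) h); rewrite mulrA dlE mul1r.
  have := ler_wpM2l (ltW NR) hx'; set X := _%:R; set Y := \sum_u _; lra.
have hT' : n%:R <= 2%:R * dl * T%:R.
  have h : 32%:R * n%:R * K%:R ^+ 2 <= T%:R :> rat by rewrite -natrX -!natrM ler_nat.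
  have := ler_wpM2l (ltW dl0) h.
  rewrite (_ : dl * (32%:R * n%:R * K%:R ^+ 2) = dl * (c * K%:R ^+ 2) * n%:R / 2%:R); last by rewrite cE; field.
  by rewrite dlE; lra.
have [s [j [jT hq]]] := walk_exists wr0 wrC NR crE xr1 wp0 dl0 erefl e4 hform hT'.
have yE u i : walk wr cr (delta s) i u = (p s i u)%:R - (q s i u)%:R.
  elim: i u => [|i IH] u; first by rewrite p0 q0 subr0 /=.
  rewrite /= /walk_step pS qS !natrM -mulrBr; congr (_ * _).
  rewrite !natr_sum -sumrB; apply: eq_bigr => v _.
  rewrite -!/(walk _ _ _ _) !IH !natrM !natrD /wr; ring.
set y := walk wr cr (delta s) j in hq yE.
have hs := form_sum wr0 wrC NR crE y.
have yEj u : y u = (p s j u)%:R - (q s j u)%:R by rewrite /y yE.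
have enE : \sum_u (\sum_v wr u v) * y u ^+ 2 = \sum_u \sum_v wr u v * y u ^+ 2.
  by apply: eq_bigr => u _; rewrite mulr_suml.
have e0 : 0 < \sum_u \sum_v wr u v * y u ^+ 2.
  rewrite -enE lt_neqAle eq_sym; apply/andP; split; last exact: (energy_ge0 wr0).
  apply: contraTneq hq => e; rewrite e mulr0 -leNgt.
  by apply: le_trans (form_le wr0 wrC NR crE y) _; rewrite e mulr0.
have e1 : 0 < \sum_u \sum_v (w u v)%:R * ((p s j u)%:R - (q s j u)%:R) ^+ 2 :> rat.
  rewrite (eq_bigr (fun u => \sum_v wr u v * y u ^+ 2)); first exact: e0.
  by move=> u _; apply: eq_bigr => v _; rewrite yEj.
have h4 : 4%:R * K%:R ^+ 2 * (\sum_u \sum_v (w u v)%:R *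
    ((p s j u)%:R - (q s j u)%:R + ((p s j v)%:R - (q s j v)%:R)) ^+ 2) <=
    \sum_u \sum_v (w u v)%:R * ((p s j u)%:R - (q s j u)%:R) ^+ 2 :> rat.
  rewrite (eq_bigr (fun u => \sum_v wr u v * (y u + y v) ^+ 2)); last first.
    by move=> u _; apply: eq_bigr => v _; rewrite !yEj.
  rewrite [leRHS](eq_bigr (fun u => \sum_v wr u v * y u ^+ 2)); last first.
    by move=> u _; apply: eq_bigr => v _; rewrite !yEj.
  rewrite -hs -enE.
  clear hs.
  set E := \sum_u (\sum_v wr u v) * y u ^+ 2 in hq *.
  set F := \sum_u (\sum_v wr u v) * (y u * _) in hq *.
  have h1 : 4%:R * (1 - 4%:R * dl) * E <= 2%:R / N%:R * F.
    rewrite -(ler_pM2l NR) (_ : N%:R * (2%:R / N%:R * F) = 2%:R * F); last first.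
      by field; rewrite gt_eqF.
    by move: hq; lra.
  have h2 : 4%:R * E - 2%:R / N%:R * F <= 16%:R * dl * E by move: h1; lra.
  have h3 := ler_wpM2l (_ : 0 <= 4%:R * K%:R ^+ 2) h2.
  apply: le_trans (h3 _) _; first by rewrite mulr_ge0 ?sqr_ge0.
  rewrite (_ : _ * (16%:R * dl * E) = dl * (c * K%:R ^+ 2) * E); last by rewrite cE; ring.
  by rewrite dlE mul1r.
have [th hth] := threshold_exists K0 wC e1 h4.
by exists s, j, th; case: hth => h1 h2; split.
Qed.
End Candidate.

(** * The algorithm *)

(* A binder at the register [x] uses [x], [x.+1] and [x.+2]. *)
Definition next x := x.+4.+4.+2.
Definition vN := Var 1.
Definition vK := Var 2.
Definition Sum x b f := Fold x b (Cst 0) (Plus (Var x.+1) f).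
Definition Beqb a b := Bor (Band a b) (Band (Bnot a) (Bnot b)).
Definition Beq a b := Band (Ble a b) (Ble b a).

Definition entry l u v :=
  Inp (Plus (Cst 2) (Plus (Times vN (Plus (Times vN l) u)) v)).
(* Only entries below the diagonal are read: the registers overwrite a part of
   the first row of the first matrix. *)
Definition adj l u v :=
  Cond (Bnot (Ble u v)) (entry l u v)
    (Cond (Bnot (Ble v u)) (entry l v u) (Cst 0)).

(* Arrays: 0 best cut so far, 1 current cut, 2 assigned vertices, 3 and 4
   positive and negative parts of the walk, 5 and 6 their next values, 7 masses
   (twice the numbers of edges), 8 weights. *)
Definition isdone u := Ble (Cst 1) (Arr 2 u).
Definition isone a u := Ble (Cst 1) (Arr a u).

Definition erem x l := Sum x vN (Sum (next x) vN
  (Cond (Bor (isdone (Var x)) (isdone (Var (next x)))) (Cst 0)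
     (adj l (Var x) (Var (next x))))).
Definition eact x l := Ble (Arr 7 l) (Times (Cst 4) (erem x l)).
Definition eweight x u v := Cond (Bor (isdone u) (isdone v)) (Cst 0)
  (Sum x vK (Cond (eact (next x) (Var x))
     (Times (Arr 8 (Var x)) (adj (Var x) u v)) (Cst 0))).
Definition edeg x u := Sum x vN (eweight (next x) u (Var x)).
(* [D^-1 (D - A)] scaled by the product of the nonzero degrees, to avoid
   divisions. *)
Definition estep x p q u :=
  Fold x vN
    (Sum (next x) vN (Times (eweight (next (next x)) u (Var (next x)))
       (Plus (Arr p u) (Arr q (Var (next x))))))
    (Cond (Bor (Beq u (Var x)) (Ble (edeg (next x) (Var x)) (Cst 0)))
       (Var x.+1) (Times (edeg (next x) (Var x)) (Var x.+1))).

Definition eabs u := Plus (Minus (Arr 3 u) (Arr 4 u)) (Minus (Arr 4 u) (Arr 3 u)).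
Definition einY th u := Band (Bnot (isdone u))
  (Band (Ble (Cst 1) (eabs u)) (Ble (eabs th) (eabs u))).
Definition esgn u := Bnot (Ble (Arr 3 u) (Arr 4 u)).
Definition ebad th u v :=
  Bor (Band (Beqb (esgn u) (esgn v)) (Bor (einY th u) (einY th v)))
    (Band (Bnot (Beqb (esgn u) (esgn v))) (Bnot (Beqb (einY th u) (einY th v)))).
Definition ecount (b : expr -> expr -> bexpr) :=
  Sum 50 vN (Sum 60 vN (Cond (b (Var 50) (Var 60))
    (eweight 70 (Var 50) (Var 60)) (Cst 0))).
Definition echeck th :=
  Band (Ble (Times (Times (Cst 32) vK) (ecount (ebad th)))
         (ecount (fun u v => Bor (einY th u) (einY th v))))
    (Ble (Cst 1) (ecount (fun u v => Bor (einY th u) (einY th v)))).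

Definition commit :=
  SIf (echeck (Var 40)) (SSeq
    (Fill 1 50 vN (Cond (einY (Var 40) (Var 50))
       (Cond (esgn (Var 50)) (Cst 1) (Cst 0)) (Arr 1 (Var 50))))
    (Fill 2 50 vN (Cond (einY (Var 40) (Var 50)) (Cst 1) (Arr 2 (Var 50))))).
Definition walk_iteration :=
  SSeq (SFor 40 vN commit)
  (SSeq (Fill 5 40 vN (estep 50 3 4 (Var 40)))
  (SSeq (Fill 6 40 vN (estep 50 4 3 (Var 40)))
  (SSeq (Fill 3 40 vN (Arr 5 (Var 40))) (Fill 4 40 vN (Arr 6 (Var 40)))))).
Definition walk_from :=
  SSeq (Fill 3 30 vN (Cond (Beq (Var 30) (Var 20)) (Cst 1) (Cst 0)))
  (SSeq (Fill 4 30 vN (Cst 0)) (SFor 30 (Var 0) walk_iteration)).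
Definition spectral_phase := SFor 10 vN (SFor 20 vN walk_from).

Definition ecutmass x a l := Sum x vN (Sum (next x) vN
  (Cond (Beqb (isone a (Var x)) (isone a (Var (next x)))) (Cst 0)
    (adj l (Var x) (Var (next x))))).
(** Minima of fractions are compared without dividing: the new minimum is at least the old one when
    each new fraction is at least some old one. Sums of 0 and 1 play the quantifiers. *)
Definition ebetter := Ble (Sum 30 vK (Cond (Ble (Cst 1) (Sum 40 vK
   (Cond (Ble (Times (ecutmass 50 0 (Var 40)) (Arr 7 (Var 30)))
              (Times (ecutmass 50 1 (Var 30)) (Arr 7 (Var 40))))
      (Cst 1) (Cst 0)))) (Cst 0) (Cst 1))) (Cst 0).
Definition keep_best := SIf ebetter (Fill 0 30 vN (Arr 1 (Var 30))).

Definition einS x r u := Ble (Cst 1) (Sum x vK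
  (Cond (Ble (Arr 7 (Var x)) (Arr 7 r))
     (Sum (next x) vN (adj (Var x) u (Var (next x)))) (Cst 0))).
(** The rank of [u] among the small vertices is the position of its colour in the binary expansion
    of the counter [a], so that counting enumerates all their cuts. *)
Definition eshift a u :=
  Fold 40 (Sum 60 u (Cond (einS 70 (Var 10) (Var 60)) (Cst 1) (Cst 0))) a
    (Div2 (Var 41)).
Definition eparity e := Minus e (Plus (Div2 e) (Div2 e)).

Definition epairs x l (same : bool) := Sum x vN (Sum (next x) vN
  (Cond (Band (isdone (Var x)) (Band (isdone (Var (next x)))
      (let b := Beqb (isone 1 (Var x)) (isone 1 (Var (next x))) in
       if same then b else Bnot b)))
    (adj l (Var x) (Var (next x))) (Cst 0))).
Definition enbrs x l v (one : bool) := Sum x vN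
  (Cond (Band (isdone (Var x))
      (let b := isone 1 (Var x) in if one then b else Bnot b))
    (adj l (Var x) v) (Cst 0)).
(* Positive ([neg = false]) and negative parts of the derivative of the
   potential in the direction of the vertex [w]. *)
Definition ederivative w (neg : bool) := Sum 50 vK
  (Times (Arr 8 (Var 50)) (Times (Arr 8 (Var 50))
    (Plus (Plus (Times (epairs 60 (Var 50) true) (enbrs 60 (Var 50) w neg))
                (Times (epairs 60 (Var 50) false) (enbrs 60 (Var 50) w (~~ neg))))
      (Times (Cst 2) (Sum 70 vN (Cond (isdone (Var 70)) (Cst 0)
         (Times (adj (Var 50) (Var 70) w) (enbrs 80 (Var 50) (Var 70) neg)))))))).

Definition greedy_step :=
  SSeq (Fill 1 40 vN (Cond (Band (Beq (Var 40) (Var 30)) (Bnot (isdone (Var 30))))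
    (Cond (Bnot (Ble (ederivative (Var 30) false) (ederivative (Var 30) true)))
       (Cst 1) (Cst 0)) (Arr 1 (Var 40))))
  (Fill 2 40 vN (Cond (Beq (Var 40) (Var 30)) (Cst 1) (Arr 2 (Var 40)))).
Definition greedy_phase :=
  SFor 10 (Plus vK (Cst 1)) (SFor 20 (Var 0)
    (SSeq (Fill 1 30 vN (Cond (einS 70 (Var 10) (Var 30))
         (eparity (eshift (Var 20) (Var 30))) (Cst 0)))
    (SSeq (Fill 2 30 vN (Cond (einS 70 (Var 10) (Var 30)) (Cst 1) (Cst 0)))
    (SSeq (SFor 30 vN greedy_step) keep_best)))).

(** In the absence of division, the quotient of n^2 by the mass is found as the number of positive
    multiples of the mass up to n^2. *)
Definition preparation :=
  SSeq (Fill 7 10 vK (Sum 20 vN (Sum 30 vN (adj (Var 10) (Var 20) (Var 30)))))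
    (Fill 8 10 vK (Sum 20 (Times vN vN) (Cond
       (Ble (Times (Plus (Var 20) (Cst 1)) (Arr 7 (Var 10))) (Times vN vN))
       (Cst 1) (Cst 0)))).

Definition algorithm :=
  SSeq preparation (SSeq spectral_phase (SSeq keep_best greedy_phase)).

Lemma algorithm_wf : swf [:: 0; 1; 2] 3 algorithm.
Proof. by vm_compute. Qed.

Ltac mirror := cbv -[iteri minn leq addn subn muln half R]; reflexivity.

(* The denotations of the expressions and statements above, with suffix [S]. *)
Section Mirror.
Variables (M n k : nat) (inp : nat -> nat).

Definition mul a b := minn a M * b.
Definition sumb b F := iteri (minn b M) (fun i z => z + F i) 0.
Definition eqbb (a b : bool) := (a && b) || (~~ a && ~~ b).
Definition eqnn (a b : nat) := (a <= b) && (b <= a).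
Definition inpS i := if (R <= i) && (i < M) then inp i else 0.
Definition entryS l u v := inpS (2 + (mul n (mul n l + u) + v)).
Definition adjacency l u v :=
  if ~~ (u <= v) then entryS l u v else if ~~ (v <= u) then entryS l v u else 0.

Implicit Type s : arrays.
Definition doneS s u := 1 <= s 2 u.
Definition oneS s a u := 1 <= s a u.
Definition remS s l := sumb n (fun u => sumb n (fun v =>
  if doneS s u || doneS s v then 0 else adjacency l u v)).
Definition actS s l := s 7 l <= mul 4 (remS s l).
Definition WS s u v := if doneS s u || doneS s v then 0 else
  sumb k (fun l => if actS s l then mul (s 8 l) (adjacency l u v) else 0).
Definition degS s u := sumb n (fun v => WS s u v).
Definition stepS s p q u :=
  iteri (minn n M) (fun v z => if eqnn u v || (degS s v <= 0) then z else mul (degS s v) z)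
    (sumb n (fun v => mul (WS s u v) (s p u + s q v))).
Definition absS s u := (s 3 u - s 4 u) + (s 4 u - s 3 u).
Definition inYS s th u := ~~ doneS s u && ((1 <= absS s u) && (absS s th <= absS s u)).
Definition sgnS s u := ~~ (s 3 u <= s 4 u).
Definition badS s th u v :=
  (eqbb (sgnS s u) (sgnS s v) && (inYS s th u || inYS s th v)) ||
  (~~ eqbb (sgnS s u) (sgnS s v) && ~~ eqbb (inYS s th u) (inYS s th v)).
Definition countS s (b : nat -> nat -> bool) := sumb n (fun u => sumb n (fun v =>
  if b u v then WS s u v else 0)).
Definition checkS s th :=
  (mul (mul 32 k) (countS s (badS s th)) <=
     countS s (fun u v => inYS s th u || inYS s th v)) &&
  (1 <= countS s (fun u v => inYS s th u || inYS s th v)).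
Definition fill s a b F : arrays := fun a' i =>
  if (a' == a) && (i < minn b M) then F i else s a' i.
Definition commitS th s : arrays :=
  if checkS s th then
    let s1 := fill s 1 n (fun u => if inYS s th u then (if sgnS s u then 1 else 0) else s 1 u) in
    fill s1 2 n (fun u => if inYS s1 th u then 1 else s1 2 u)
  else s.
Definition iterationS s : arrays :=
  let s1 := iteri (minn n M) commitS s in
  let s2 := fill s1 5 n (stepS s1 3 4) in
  let s3 := fill s2 6 n (stepS s2 4 3) in
  let s4 := fill s3 3 n (fun u => s3 5 u) in
  fill s4 4 n (fun u => s4 6 u).
Definition walk_fromS v s : arrays :=
  let s1 := fill s 3 n (fun u => if eqnn u v then 1 else 0) in
  let s2 := fill s1 4 n (fun u => 0) in
  iteri (minn M M) (fun _ => iterationS) s2.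
Definition spectralS s : arrays :=
  iteri (minn n M) (fun _ => iteri (minn n M) walk_fromS) s.

Definition cutS s a l := sumb n (fun u => sumb n (fun v =>
  if eqbb (oneS s a u) (oneS s a v) then 0 else adjacency l u v)).
Definition betterS s :=
  sumb k (fun l => if 1 <= sumb k (fun l' =>
    if mul (cutS s 0 l') (s 7 l) <= mul (cutS s 1 l) (s 7 l') then 1 else 0)
  then 0 else 1) <= 0.
Definition keepS s : arrays := if betterS s then fill s 0 n (fun u => s 1 u) else s.

Definition inSS s r u := 1 <= sumb k (fun l =>
  if s 7 l <= s 7 r then sumb n (fun v => adjacency l u v) else 0).
Definition shiftS s r a u :=
  iteri (minn (sumb u (fun v => if inSS s r v then 1 else 0)) M) (fun _ z => z./2) a.
Definition parityS e := e - (e./2 + e./2).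
Definition pairsS s l (same : bool) := sumb n (fun u => sumb n (fun v =>
  if doneS s u && (doneS s v && (let b := eqbb (oneS s 1 u) (oneS s 1 v) in
     if same then b else ~~ b)) then adjacency l u v else 0)).
Definition nbrsS s l v (one : bool) := sumb n (fun u =>
  if doneS s u && (if one then oneS s 1 u else ~~ oneS s 1 u) then adjacency l u v else 0).
Definition derivativeS s w (neg : bool) := sumb k (fun l => mul (s 8 l) (mul (s 8 l)
  ((mul (pairsS s l true) (nbrsS s l w neg) + mul (pairsS s l false) (nbrsS s l w (~~ neg)))
   + mul 2 (sumb n (fun v => if doneS s v then 0 else mul (adjacency l v w) (nbrsS s l v neg)))))).
Definition greedyS w s : arrays :=
  let s1 := fill s 1 n (fun u => if eqnn u w && ~~ doneS s w then
    (if ~~ (derivativeS s w false <= derivativeS s w true) then 1 else 0) else s 1 u) in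
  fill s1 2 n (fun u => if eqnn u w then 1 else s1 2 u).
Definition attemptS r a s : arrays :=
  let s1 := fill s 1 n (fun u => if inSS s r u then parityS (shiftS s r a u) else 0) in
  let s2 := fill s1 2 n (fun u => if inSS s1 r u then 1 else 0) in
  keepS (iteri (minn n M) greedyS s2).
Definition greedy_phaseS s : arrays :=
  iteri (minn (k + 1) M) (fun r => iteri (minn M M) (attemptS r)) s.
Definition preparationS s : arrays :=
  let s1 := fill s 7 k (fun l => sumb n (fun u => sumb n (fun v => adjacency l u v))) in
  fill s1 8 k (fun l => sumb (mul n n) (fun i =>
    if mul (i + 1) (s1 7 l) <= mul n n then 1 else 0)).
Definition algorithmS s : arrays :=
  greedy_phaseS (keepS (spectralS (preparationS s))).

Lemma preparationE s : den M inp (base_env M n k) preparation s = preparationS s.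
Proof. reflexivity. Qed.

Lemma keepE s : den M inp (base_env M n k) keep_best s = keepS s.
Proof. reflexivity. Qed.

Lemma spectralE s : den M inp (base_env M n k) spectral_phase s = spectralS s.
Proof. mirror. Qed.

Lemma greedyE s : den M inp (base_env M n k) greedy_phase s = greedy_phaseS s.
Proof. mirror. Qed.

Lemma algorithmE s : den M inp (base_env M n k) algorithm s = algorithmS s.
Proof. by rewrite /algorithmS -preparationE -spectralE -keepE -greedyE. Qed.
End Mirror.

(** * The potential of the greedy extension *)

Section Potential.
Local Open Scope ring_scope.
Variables (n : nat) (E : 'I_n -> 'I_n -> rat).
Hypotheses (EC : forall u v, E u v = E v u) (Ediag : forall u, E u u = 0).
Hypothesis EE : forall u v, E u v * E u v = E u v.

(* [y] vanishes on the unassigned vertices, whose indicator function is [r]: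
   this is the conditional expectation of [(sum E u v y u y v) ^ 2] when the
   remaining signs are uniform and independent. *)
Definition quadratic (y : 'I_n -> rat) := \sum_u \sum_v E u v * (y u * y v).
Definition pull (y : 'I_n -> rat) v := \sum_u E u v * y u.
Definition potential y r :=
  quadratic y ^+ 2 + 4%:R * (\sum_v r v * pull y v ^+ 2) +
  2%:R * (\sum_u \sum_v E u v * (r u * r v)).

Lemma sum_delta (f : 'I_n -> rat) w : \sum_v f v * (v == w)%:R = f w.
Proof.
rewrite (bigD1 w) //= eqxx mulr1 big1 ?addr0 // => v /negbTE->; exact: mulr0.
Qed.

Lemma potential_ext y y' r r' : y =1 y' -> r =1 r' -> potential y r = potential y' r'.
Proof.
move=> hy hr; rewrite /potential /quadratic /pull; congr (_ ^+ 2 + _ * _ + _ * _).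
- by apply: eq_bigr => u _; apply: eq_bigr => v _; rewrite !hy.
- by apply: eq_bigr => u _; rewrite hr; congr (_ * _ ^+ 2); apply: eq_bigr => v _; rewrite !hy.
- by apply: eq_bigr => u _; apply: eq_bigr => v _; rewrite !hr.
Qed.

(** Being a conditional expectation, the potential is the average of its values after the two
    choices of sign for [w]. So only a term odd in [xi] remains, and one of the signs does not
    increase the potential. *)
Lemma potential_update y r w xi : r w = 1 -> xi ^+ 2 = 1 ->
  potential (fun u => y u + xi * (u == w)%:R) (fun u => r u - (u == w)%:R) =
  potential y r +
    4%:R * xi * (quadratic y * pull y w + 2%:R * \sum_v r v * (E v w * pull y v)).
Proof.
move=> rw xi2; rewrite /potential.
have e1 v : pull (fun u => y u + xi * (u == w)%:R) v = pull y v + xi * E w v.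
  rewrite /pull -(sum_delta (fun u => xi * E u v) w) -big_split; apply: eq_bigr => u _ /=.
  by ring.
have q1 z : quadratic z = \sum_v z v * pull z v.
  rewrite /quadratic exchange_big; apply: eq_bigr => v _; rewrite mulr_sumr.
  by apply: eq_bigr => u _ /=; ring.
have e2 : quadratic (fun u => y u + xi * (u == w)%:R) = quadratic y + 2%:R * xi * pull y w.
  rewrite !q1.
  have -> : pull y w = \sum_v y v * E w v.
    by apply: eq_bigr => u _; rewrite EC mulrC.
  under eq_bigr => v _ do rewrite e1.
  have -> : \sum_v (y v + xi * (v == w)%:R) * (pull y v + xi * E w v) =
     \sum_v y v * pull y v + xi * (\sum_v y v * E w v) +
     \sum_v (xi * (pull y v + xi * E w v)) * (v == w)%:R.
    by rewrite mulr_sumr -!big_split; apply: eq_bigr => v _ /=; ring.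
  rewrite sum_delta Ediag mulr0 addr0.
  have -> : pull y w = \sum_v y v * E w v.
    by apply: eq_bigr => u _; rewrite EC mulrC.
  ring.
have e3 : \sum_v (r v - (v == w)%:R) * pull (fun u => y u + xi * (u == w)%:R) v ^+ 2 =
   \sum_v r v * pull y v ^+ 2 + 2%:R * xi * (\sum_v r v * (E v w * pull y v)) +
   \sum_v r v * E v w - pull y w ^+ 2.
  under eq_bigr => v _ do rewrite e1.
  have -> : \sum_v (r v - (v == w)%:R) * (pull y v + xi * E w v) ^+ 2 =
     (\sum_v r v * pull y v ^+ 2 + 2%:R * xi * (\sum_v r v * (E v w * pull y v)) +
      \sum_v r v * E v w) - \sum_v (pull y v + xi * E w v) ^+ 2 * (v == w)%:R.
    rewrite mulr_sumr -!big_split -sumrB; apply: eq_bigr => v _ /=.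
    have h : xi * xi * (E v w * E v w) = E v w by rewrite -expr2 xi2 mul1r EE.
    rewrite (EC w v) -[X in _ + X - _](congr1 (fun t => r v * t) h).
    by ring.
  by rewrite sum_delta Ediag mulr0 addr0.
have e4 : \sum_u \sum_v E u v * ((r u - (u == w)%:R) * (r v - (v == w)%:R)) =
   \sum_u \sum_v E u v * (r u * r v) - 2%:R * (\sum_v r v * E v w).
  have -> : \sum_u \sum_v E u v * ((r u - (u == w)%:R) * (r v - (v == w)%:R)) =
     \sum_u (\sum_v E u v * (r u * r v) - E u w * r u - (\sum_v E u v * r v - E u w) * (u == w)%:R).
    apply: eq_bigr => u _.
    rewrite -(sum_delta (fun v => E u v * r u) w) -(sum_delta (fun v => E u v) w).
    by rewrite -!sumrB mulr_suml -sumrB; apply: eq_bigr => v _ /=; ring.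
  rewrite !sumrB (sum_delta (fun u => \sum_v E u v * r v - E u w)) Ediag subr0.
  have -> : \sum_v E w v * r v = \sum_v r v * E v w.
    by apply: eq_bigr => v _; rewrite EC mulrC.
  have -> : \sum_u E u w * r u = \sum_v r v * E v w.
    by apply: eq_bigr => v _; rewrite mulrC.
  by ring.
rewrite e2 e3 e4.
have -> : (quadratic y + 2%:R * xi * pull y w) ^+ 2 =
  quadratic y ^+ 2 + 4%:R * xi * (quadratic y * pull y w) + 4%:R * xi ^+ 2 * pull y w ^+ 2.
  by ring.
rewrite xi2; ring.
Qed.
End Potential.

(** * Encoding partial cuts by numbers, and choosing the cutoff between small and large graphs *)

Lemma iter_half r a : iter r half a = a %/ 2 ^ r.
Proof.
elim: r => [|r IH] /=; first by rewrite expn0 divn1.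
by rewrite IH -divn2 -divnMA expnSr.
Qed.

Lemma bits_exist (P f : nat -> bool) m :
  exists2 a, a < 2 ^ (\sum_(v < m) P v) &
    forall u, u < m -> P u -> odd (iter (\sum_(v < u) P v) half a) = f u.
Proof.
elim: m => [|m [a ha IH]]; first by exists 0; rewrite ?big_ord0.
set r := \sum_(v < m) P v in ha.
exists (a + (P m && f m) * 2 ^ r).
  rewrite big_ord_recr /= -/r; case: (P m) => /=; last by rewrite mul0n !addn0.
  by rewrite addn1 expnS mul2n -addnn; case: (f m); rewrite ?mul0n ?mul1n; lia.
move=> u; rewrite ltnS leq_eqVlt => /orP[/eqP->|lt] pu.
  rewrite -/r iter_half pu /= divnDMl ?expn_gt0 // divn_small //.
  by case: (f m).
rewrite -(IH u lt pu) !iter_half.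
have le : \sum_(v < u) P v < r.
  rewrite /r -(subnKC lt) big_split_ord /= big_ord_recr /= pu.
  by rewrite addn1 leq_addr.
set q := \sum_(v < u) P v in le *.
have -> : 2 ^ r = 2 ^ (r - q) * 2 ^ q by rewrite -expnD subnK // ltnW.
rewrite mulnA divnDMl ?expn_gt0 // oddD.
have -> : odd ((P m && f m) * 2 ^ (r - q)) = false.
  by rewrite oddM oddX subn_eq0 leqNgt le /= andbF.
by rewrite addbF.
Qed.

Section Thresholds.
Variables (k : nat) (m : nat -> nat).
Hypothesis k0 : 0 < k.
(** This is 32 p^2 k for p = 2^20 k^2 (see [gap_precision]), the factor that the second-moment bound
    needs. [Z] is the gap times (2k)^2, so that cubing x exceeds the gap times (k x + 1)^2. *)
Definition gap := 2 ^ 45 * k ^ 5.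
Let Z := 2 ^ 47 * k ^ 7.
Let x j := Z ^ (3 ^ j).

Let Z0 : 0 < Z. Proof. by rewrite /Z muln_gt0 !expn_gt0 k0. Qed.

Lemma threshold_step j : gap * (k * x j + 1) ^ 2 <= x j.+1.
Proof.
have x1 : Z <= x j by rewrite /x -{1}(expn1 Z) leq_pexp2l // expn_gt0.
have xp : 0 < x j := leq_trans Z0 x1.
have -> : x j.+1 = x j * x j ^ 2 by rewrite /x -expnS -expnM expnSr.
apply: (@leq_trans (gap * (2 * k * x j) ^ 2)).
  rewrite leq_mul2l leq_exp2r //; apply/orP; right.
  have h : 0 < k * x j by rewrite muln_gt0 k0.
  by rewrite -mulnA mul2n -addnn leq_add2l.
have -> : gap * (2 * k * x j) ^ 2 = Z * x j ^ 2.
  rewrite /gap /Z !expnMn; move: (x j ^ 2) => y.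
  have e2 : 2 ^ 45 * 2 ^ 2 = 2 ^ 47 := esym (expnD 2 45 2).
  have e5 : k ^ 5 * k ^ 2 = k ^ 7 := esym (expnD k 5 2).
  move: (2 ^ 45) (2 ^ 2) (2 ^ 47) e2 => a b c e2.
  by rewrite mulnA mulnACA e2 e5.
by rewrite leq_mul2r x1 orbT.
Qed.

Lemma threshold_mono i j : i <= j -> x i <= x j.
Proof. by move=> h; rewrite /x leq_pexp2l // leq_pexp2l. Qed.

(** The estimates are generous: Z <= 2^(54 k), and the resulting exponent k + 54 k 3^k is at most
    2^(6 + 3k). *)
Lemma threshold_le j : j <= k -> k * x j <= 2 ^ (2 ^ (64 * k)).
Proof.
move=> jk; apply: leq_trans (_ : 2 ^ k * 2 ^ (54 * k * 3 ^ k) <= _).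
  apply: leq_mul; first exact: leq_exp2.
  apply: leq_trans (threshold_mono jk) _; rewrite /x expnM leq_exp2r ?expn_gt0 //.
  apply: (@leq_trans (2 ^ 47 * (2 ^ k) ^ 7)).
    by rewrite leq_mul2l leq_exp2r ?leq_exp2 ?orbT.
  by rewrite -expnM -expnD leq_exp2l //; lia.
rewrite -expnD leq_exp2l //.
have h1 : 3 ^ k <= 2 ^ (2 * k) by rewrite expnM leq_exp2r.
have h2 : k <= 2 ^ k := leq_exp2 k.
have h3 : 2 ^ 6 * 2 ^ k * 2 ^ (2 * k) <= 2 ^ (64 * k).
  by rewrite -!expnD leq_exp2l //; lia.
apply: leq_trans h3; apply: (@leq_trans (55 * k * 2 ^ (2 * k))).
  apply: (@leq_trans (k * 2 ^ (2 * k) + 54 * k * 2 ^ (2 * k))).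
    by rewrite leq_add ?leq_mul2l ?h1 ?orbT // leq_pmulr // expn_gt0.
  by rewrite -mulnDl leq_mul2r; apply/orP; right; lia.
by rewrite leq_mul2r; apply/orP; right; apply: leq_mul h2.
Qed.

(** Pigeonhole: the k + 1 windows between successive thresholds are disjoint and there are only k
    masses. *)
Lemma gap_exists : exists2 j, j <= k & forall l, l < k -> m l <= x j \/ x j.+1 < m l.
Proof.
case: (boolP [exists j : 'I_k.+1, [forall l : 'I_k, (m l <= x j) || (x j.+1 < m l)]]).
  move=> /existsP[j /forallP h]; exists j; first by rewrite -ltnS.
  by move=> l hl; apply/orP; apply: (h (Ordinal hl)).
move=> /existsPn h.
have h' (j : 'I_k.+1) : exists l : 'I_k, (x j < m l) && (m l <= x j.+1).
  have /forallPn[l] := h j; rewrite negb_or -leqNgt -ltnNge => hl; by exists l.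
pose g j := xchoose (h' j).
have gP (j : 'I_k.+1) : (x j < m (g j)) && (m (g j) <= x j.+1) := xchooseP (h' j).
have inj : injective g.
  suff lt (i j : 'I_k.+1) : i < j -> g i <> g j.
    move=> i j e; apply: val_inj; case: (ltngtP i j) => // hij.
      by case: (lt _ _ hij).
    by case: (lt _ _ hij).
  move=> hij e; have /andP[_ h1] := gP i; have /andP[h2 _] := gP j.
  rewrite e in h1; have := leq_trans h2 h1.
  by rewrite ltnNge threshold_mono.
by have := leq_card g inj; rewrite !card_ord ltnn.
Qed.

(* The cutoff [k] stands for the empty set of small graphs. *)
Lemma cutoff_exists : (forall l, l < k -> 0 < m l) -> m k = 0 ->
  exists2 r, r <= k & k * m r <= 2 ^ (2 ^ (64 * k)) /\
    forall l, l < k -> m r < m l -> gap * (k * m r + 1) ^ 2 <= m l.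
Proof.
move=> m0 mk; have [j jk hj] := gap_exists.
case: (boolP [exists l : 'I_k, m l <= x j]) => [/existsP[l0 hl0]|/existsPn hn].
  (* The program knows the masses but not [x j]: the cutoff becomes the largest mass up to [x j],
     and the gap above it can only be wider. *)
  have [r hr hmax] := @arg_maxnP _ l0 (fun l : 'I_k => m l <= x j) (fun l => m l) hl0.
  exists r; first exact: ltnW.
  split; first by apply: leq_trans (threshold_le jk); rewrite leq_mul2l hr orbT.
  move=> l hl hrl; case: (hj l hl) => [h|h].
    by have := hmax (Ordinal hl) h; rewrite /= leqNgt hrl.
  apply: leq_trans (ltnW h); apply: leq_trans (threshold_step j).
  by rewrite leq_mul2l leq_exp2r // leq_add2r leq_mul2l hr !orbT.
exists k => //; rewrite mk muln0; split=> // l hl _.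
case: (hj l hl) => [h|h]; first by have := hn (Ordinal hl); rewrite /= h.
apply: leq_trans (ltnW h); apply: leq_trans (threshold_step j).
by rewrite leq_mul2l leq_exp2r // leq_add2r orbT.
Qed.
End Thresholds.

(** * Analysis of the algorithm *)

Lemma iteri_ind (T : Type) (P : T -> Prop) n (f : nat -> T -> T) x :
  P x -> (forall i y, i < n -> P y -> P (f i y)) -> P (iteri n f x).
Proof.
move=> Px Pf; elim: n Pf => [|n IH] Pf //=.
by apply: (Pf) => //; apply: IH => i y hi; apply: Pf; apply: ltnW.
Qed.

Lemma iteri_indS (T : Type) (P : nat -> T -> Prop) n (f : nat -> T -> T) x :
  P 0 x -> (forall i y, i < n -> P i y -> P i.+1 (f i y)) -> P n (iteri n f x).
Proof.
move=> Px Pf; elim: n Pf => [|n IH] Pf //=.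
by apply: (Pf) => //; apply: IH => i y hi; apply: Pf; apply: ltnW.
Qed.

(** The pattern of all exhaustive searches below: turn [i0] reaches the goal, later turns keep it,
    and earlier turns matter only through the invariant [P]. *)
Lemma iteri_hit (T : Type) (P : nat -> T -> Prop) (Q : T -> Prop) n
    (f : nat -> T -> T) x i0 :
  i0 < n -> P 0 x -> (forall i y, i < n -> P i y -> P i.+1 (f i y)) ->
  (forall y, P i0 y -> Q (f i0 y)) ->
  (forall i y, i < n -> P i y -> Q y -> Q (f i y)) ->
  Q (iteri n f x).
Proof.
move=> hi Px Pf Qi Qf.
suff [_ h] : P n (iteri n f x) /\ (i0 < n -> Q (iteri n f x)) by exact: h.
apply: (iteri_indS (P := fun n y => P n y /\ (i0 < n -> Q y))) => // i y hin [h1 h2].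
split; first exact: Pf.
rewrite ltnS leq_eqVlt => /orP[/eqP e|lt]; first by subst; apply: Qi.
by apply: (Qf) => //; apply: h2.
Qed.

Lemma iteri_sum n F : iteri n (fun i z => z + F i) 0 = \sum_(i < n) F i.
Proof. by elim: n => [|n IH] /=; rewrite ?big_ord0 // big_ord_recr /= IH. Qed.

Lemma iteri_prod n (C : nat -> bool) (d : nat -> nat) z :
  iteri n (fun i z => if C i then z else d i * z) z =
  (\prod_(i < n | ~~ C i) d i) * z.
Proof.
elim: n => [|n IH] /=; first by rewrite big_ord0 mul1n.
rewrite big_mkcond big_ord_recr /= -big_mkcond IH; case: (C n) => /=; first by rewrite muln1.
by rewrite mulnA (mulnC (d n)).
Qed.

Lemma eq_iteri (T : Type) n (f g : nat -> T -> T) x :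
  (forall i z, i < n -> f i z = g i z) -> iteri n f x = iteri n g x.
Proof. by elim: n => //= n IH h; rewrite h // IH // => i z hi; apply: h; apply: ltnW. Qed.

Lemma eqbbE a b : eqbb a b = (a == b).
Proof. by case: a; case: b. Qed.

Lemma eqnnE a b : eqnn a b = (a == b).
Proof. by rewrite /eqnn -eqn_leq. Qed.

Section Analysis.
Variables (M n k : nat) (inp : nat -> nat).
Hypotheses (n0 : 0 < n) (k0 : 0 < k).
Hypothesis MB : 2 ^ 20 * k ^ 2 * n ^ 4 <= M.
Let A l u v := adjacency M n inp l u v.
Hypothesis A01 : forall l u v, l < k -> u < n -> v < n -> A l u v <= 1.

Definition mass l := \sum_(u < n) \sum_(v < n) A l u v.
Hypothesis mass0 : forall l, l < k -> 0 < mass l.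

Lemma AC l u v : A l u v = A l v u.
Proof. by rewrite /A /adjacency; case: (ltngtP u v). Qed.

(** What [M] must reach so that nothing is cut off: loop counts, first factors of products (degrees
    are at most [k * n ^ 3]), and the length [32 * n * (32 * k) ^ 2] of the walk. *)
Lemma bounds : [/\ n <= M, k.+1 <= M, n * n <= M, 32 * k <= M & k * n ^ 3 <= M] /\
  32 * n * (32 * k) ^ 2 <= M /\ 4 <= M.
Proof.
have k1 : k <= k ^ 2 by rewrite -mulnn leq_pmulr.
have n1 : n <= n ^ 4 by rewrite expnS leq_pmulr // expn_gt0 n0.
have n2 : n * n <= n ^ 4 by rewrite mulnn leq_pexp2l.
have n3 : n ^ 3 <= n ^ 4 by rewrite leq_pexp2l.
have kn : k ^ 2 * n ^ 4 <= 2 ^ 20 * k ^ 2 * n ^ 4 by rewrite -mulnA leq_pmull // expn_gt0.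
have kp : 0 < k ^ 2 by rewrite expn_gt0 k0.
have np : 0 < n ^ 4 by rewrite expn_gt0 n0.
have h x : 0 < x -> k ^ 2 <= k ^ 2 * x by move=> hx; rewrite leq_pmulr.
have h' x : x <= k ^ 2 * x by rewrite leq_pmull.
have e20 c : c <= 2 ^ 15 -> c * (k ^ 2 * n ^ 4) <= M.
  move=> hc; apply: leq_trans MB; rewrite -mulnA leq_mul2r; apply/orP; right.
  by apply: leq_trans hc _; rewrite leq_exp2l.
have c64 : 64 * (k ^ 2 * n ^ 4) <= M.
  by apply: e20; apply: (@leq_trans (2 ^ 6)); rewrite ?leq_exp2l.
split; first split.
- by apply: leq_trans c64; have := h' (n ^ 4); lia.
- apply: leq_trans c64; have := h _ np; have := h' (n ^ 4).
  by move: (k ^ 2) (n ^ 4) k1 kp np; move=> K N; nia.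
- by apply: leq_trans c64; have := h' (n ^ 4); lia.
- by apply: leq_trans c64; have := h _ np; lia.
- apply: leq_trans (leq_mul k1 n3) _; apply: leq_trans c64; lia.
split; last by apply: leq_trans c64; have := h _ np; lia.
apply: leq_trans (e20 _ (leqnn _)).
rewrite expnMn mulnACA [32 * 32 ^ 2](_ : _ = 2 ^ 15); last by rewrite -[32]/(2 ^ 5) -expnM -expnD.
by rewrite leq_mul2l (mulnC n) leq_mul2l n1 !orbT.
Qed.
Let nM : n <= M. Proof. by have [[]] := bounds. Qed.
Let kM : k <= M. Proof. by have [[_ /ltnW]] := bounds. Qed.
Let nnM : n * n <= M. Proof. by have [[]] := bounds. Qed.

Lemma SE b F : b <= M -> sumb M b F = \sum_(i < b) F i.
Proof. by move=> h; rewrite /sumb (minn_idPl h) iteri_sum. Qed.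

Lemma mulE a b : a <= M -> mul M a b = a * b.
Proof. by move=> h; rewrite /mul (minn_idPl h). Qed.

Definition cw l := n * n %/ mass l.

Lemma mass_le l : l < k -> mass l <= n * n.
Proof.
move=> hl; apply: (@leq_trans (\sum_(u < n) \sum_(v < n) 1)).
  by apply: leq_sum => u _; apply: leq_sum => v _; apply: A01.
by rewrite sum_nat_const sum1_card !card_ord.
Qed.

Lemma cw_le l : cw l <= n * n.
Proof. exact: leq_div. Qed.

Lemma cw_mass l : cw l * mass l <= n * n.
Proof. exact: leq_divM. Qed.

(** As the mass is at most n^2, rounding the quotient down at most halves it: all weighted masses
    lie between n^2 / 2 and n^2. *)
Lemma cw_mass2 l : l < k -> n * n < 2 * (cw l * mass l).
Proof.
move=> hl; have m0 := mass0 hl.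
have h := ltn_ceil (n * n) m0; rewrite -/(cw l) mulSn in h.
have c1 : 0 < cw l by rewrite divn_gt0 // mass_le.
have : mass l <= cw l * mass l by rewrite leq_pmull.
by lia.
Qed.

Definition prepared (s : arrays) :=
  [/\ forall l, l < k -> s 7 l = mass l, s 7 k = 0 & forall l, l < k -> s 8 l = cw l].

Definition undone (D : nat -> bool) u v := ~~ D u && ~~ D v.
Definition part (P : nat -> nat -> bool) l :=
  \sum_(u < n) \sum_(v < n) A l u v * P u v.
Definition active D l := mass l <= 4 * part (undone D) l.
Definition weight D u v := \sum_(l < k) active D l * (cw l * (A l u v * undone D u v)).

Lemma eq_part (P Q : nat -> nat -> bool) l :
  (forall u v, u < n -> v < n -> P u v = Q u v) -> part P l = part Q l.
Proof. by move=> h; apply: eq_bigr => u _; apply: eq_bigr => v _; rewrite h. Qed.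

Lemma part_le P l : part P l <= mass l.
Proof.
apply: leq_sum => u _; apply: leq_sum => v _; case: (P u v); by rewrite ?muln1 ?muln0.
Qed.

Lemma part_leq (P Q : nat -> nat -> bool) l :
  (forall u v, u < n -> v < n -> P u v -> Q u v) -> part P l <= part Q l.
Proof.
move=> h; apply: leq_sum => u _; apply: leq_sum => v _; rewrite leq_mul2l.
by have := h u v (ltn_ord u) (ltn_ord v); case: (P u v) => [->|] //; rewrite orbT.
Qed.

Lemma weightC D u v : weight D u v = weight D v u.
Proof. by apply: eq_bigr => l _; rewrite AC /undone andbC. Qed.

Lemma remSE s l : remS M n inp s l = part (undone (doneS s)) l.
Proof.
rewrite /remS SE //; apply: eq_bigr => u _; rewrite SE //; apply: eq_bigr => v _.
by rewrite /undone -negb_or; case: (_ || _); rewrite ?muln0 ?muln1.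
Qed.

Lemma actSE s l : prepared s -> l < k -> actS M n inp s l = active (doneS s) l.
Proof.
by move=> [h _ _] hl; rewrite /actS mulE ?remSE ?h // ; have [_ [_]] := bounds.
Qed.

Lemma WSE s u v : prepared s -> WS M n k inp s u v = weight (doneS s) u v.
Proof.
move=> ps; rewrite /WS /weight /undone -negb_or; case: (_ || _) => /=.
  by rewrite big1 // => l _; rewrite !muln0.
rewrite SE //; apply: eq_bigr => l _; rewrite actSE // muln1.
have [_ _ h8] := ps; rewrite h8 // mulE; last exact: leq_trans (cw_le _) nnM.
by case: active; rewrite ?mul1n.
Qed.

Lemma weight_le D u v : u < n -> v < n -> weight D u v <= k * (n * n).
Proof.
move=> hu hv; apply: (@leq_trans (\sum_(l < k) n * n)); last by rewrite sum_nat_const card_ord.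
apply: leq_sum => l _; have := A01 (ltn_ord l) hu hv; have := cw_le l.
case: active; rewrite ?mul0n // mul1n => h1 h2.
apply: leq_trans h1; rewrite -{2}(muln1 (cw l)) leq_mul2l; apply/orP; right.
by apply: leq_trans h2; case: undone; rewrite ?muln1 ?muln0.
Qed.

Definition degree D u := \sum_(v < n) weight D u v.

Lemma degree_le D u : u < n -> degree D u <= M.
Proof.
move=> hu; have [[_ _ _ _ h] _] := bounds; apply: leq_trans h.
rewrite (_ : k * n ^ 3 = \sum_(v < n) k * (n * n)).
  by apply: leq_sum => v _; apply: weight_le.
by rewrite sum_nat_const card_ord !expnS expn0; lia.
Qed.

Lemma degSE s u : prepared s -> degS M n k inp s u = degree (doneS s) u.
Proof. by move=> ps; rewrite /degS SE //; apply: eq_bigr => v _; rewrite WSE. Qed.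

Lemma countSE s b : prepared s -> countS M n k inp s b =
  \sum_(u < n) \sum_(v < n) weight (doneS s) u v * b u v.
Proof.
move=> ps; rewrite /countS SE //; apply: eq_bigr => u _; rewrite SE //.
by apply: eq_bigr => v _; rewrite WSE //; case: (b u v); rewrite ?muln0 ?muln1.
Qed.

Lemma sum_weight D (b : nat -> nat -> bool) :
  \sum_(u < n) \sum_(v < n) weight D u v * b u v =
  \sum_(l < k) active D l * (cw l * part (fun u v => undone D u v && b u v) l).
Proof.
under eq_bigr => u _ do under eq_bigr => v _ do rewrite big_distrl /=.
under eq_bigr => u _ do rewrite exchange_big /=.
rewrite exchange_big; apply: eq_bigr => l _ /=.
rewrite /part !big_distrr; apply: eq_bigr => u _ /=.
rewrite !big_distrr; apply: eq_bigr => v _ /=.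
by case: (undone D u v); case: (b u v); rewrite ?muln0 ?muln1.
Qed.

Definition cutdone s l :=
  part (fun u v => [&& doneS s u, doneS s v & oneS s 1 u != oneS s 1 v]) l.

(** [tau l] counts the edges of [l] that received a coloured end while [l] was active, and [b l]
    bounds those among them that are lost. A dropped graph stops counting: its later edges are no
    longer controlled, but three quarters of its mass already are. Only the weighted sum of the
    losses over all graphs is bounded. *)
Definition spectral_inv s := prepared s /\ exists b tau : nat -> nat,
  [/\ forall l, l < k -> tau l <= cutdone s l + b l,
      forall l, l < k -> tau l <= mass l,
      forall l, l < k -> active (doneS s) l ->
        tau l + part (undone (doneS s)) l = mass l,
      forall l, l < k -> ~~ active (doneS s) l -> 3 * mass l <= 4 * tau l &
      32 * k * (\sum_(l < k) cw l * b l) <= \sum_(l < k) cw l * tau l].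

Lemma spectral_inv_ext s s' :
  (forall a u, a \in [:: 1; 2; 7; 8] -> s' a u = s a u) ->
  spectral_inv s -> spectral_inv s'.
Proof.
move=> h [[p1 p2 p3] [b [tau [h1 h2 h3 h4 h5]]]]; split.
  by split=> [l hl||l hl]; rewrite h // ?p1 ?p2 ?p3.
have hd u : doneS s' u = doneS s u by rewrite /doneS h.
have ep l : part (undone (doneS s')) l = part (undone (doneS s)) l.
  by apply: eq_part => u v _ _; rewrite /undone !hd.
have ea l : active (doneS s') l = active (doneS s) l by rewrite /active ep.
have ec l : cutdone s' l = cutdone s l.
  by apply: eq_part => u v _ _; rewrite !hd /oneS !h.
exists b, tau; split=> // l hl; rewrite ?ec ?ea ?ep; auto.
Qed.

Definition inY s th u := ~~ doneS s u && ((0 < absS s u) && (absS s th <= absS s u)).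
Definition sgn (s : arrays) u := s 4 u < s 3 u.

Lemma badSE s th u v :
  badS s th u v = bad (inY s th u) (inY s th v) (sgn s u) (sgn s v).
Proof.
rewrite /badS /bad !eqbbE /sgn /sgnS !ltnNge; congr (_ || (_ && _)).
Qed.

Lemma commit_facts th s : let s' := commitS M n k inp th s in
  [/\ forall a u, a \notin [:: 1; 2] -> s' a u = s a u,
      forall u, u < n -> doneS s' u =
        doneS s u || (checkS M n k inp s th && inY s th u) &
      forall u, u < n -> oneS s' 1 u =
        if checkS M n k inp s th && inY s th u then sgn s u else oneS s 1 u].
Proof.
rewrite /commitS; case: ifP => _ /=; last by split=> // u; rewrite orbF.
split.
- by move=> a u; rewrite !inE negb_or /fill => /andP[/negbTE-> /negbTE->].
- move=> u hu; rewrite /doneS /fill /= (minn_idPl nM) hu.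
  by case: ifP => h; have -> : inY s th u = _ := h; rewrite ?orbT ?orbF.
- move=> u hu; rewrite /oneS /fill /= (minn_idPl nM) hu.
  case: ifP => h; have -> : inY s th u = _ := h => //.
  by rewrite /sgnS -ltnNge -/(sgn s u); case: ifP.
Qed.

Lemma partD P Q l : (forall u v, u < n -> v < n -> ~~ (P u v && Q u v)) ->
  part P l + part Q l = part (fun u v => P u v || Q u v) l.
Proof.
move=> h; rewrite /part -big_split; apply: eq_bigr => u _; rewrite -big_split.
apply: eq_bigr => v _ /=; have := h u v (ltn_ord u) (ltn_ord v).
by case: (P u v); case: (Q u v) => //= _; rewrite ?muln0 ?muln1 ?addn0.
Qed.

(** An edge newly met by the set is either cut or bad, and [checkS] says that the bad ones weigh at
    most 1 / (32 k) of all those newly met. Both counters grow for active graphs only, which are the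
    graphs that [checkS] weighs. *)
Lemma commit_inv th s : spectral_inv s -> spectral_inv (commitS M n k inp th s).
Proof.
move=> [ps [b [tau [h1 h2 h3 h4 h5]]]].
have [f1 f2 f3] := commit_facts th s.
case: (boolP (checkS M n k inp s th)) => hc; last first.
  by rewrite /commitS (negbTE hc); split=> //; exists b, tau.
rewrite hc /= in f2 f3; set s' := commitS _ _ _ _ _ _ in f1 f2 f3 *.
move: hc; rewrite /checkS !countSE // => /andP[hc _].
have [[_ _ _ k32 _] _] := bounds.
have M32 : 32 <= M by apply: leq_trans k32; rewrite leq_pmulr.
rewrite (mulE _ M32) mulE // in hc.
set D := doneS s in hc h3 h4; set D' := doneS s'.
rewrite sum_weight (sum_weight _ (fun u v => inYS s th u || inYS s th v)) in hc.
pose Y := inY s th.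
have YD u : ~~ (D u && Y u) by rewrite /Y /inY -/(D u); case: (D u).
pose badl l := part (fun u v => undone D u v && badS s th u v) l.
pose tol l := part (fun u v => undone D u v && (inY s th u || inY s th v)) l.
have remE l : part (undone D') l + tol l = part (undone D) l.
  rewrite partD; last first.
    by move=> u v hu hv; rewrite /undone /D' !f2 // -/(D u) -/(D v) -/(Y u) -/(Y v);
       case: (D u); case: (D v); case: (Y u); case: (Y v).
  apply: eq_part => u v hu hv; rewrite /undone /D' !f2 // -/(D u) -/(D v) -/(Y u) -/(Y v).
  by case: (D u); case: (D v); case: (Y u); case: (Y v).
have cutE l : cutdone s l + tol l <= cutdone s' l + badl l.
  rewrite /cutdone /tol /badl /part -!big_split; apply: leq_sum => u _.
  rewrite -!big_split; apply: leq_sum => v _ /=; rewrite -!mulnDr leq_mul2l; apply/orP; right.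
  rewrite !f2 // !f3 // badSE /bad /undone -/(D u) -/(D v) -/(Y u) -/(Y v).
  by move: (YD u) (YD v); case: (D u); case: (D v); case: (Y u) => //; case: (Y v) => //= _ _;
    case: (sgn s u); case: (sgn s v); case: (oneS s 1 u); case: (oneS s 1 v).
have cutE' l : cutdone s l <= cutdone s' l.
  apply: part_leq => u v hu hv /and3P[d1 d2 d3]; rewrite !f2 // !f3 //.
  by move: (YD u) (YD v); rewrite /D d1 d2 /= -/(Y u) -/(Y v) => /negbTE-> /negbTE->.
have actE l : active D' l -> active D l.
  by rewrite /active => /leq_trans; apply; rewrite leq_mul2l -remE leq_addr.
split.
  by case: ps => p1 p2 p3; split=> [l hl||l hl]; rewrite f1 // ?p1 ?p2 ?p3.
exists (fun l => b l + active D l * badl l), (fun l => tau l + active D l * tol l).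
split.
- move=> l hl; have := h1 l hl; have := cutE l; have := cutE' l.
  by case: active; rewrite ?mul1n ?mul0n ?addn0; lia.
- move=> l hl; case: (boolP (active D l)) => ha; rewrite ?mul0n ?addn0 ?mul1n; last exact: h2.
  by rewrite -(h3 l hl ha) leq_add2l -(remE l) leq_addl.
- move=> l hl ha; have ha' := actE l ha; rewrite ha' mul1n -(h3 l hl ha') -(remE l).
  by rewrite -/D' addnAC addnA.
- move=> l hl ha; case: (boolP (active D l)) => ha'; rewrite ?mul0n ?addn0 ?mul1n; last exact: h4.
  have := h3 l hl ha'; rewrite -(remE l); move: ha; rewrite -/D' /active -ltnNge; lia.
- have e (f : nat -> nat) (g : nat -> nat) : \sum_(l < k) cw l * (f l + active D l * g l) =
      \sum_(l < k) cw l * f l + \sum_(l < k) active D l * (cw l * g l).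
    rewrite -big_split; apply: eq_bigr => l _ /=; rewrite mulnDr; congr (_ + _).
    by rewrite mulnCA.
  by rewrite !e mulnDr; apply: leq_add; [exact: h5 | exact: hc].
Qed.

Definition ndone s := \sum_(u < n) doneS s u.

Lemma commit_mono th s u : u < n -> doneS s u -> doneS (commitS M n k inp th s) u.
Proof. by move=> hu h; have [_ f2 _] := commit_facts th s; rewrite f2 // h. Qed.

Lemma ndone_mono s s' : (forall u, u < n -> doneS s u -> doneS s' u) -> ndone s <= ndone s'.
Proof. by move=> h; apply: leq_sum => u _; case: (boolP (doneS s u)) => // /h ->. Qed.

Lemma ndone_progress s s' v : (forall u, u < n -> doneS s u -> doneS s' u) ->
  v < n -> ~~ doneS s v -> doneS s' v -> ndone s < ndone s'.
Proof.
move=> h hv d d'; rewrite /ndone (bigD1 (Ordinal hv)) //= (negbTE d) add0n.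
rewrite [X in _ < X](bigD1 (Ordinal hv)) //= d' add1n ltnS.
by apply: leq_sum => u _; case: (boolP (doneS s u)) => // /h ->.
Qed.

Lemma commit_progress th s : prepared s -> checkS M n k inp s th ->
  ndone s < ndone (commitS M n k inp th s).
Proof.
move=> ps hc; have [_ f2 _] := commit_facts th s.
move: (hc); rewrite {1}/checkS => /andP[_]; rewrite countSE //.
case: (boolP [exists u : 'I_n, inY s th u]) => [/existsP[u hu] _|/existsPn h].
  apply: (ndone_progress (v := u)) => //; first exact: commit_mono.
    by have /andP[] := hu.
  by rewrite f2 // hc hu orbT.
have hY (u : 'I_n) : inYS s th u = false := negbTE (h u).
by rewrite big1 // => u _; rewrite big1 // => v _; rewrite !hY muln0.
Qed.

Definition coef D u := \prod_(v < n | ~~ ((u == v :> nat) || (degree D v <= 0))) degree D v.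

Lemma coef_degree D (u : 'I_n) : degree D u != 0 ->
  coef D u * degree D u = \prod_(v < n | degree D v != 0) degree D v.
Proof.
move=> h; rewrite [RHS](bigD1 u) //= mulnC; congr (_ * _).
apply: eq_bigl => v; rewrite negb_or leqn0 andbC; congr (_ && _).
by rewrite eq_sym val_eqE.
Qed.

Lemma stepSE s p q u : prepared s -> u < n ->
  stepS M n k inp s p q u =
  coef (doneS s) u * \sum_(v < n) weight (doneS s) u v * (s p u + s q v).
Proof.
move=> ps hu; rewrite /stepS (minn_idPl nM) SE //.
rewrite (eq_iteri (g := fun v z => if (u == v) || (degree (doneS s) v <= 0) then z
   else degree (doneS s) v * z)); last first.
  by move=> v z hv; rewrite eqnnE degSE // mulE // degree_le.
rewrite iteri_prod; congr (_ * _); apply: eq_bigr => v _; rewrite WSE // mulE //.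
apply: leq_trans (degree_le (doneS s) hu).
by rewrite /degree (bigD1 v) //= leq_addr.
Qed.

Definition walk_pair D v := fix walk j : (nat -> nat) * (nat -> nat) :=
  if j is j.+1 then
    let p := (walk j).1 in let q := (walk j).2 in
    (fun u => coef D u * \sum_(v < n) weight D u v * (p u + q v),
     fun u => coef D u * \sum_(v < n) weight D u v * (q u + p v))
  else (fun u => (u == v) : nat, fun _ => 0).

Lemma weight_undone D u v : ~~ undone D u v -> weight D u v = 0.
Proof. by move=> /negbTE h; rewrite /weight h big1 // => l _; rewrite !muln0. Qed.

(** * The spectral phase when some cut is nearly perfect for all graphs *)

Section NearlyBipartite.
Variable x : nat -> bool.
Hypothesis hx : forall l, l < k ->
  2 ^ 18 * k ^ 2 * part (fun u v => x u == x v) l <= mass l.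

(** The candidate depends on the set [D] of coloured vertices alone, so that the nested loops can
    meet it in any state that has coloured [D] and carries the walk. *)
Lemma good_candidate D : (exists2 l, l < k & active D l) ->
  exists v j th, [/\ v < n, j < M, th < n &
    forall s, prepared s -> (forall u, u < n -> doneS s u = D u) ->
     (forall u, u < n -> s 3 u = (walk_pair D v j).1 u) ->
     (forall u, u < n -> s 4 u = (walk_pair D v j).2 u) ->
     checkS M n k inp s th].
Proof.
move=> [l0 hl0 act0].
pose w (u v : 'I_n) := weight D u v.
have K0 : 0 < 32 * k by rewrite muln_gt0.
have wE : \sum_u \sum_v w u v = \sum_(l < k) active D l * (cw l * part (undone D) l).
  transitivity (\sum_(u < n) \sum_(v < n) weight D u v * true).
    by apply: eq_bigr => u _; apply: eq_bigr => v _; rewrite muln1.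
  rewrite (sum_weight _ (fun _ _ => true)); apply: eq_bigr => l _.
  by congr (_ * (_ * _)); apply: eq_part => u v _ _; rewrite andbT.
have W0 : 0 < \sum_u \sum_v w u v.
  rewrite wE (bigD1 (Ordinal hl0)) //= act0 mul1n addn_gt0 muln_gt0.
  have m0 := mass0 hl0; rewrite /cw divn_gt0 // mass_le //=.
  by move: act0; rewrite /active; case: part => //; lia.
have hxw : 64 * (32 * k) ^ 2 * (\sum_u \sum_v w u v * (x u == x v)) <= \sum_u \sum_v w u v.
  rewrite (sum_weight _ (fun u v => x u == x v)) wE big_distrr; apply: leq_sum => l _ /=.
  case: (boolP (active D l)) => ha; rewrite ?mul0n ?muln0 // !mul1n mulnCA leq_mul2l.
  apply/orP; right.
  have h1 : part (fun u v => undone D u v && (x u == x v)) l <= part (fun u v => x u == x v) l.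
    by apply: part_leq => u v _ _ /andP[].
  have h2 := hx (ltn_ord l).
  (* Here 2^18 = 4 * 64 * 32^2. The 4 is the reason for dropping graphs: an active graph keeps at
     least a quarter of its mass, so its uncut fraction grows at most fourfold. *)
  have h3 : 2 ^ 2 * (2 ^ 6 * (2 ^ 5 * k) ^ 2) = 2 ^ 18 * k ^ 2.
    by rewrite expnMn -expnM 2!mulnA -!expnD; congr (2 ^ _ * _).
  have -> : 64 * (32 * k) ^ 2 = 2 ^ 6 * (2 ^ 5 * k) ^ 2 by [].
  rewrite -(leq_pmul2l (isT : 0 < 2 ^ 2)) mulnA h3.
  by apply: leq_trans ha; apply: leq_trans h2; rewrite leq_mul2l h1 orbT.
have hT : 32 * n * (32 * k) ^ 2 <= M by have [_ []] := bounds.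
have N0 : 0 < \prod_(v < n | degree D v != 0) degree D v.
  by apply: prodn_cond_gt0 => v; rewrite lt0n.
have [v [j [th [jM h1 h2]]]] := @candidate_exists n w (fun u => coef D u) _ (32 * k) M
  (fun u => x u) (fun v j u => (walk_pair D v j).1 u) (fun v j u => (walk_pair D v j).2 u)
  N0 K0 (fun u v => weightC D u v) (@coef_degree D) (fun _ _ => erefl) (fun _ _ => erefl)
  (fun _ _ _ => erefl) (fun _ _ _ => erefl) W0 hxw hT.
exists v, j, th; split=> // s ps hD h3 h4.
have [[_ _ _ k32 _] _] := bounds.
have M32 : 32 <= M by apply: leq_trans k32; rewrite leq_pmulr.
have wD (u v' : 'I_n) : weight (doneS s) u v' = w u v'.
  have hu u' v'' : u' < n -> v'' < n -> undone (doneS s) u' v'' = undone D u' v''.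
    by move=> hu hv; rewrite /undone !hD.
  rewrite /w /weight; apply: eq_bigr => l _; rewrite hu //; congr (_ * _).
  by rewrite /active (eq_part (Q := undone D)).
have absE (u : 'I_n) : absS s u = ((walk_pair D v j).1 u - (walk_pair D v j).2 u) +
    ((walk_pair D v j).2 u - (walk_pair D v j).1 u).
  by rewrite /absS h3 // h4.
(* Pairs of nonzero weight have both ends uncoloured, so the corresponding test in [inY]
   disappears. *)
have key (P : bool -> bool -> bool -> bool -> bool) :
   \sum_(u < n) \sum_(v' < n) weight (doneS s) u v' *
      P (inY s th u) (inY s th v') (sgn s u) (sgn s v') =
   \sum_u \sum_v' w u v' *
      P ((0 < absS s u) && (absS s th <= absS s u)) ((0 < absS s v') && (absS s th <= absS s v'))
         ((walk_pair D v j).2 u < (walk_pair D v j).1 u) ((walk_pair D v j).2 v' < (walk_pair D v j).1 v').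
  apply: eq_bigr => u _; apply: eq_bigr => v' _; rewrite wD.
  case: (boolP (undone D u v')) => [|/weight_undone]; last by rewrite /w => ->.
  by rewrite /undone /inY /sgn => /andP[d1 d2]; rewrite !hD // d1 d2 /= h3 // h3 // h4 // h4.
rewrite /checkS !countSE // (mulE _ M32) mulE //.
have -> : \sum_(u < n) \sum_(v0 < n) weight (doneS s) u v0 * badS s th u v0 =
  \sum_(u < n) \sum_(v0 < n) weight (doneS s) u v0 * bad (inY s th u) (inY s th v0) (sgn s u) (sgn s v0).
  by apply: eq_bigr => u _; apply: eq_bigr => v' _; rewrite badSE.
rewrite (key bad) (key (fun a b _ _ => a || b)).
move: h1 h2.
under eq_bigr => u _ do under eq_bigr => v' _ do rewrite -!absE.
under [X in _ <= X -> _]eq_bigr => u _ do under eq_bigr => v' _ do rewrite -!absE.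
under [X in _ -> 0 < X -> _]eq_bigr => u _ do under eq_bigr => v' _ do rewrite -!absE.
by move=> -> ->.
Qed.

Definition grown (D : nat -> bool) s := spectral_inv s /\ forall u, u < n -> D u -> doneS s u.
Definition following (D : nat -> bool) v j (s : arrays) :=
  [/\ forall u, u < n -> doneS s u = D u,
      forall u, u < n -> s 3 u = (walk_pair D v j).1 u &
      forall u, u < n -> s 4 u = (walk_pair D v j).2 u].
Definition nD (D : nat -> bool) := \sum_(u < n) D u.
(* Either some vertex was assigned since the start [D] of the round, or the
   arrays 3 and 4 hold the walk for the unchanged weights. *)
Definition tracking D v j s := grown D s /\ (nD D < ndone s \/ following D v j s).

Lemma commit_grown D th s : grown D s -> grown D (commitS M n k inp th s).
Proof.
by move=> [h1 h2]; split; [exact: commit_inv | move=> u hu du; apply: commit_mono => //; apply: h2].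
Qed.

Lemma commit_ndone th s : ndone s <= ndone (commitS M n k inp th s).
Proof. by apply: ndone_mono => u hu; apply: commit_mono. Qed.

Lemma commit_tracking D v j th s : tracking D v j s ->
  tracking D v j (commitS M n k inp th s).
Proof.
move=> [g t]; split; first exact: commit_grown.
case: t => [t|[t1 t2 t3]]; first by left; apply: leq_trans t (commit_ndone th s).
case: (boolP (checkS M n k inp s th)) => hc.
  left; apply: leq_ltn_trans (commit_progress g.1.1 hc).
  by apply: leq_sum => u _; rewrite t1.
by right; rewrite /commitS (negbTE hc).
Qed.

Lemma weight_ext D D' u v : (forall u, u < n -> D u = D' u) -> u < n -> v < n ->
  weight D u v = weight D' u v.
Proof.
move=> h hu hv; apply: eq_bigr => l _; congr (_ * (_ * (_ * _))).
  by rewrite /active (eq_part (Q := undone D')) // => u' v' hu' hv'; rewrite /undone !h.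
by rewrite /undone !h.
Qed.

Lemma coef_ext D D' u : (forall u, u < n -> D u = D' u) -> coef D u = coef D' u.
Proof.
move=> h; have e (v : 'I_n) : degree D v = degree D' v.
  by apply: eq_bigr => v' _; apply: weight_ext.
by apply: eq_big => [v|v _]; rewrite e.
Qed.

Lemma ndone_ext s s' : (forall u, s' 2 u = s 2 u) -> ndone s' = ndone s.
Proof. by move=> h; apply: eq_bigr => u _; rewrite /doneS h. Qed.

Lemma commits_tracking D v j s : tracking D v j s ->
  tracking D v j (iteri (minn n M) (commitS M n k inp) s).
Proof. by move=> t; apply: iteri_ind => // i y _; apply: commit_tracking. Qed.

Lemma iteration_keeps s a u : a \in [:: 1; 2; 7; 8] ->
  iterationS M n k inp s a u = iteri (minn n M) (commitS M n k inp) s a u.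
Proof. by rewrite !inE => /or4P[] /eqP->. Qed.

Lemma ndone_iteration s : ndone s <= ndone (iterationS M n k inp s).
Proof.
rewrite (@ndone_ext (iteri (minn n M) (commitS M n k inp) s) (iterationS M n k inp s)); last first.
  by move=> u; apply: iteration_keeps.
apply: (iteri_ind (P := fun s' => ndone s <= ndone s')) => // i y _ h.
exact: leq_trans h (commit_ndone i y).
Qed.

Lemma iteration_tracking D v j s : tracking D v j s ->
  tracking D v j.+1 (iterationS M n k inp s).
Proof.
move=> /commits_tracking; have e := @iteration_keeps s.
move: e; rewrite /iterationS; set s1 := iteri _ _ _.
set s2 := fill _ _ 5 _ _; set s3 := fill _ _ 6 _ _; set s4 := fill _ _ 3 _ _.
set s5 := fill _ _ 4 _ _ => e [[g1 g2] t].
split; first split.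
- by apply: spectral_inv_ext g1 => a u ha; rewrite e.
- by move=> u hu du; rewrite /doneS e // -/(doneS s1 u) g2.
case: t => [t|[t1 t2 t3]]; first by left; rewrite (@ndone_ext s1) // => u; rewrite e.
have p1 : prepared s1 by exact: g1.1.
have p2 : prepared s2 by exact: g1.1.
have eW u v' : u < n -> v' < n -> weight (doneS s1) u v' = weight D u v'.
  exact: weight_ext.
right; split.
- by move=> u hu; rewrite -t1 // /doneS e.
- move=> u hu; transitivity (stepS M n k inp s1 3 4 u).
    by rewrite /s5 /s4 /fill /= (minn_idPl nM) hu /s3 /s2 /fill /= (minn_idPl nM) hu.
  rewrite stepSE //= (coef_ext _ t1); congr (_ * _); apply: eq_bigr => v' _.
  by rewrite eW // t2 // t3.
- move=> u hu; transitivity (stepS M n k inp s2 4 3 u).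
    by rewrite /s5 /s4 /fill /= (minn_idPl nM) hu /s3 /fill /= (minn_idPl nM) hu.
  rewrite stepSE //= (coef_ext _ t1); congr (_ * _); apply: eq_bigr => v' _.
  by rewrite eW // -[s2 4 u]/(s1 4 u) -[s2 3 v']/(s1 3 v') t2 // t3.
Qed.

Definition round D s :=
  grown D s /\ (nD D < ndone s \/ forall u, u < n -> doneS s u = D u).

Lemma walk_start D v s : round D s ->
  tracking D v 0 (fill M (fill M s 3 n (fun u => if eqnn u v then 1 else 0)) 4 n (fun u => 0)).
Proof.
move=> [[g1 g2] t]; split; first split.
- by apply: spectral_inv_ext g1 => a u; rewrite !inE => /or4P[] /eqP->.
- by move=> u hu du; apply: g2.
case: t => [t|t]; [by left | right; split=> // u hu].
- by rewrite /fill /= (minn_idPl nM) hu eqnnE; case: eqP.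
- by rewrite /fill /= (minn_idPl nM) hu.
Qed.

Lemma tracking_round D v j s : tracking D v j s -> round D s.
Proof. by move=> [g [t|[t _ _]]]; split=> //; [left | right]. Qed.

Lemma walk_round D v s : round D s -> round D (walk_fromS M n k inp v s).
Proof.
move=> h; apply: (@tracking_round D v (minn M M)); rewrite /walk_fromS.
apply: iteri_indS; first exact: walk_start.
by move=> i y _; apply: iteration_tracking.
Qed.

Lemma ndone_walk v s : ndone s <= ndone (walk_fromS M n k inp v s).
Proof.
apply: (iteri_ind (P := fun s' => ndone s <= ndone s')) => // i y _ h.
exact: leq_trans h (ndone_iteration y).
Qed.

(** The three nested loops reach the start, the time and the threshold of [good_candidate], unless a
    commit came earlier and changed the weights; but that already is progress. *)
Lemma round_progress D s : (exists2 l, l < k & active D l) -> round D s ->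
  nD D < ndone (iteri (minn n M) (walk_fromS M n k inp) s).
Proof.
move=> hact hr; have [v [j [th [hv hj hth hcheck]]]] := good_candidate hact.
apply: (iteri_hit (P := fun _ => round D) (i0 := v) (Q := fun s => nD D < ndone s)) => //.
- by rewrite leq_min hv (leq_trans hv nM).
- by move=> i y _; apply: walk_round.
- move=> y hy; rewrite /walk_fromS.
  apply: (iteri_hit (P := tracking D v) (i0 := j) (Q := fun s => nD D < ndone s)).
  + by rewrite minnn.
  + exact: walk_start.
  + by move=> i z _; apply: iteration_tracking.
  + move=> z hz; rewrite (@ndone_ext (iteri (minn n M) (commitS M n k inp) z) (iterationS M n k inp z)); last first.
      by move=> u; apply: iteration_keeps.
    apply: (iteri_hit (P := fun _ => tracking D v j) (i0 := th) (Q := fun s => nD D < ndone s)) => //.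
    * by rewrite leq_min hth (leq_trans hth nM).
    * by move=> i z' _; apply: commit_tracking.
    * move=> z' [g [t|[t1 t2 t3]]]; first exact: leq_trans t (commit_ndone th z').
      apply: leq_ltn_trans (commit_progress g.1.1 _); last exact: hcheck g.1.1 t1 t2 t3.
      by apply: leq_sum => u _; rewrite t1.
    * by move=> i z' _ _ h; apply: leq_trans h (commit_ndone i z').
  + by move=> i z _ _ h; apply: leq_trans h (ndone_iteration z).
- by move=> i y _ _ h; apply: leq_trans h (ndone_walk i y).
Qed.

Lemma active_mono (D D' : nat -> bool) l :
  (forall u, u < n -> D u -> D' u) -> active D' l -> active D l.
Proof.
move=> h /leq_trans; apply; rewrite leq_mul2l; apply: part_leq => u v hu hv.
by rewrite /undone => /andP[h1 h2]; rewrite !(contra (h _ _)).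
Qed.

Lemma spectral_keeps s a u : a \notin [:: 1; 2; 3; 4; 5; 6] ->
  spectralS M n k inp s a u = s a u.
Proof.
move=> ha; have hf s' a' b F : a' \in [:: 1; 2; 3; 4; 5; 6] -> fill M s' a' b F a u = s' a u.
  by rewrite /fill; case: eqP => // <- h; rewrite h in ha.
have hc th s' : commitS M n k inp th s' a u = s' a u.
  by rewrite /commitS; case: ifP => // _; rewrite !hf.
apply: (iteri_ind (P := fun s' => s' a u = s a u)) => // i y _ <-.
apply: (iteri_ind (P := fun s' => s' a u = y a u)) => // v z _ <-.
apply: (iteri_ind (P := fun s' => s' a u = z a u)) => [|j z' _ <-]; first by rewrite !hf.
rewrite /iterationS !hf //.
by apply: (iteri_ind (P := fun s' => s' a u = z' a u)) => // th y' _ <-.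
Qed.

(** While some graph is active each of the n rounds colours a new vertex, and when all vertices are
    coloured no graph is active. So every graph ends up dropped, with 3/4 of its mass counted and
    less than 1/16 of it lost. *)
Lemma spectral_correct s : prepared s -> (forall u, s 2 u = 0) ->
  let s' := spectralS M n k inp s in
  forall l, l < k ->
    11 * mass l <= 16 * part (fun u v => oneS s' 1 u != oneS s' 1 v) l.
Proof.
move=> ps z s'.
have rem0 l : part (undone (doneS s)) l = mass l.
  by apply: eq_bigr => u _; apply: eq_bigr => v _; rewrite /undone /doneS !z muln1.
have i0 : spectral_inv s.
  split=> //; exists (fun _ => 0), (fun _ => 0); split=> //.
  - by move=> l hl _; rewrite rem0.
  - move=> l hl; rewrite /active rem0 -ltnNge; have := mass0 hl; lia.
  - by rewrite big1 ?muln0 // => l _; rewrite muln0.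
pose I i s := spectral_inv s /\
  ((forall l, l < k -> ~~ active (doneS s) l) \/ i <= ndone s).
have [hI hfin] : I (minn n M) s'.
  apply: iteri_indS; first by split=> //; right.
  move=> i y _ [h1 h2].
  set y' := iteri _ _ _.
  have ry : round (doneS y) y by split=> //; right.
  have [[g1 g2] _] : round (doneS y) y'.
    by apply: iteri_ind => // j y1 _; apply: walk_round.
  split=> //; case: h2 => [h2|h2].
    by left=> l hl; apply: contra (h2 l hl); apply: active_mono.
  case: (boolP [exists l : 'I_k, active (doneS y) l]) => [/existsP[l hl]|/existsPn h].
    right; apply: leq_ltn_trans h2 _; apply: (round_progress _ ry).
    by exists l.
  by left=> l hl; apply: contra (h (Ordinal hl)); apply: active_mono.
have {}hfin l : l < k -> ~~ active (doneS s') l.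
  case: hfin => // hfin hl; first exact: hfin.
  rewrite (minn_idPl nM) in hfin.
  have all_done u : u < n -> doneS s' u.
    move=> hu; apply: contraLR hfin => hd; rewrite -ltnNge /ndone (bigD1 (Ordinal hu)) //= (negbTE hd).
    rewrite add0n; apply: (@leq_ltn_trans (\sum_(i < n | i != Ordinal hu) 1)).
      by apply: leq_sum => u' _; case: doneS.
    by rewrite sum1_card cardC1 card_ord; case: (n) n0.
  rewrite /active (eq_part (Q := fun _ _ => false)); last first.
    by move=> u v hu hv; rewrite /undone !all_done.
  rewrite /part big1 ?muln0 -?ltnNge ?mass0 // => u _.
  by rewrite big1 // => v _; rewrite muln0.
case: hI => ps' [b [tau [h1 h2 h3 h4 h5]]] l hl.
have h1l := h1 l hl; have h4l := h4 l hl (hfin l hl).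
have hc : cutdone s' l <= part (fun u v => oneS s' 1 u != oneS s' 1 v) l.
  by apply: part_leq => u v _ _ /and3P[].
(* A single graph may bear the whole loss, at most k n^2 / (32 k) = n^2 / 32, while its own weighted
   mass exceeds n^2 / 2. *)
have hb : 16 * b l < mass l.
  have t1 : \sum_(l < k) cw l * tau l <= k * (n * n).
    apply: (@leq_trans (\sum_(l < k) n * n)); last by rewrite sum_nat_const card_ord.
    by apply: leq_sum => l' _; apply: leq_trans (cw_mass l'); rewrite leq_mul2l h2 ?orbT.
  have t2 : cw l * b l <= \sum_(l < k) cw l * b l by rewrite (bigD1 (Ordinal hl)) //= leq_addr.
  have t3 : 32 * (cw l * b l) <= n * n.
    rewrite -(leq_pmul2l k0); apply: leq_trans t1; apply: leq_trans h5.
    by rewrite mulnA (mulnC k) leq_mul2l t2 orbT.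
  have t4 := leq_ltn_trans t3 (cw_mass2 hl).
  have c1 : 0 < cw l by rewrite /cw divn_gt0 ?mass0 // mass_le.
  by rewrite -(ltn_pmul2l c1); move: t4; lia.
by lia.
Qed.

End NearlyBipartite.

(** * The greedy extension does not increase the potential *)

Section Greedy.
Local Open Scope ring_scope.

Definition entry_rat l (u v : 'I_n) : rat := (A l u v)%:R.
Definition sign_of (s : arrays) (u : 'I_n) : rat :=
  if doneS s u then (if oneS s 1 u then -1 else 1) else 0.
Definition free_of (s : arrays) (u : 'I_n) : rat := (~~ doneS s u)%:R.
Definition graph_potential s l := potential (entry_rat l) (sign_of s) (free_of s).
(** The weights are squared because the potential measures squared imbalances: this makes the graphs
    comparable. *)
Definition total_potential s :=
  \sum_(l < k) (cw l)%:R ^+ 2 * graph_potential s l.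

Lemma entry_ratC l u v : entry_rat l u v = entry_rat l v u.
Proof. by rewrite /entry_rat AC. Qed.

Lemma entry_rat_diag l u : entry_rat l u u = 0.
Proof. by rewrite /entry_rat /A /adjacency leqnn. Qed.

Lemma entry_rat_idem l u v : (l < k)%N ->
  entry_rat l u v * entry_rat l u v = entry_rat l u v.
Proof.
move=> hl; have := A01 hl (ltn_ord u) (ltn_ord v); rewrite /entry_rat.
by case: (A l u v) => [|[|]] // _; rewrite ?mulr0 ?mulr1.
Qed.

Lemma pairsSE s l : (pairsS M n inp s l true)%:R - (pairsS M n inp s l false)%:R =
  quadratic (entry_rat l) (sign_of s).
Proof.
rewrite /pairsS /quadratic !SE // !natr_sum -sumrB; apply: eq_bigr => u _.
rewrite !SE // !natr_sum -sumrB; apply: eq_bigr => v _; rewrite !eqbbE /sign_of /entry_rat /A.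
case: (doneS s u); case: (doneS s v); case: (oneS s 1 u); case: (oneS s 1 v) => /=; ring.
Qed.

Lemma nbrsSE s l (v : 'I_n) : (nbrsS M n inp s l v false)%:R - (nbrsS M n inp s l v true)%:R =
  pull (entry_rat l) (sign_of s) v.
Proof.
rewrite /nbrsS /pull !SE // !natr_sum -sumrB; apply: eq_bigr => u _.
rewrite /sign_of /entry_rat /A.
case: (doneS s u); case: (oneS s 1 u) => /=; ring.
Qed.

Lemma pairsS_le s l b : (l < k)%N -> (pairsS M n inp s l b <= M)%N.
Proof.
move=> hl; apply: leq_trans nnM; rewrite /pairsS SE //.
apply: (@leq_trans (\sum_(u < n) \sum_(v < n) 1)%N); last first.
  by rewrite sum_nat_const sum1_card !card_ord.
apply: leq_sum => u _; rewrite SE //; apply: leq_sum => v _; case: ifP => // _.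
exact: A01.
Qed.

Lemma derivativeE s (w : 'I_n) : prepared s ->
  (derivativeS M n k inp s w false)%:R - (derivativeS M n k inp s w true)%:R =
  \sum_(l < k) (cw l)%:R ^+ 2 *
    (quadratic (entry_rat l) (sign_of s) * pull (entry_rat l) (sign_of s) w +
     2%:R * \sum_v free_of s v * (entry_rat l v w * pull (entry_rat l) (sign_of s) v)) :> rat.
Proof.
move=> ps; have [_ _ h8] := ps.
have M2 : (2 <= M)%N by have [_ [_]] := bounds; apply: leq_trans.
have M1 : (1 <= M)%N by apply: leq_trans M2.
rewrite /derivativeS !SE // !natr_sum -sumrB; apply: eq_bigr => l _.
have cM : (cw l <= M)%N := leq_trans (cw_le l) nnM.
rewrite h8 // !(mulE _ cM) !(mulE _ (pairsS_le _ _ (ltn_ord l))) !(mulE _ M2) /=.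
rewrite !SE // -pairsSE -nbrsSE.
have -> : \sum_v free_of s v * (entry_rat l v w * pull (entry_rat l) (sign_of s) v) =
  (\sum_(v < n) if doneS s v then 0 else mul M (A l v w) (nbrsS M n inp s l v false))%N%:R -
  (\sum_(v < n) if doneS s v then 0 else mul M (A l v w) (nbrsS M n inp s l v true))%N%:R.
  rewrite !natr_sum -sumrB; apply: eq_bigr => v _; rewrite -nbrsSE /free_of.
  have aM : (A l v w <= M)%N by apply: leq_trans M1; apply: A01.
  case: (doneS s v) => /=; first by rewrite mul0r subrr.
  by rewrite mul1r !mulE // !natrM /entry_rat mulrBr.
set X := (\sum_(v < n) _)%N; set Y := (\sum_(v < n) _)%N.
rewrite !natrM !natrD !natrM; ring.
Qed.

Lemma greedy_facts w s : (w < n)%N -> let s' := greedyS M n k inp w s in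
  [/\ forall a u, a \notin [:: 1; 2]%N -> s' a u = s a u,
      forall u, (u < n)%N -> doneS s' u = (u == w) || doneS s u &
      forall u, (u < n)%N -> oneS s' 1 u =
        if (u == w) && ~~ doneS s w
        then (derivativeS M n k inp s w true < derivativeS M n k inp s w false)%N
        else oneS s 1 u].
Proof.
move=> hw; rewrite /greedyS /=; split.
- by move=> a u; rewrite !inE negb_or /fill => /andP[/negbTE-> /negbTE->].
- by move=> u hu; rewrite /doneS /fill /= (minn_idPl nM) hu eqnnE; case: eqP.
- move=> u hu; rewrite /oneS /fill /= (minn_idPl nM) hu eqnnE.
  by case: ifP => // _; rewrite -ltnNge; case: ifP.
Qed.

Lemma greedy_total w s : prepared s -> (w < n)%N ->
  total_potential (greedyS M n k inp w s) <= total_potential s.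
Proof.
move=> ps hw; have [_ f2 f3] := greedy_facts s hw.
set s' := greedyS _ _ _ _ _ _ in f2 f3 *.
case: (boolP (doneS s w)) => dw.
  rewrite le_eqVlt; apply/orP; left; apply/eqP; apply: eq_bigr => l _.
  congr (_ * _); have hd (u : 'I_n) : doneS s' u = doneS s u.
    by rewrite f2 //; case: eqP => // ->; rewrite dw.
  apply: potential_ext => u; by rewrite /sign_of /free_of hd // ?f3 // ?dw ?andbF.
pose W := Ordinal hw.
(* The colour 1 stands for the sign -1, so the chosen sign opposes the derivative. *)
pose xi : rat := if (derivativeS M n k inp s w true < derivativeS M n k inp s w false)%N
  then -1 else 1.
have xi2 : xi ^+ 2 = 1 by rewrite /xi; case: ifP => _; ring.
have rw : free_of s W = 1 by rewrite /free_of /W /= dw.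
have e : total_potential s' = total_potential s + 4%:R * xi *
   ((derivativeS M n k inp s w false)%:R - (derivativeS M n k inp s w true)%:R).
  rewrite -[w]/(W : nat) derivativeE // /total_potential mulr_sumr -big_split.
  apply: eq_bigr => l _ /=.
  have := potential_update (@entry_ratC l) (@entry_rat_diag l)
    (fun u v => entry_rat_idem u v (ltn_ord l)) (sign_of s) rw xi2.
  rewrite [X in X = _](_ : _ = graph_potential s' l); last first.
    apply: potential_ext => u; rewrite /sign_of /free_of f2 ?f3 //.
      rewrite -[u == W]/(u == w :> nat); case: eqP => [->|_] /=.
        by rewrite (negbTE dw) /= /xi mulr1 add0r.
      by rewrite mulr0 addr0.
    rewrite -[u == W]/(u == w :> nat); case: eqP => [->|_] /=; last by rewrite subr0.
    by rewrite dw subrr.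
  by move=> ->; rewrite mulrDr; congr (_ + _); ring.
rewrite e gerDl /xi; case: ltnP => h.
  have : (derivativeS M n k inp s w true)%:R <= (derivativeS M n k inp s w false)%:R :> rat.
    by rewrite ler_nat ltnW.
  by lra.
have : (derivativeS M n k inp s w false)%:R <= (derivativeS M n k inp s w true)%:R :> rat.
  by rewrite ler_nat.
by lra.
Qed.

Definition extends s0 s := [/\ prepared s, total_potential s <= total_potential s0,
  forall u, (u < n)%N -> doneS s0 u -> doneS s u /\ oneS s 1 u = oneS s0 1 u &
  forall u, s 0%N u = s0 0%N u].

Lemma greedy_loop s0 : prepared s0 ->
  let s := iteri (minn n M) (greedyS M n k inp) s0 in
  extends s0 s /\ forall u, (u < n)%N -> doneS s u.
Proof.
move=> ps /=; rewrite (minn_idPl nM).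
suff : (fun i s => extends s0 s /\ forall u, (u < i)%N -> doneS s u) n
   (iteri n (greedyS M n k inp) s0) by [].
apply: (iteri_indS (P := fun i s => extends s0 s /\ forall u, (u < i)%N -> doneS s u)).
  by split.
move=> i s hi [[p1 p2 p3 p4] p5]; have [f1 f2 f3] := greedy_facts s hi.
split; last first.
  move=> u; rewrite ltnS leq_eqVlt => /orP[/eqP->|lt]; first by rewrite f2 // eqxx.
  by rewrite f2 ?p5 ?orbT // (ltn_trans lt).
split.
- by case: p1 => q1 q2 q3; split=> [l hl||l hl]; rewrite f1 // ?q1 ?q2 ?q3.
- exact: le_trans (greedy_total p1 hi) p2.
- move=> u hu /(p3 u hu) [d1 d2]; rewrite f2 // f3 // d1 orbT; split=> //.
  by case: eqP => // e; subst; rewrite d1.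
- by move=> u; rewrite f1.
Qed.

Lemma graph_potential_done s l : (forall u, (u < n)%N -> doneS s u) ->
  graph_potential s l =
  ((mass l)%:R - 2%:R * (part (fun u v => oneS s 1 u != oneS s 1 v) l)%:R) ^+ 2.
Proof.
move=> hd; have r0 (u : 'I_n) : free_of s u = 0 by rewrite /free_of hd.
rewrite /graph_potential /potential.
rewrite [X in _ + 4%:R * X + _]big1 => [|u _]; last by rewrite r0 mul0r.
rewrite [X in _ + 2%:R * X]big1 => [|u _]; last by rewrite big1 // => v _; rewrite r0 mul0r mulr0.
rewrite !mulr0 !addr0; congr (_ ^+ 2).
rewrite /quadratic /mass /part !natr_sum mulr_sumr -sumrB; apply: eq_bigr => u _.
rewrite !natr_sum mulr_sumr -sumrB; apply: eq_bigr => v _.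
rewrite natrM /sign_of !hd // /entry_rat; case: (oneS s 1 u); case: (oneS s 1 v) => /=; ring.
Qed.

Lemma pull_le s l v : (l < k)%N ->
  `|pull (entry_rat l) (sign_of s) v| <= \sum_(u < n) (doneS s u * A l u v)%N%:R :> rat.
Proof.
move=> hl; apply: le_trans (ler_norm_sum _ _ _) _; apply: ler_sum => u _.
rewrite /sign_of /entry_rat; case: (doneS s u); rewrite ?mulr0 ?normr0 // mul1n.
by case: (oneS s 1 u); rewrite ?mulrN1 ?normrN ?mulr1 normr_nat.
Qed.

(** With q coloured vertices the quadratic form is at most q^2. Each pull is at most q and the pulls
    sum to at most the mass, so their squares sum to at most q times it. The uncoloured pairs
    contribute at most twice the mass. *)
Lemma graph_potential_le s l : (l < k)%N ->
  graph_potential s l <= (ndone s)%:R ^+ 4 + (4%:R * (ndone s)%:R + 2%:R) * (mass l)%:R.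
Proof.
move=> hl; rewrite /graph_potential /potential.
have pb v : `|pull (entry_rat l) (sign_of s) v| <= (ndone s)%:R.
  apply: le_trans (pull_le _ _ hl) _; rewrite -natr_sum ler_nat; apply: leq_sum => u _.
  by have := A01 hl (ltn_ord u) (ltn_ord v); rewrite /A; case: (doneS s u); rewrite ?mul1n ?mul0n.
have pb2 : \sum_v `|pull (entry_rat l) (sign_of s) v| <= (mass l)%:R.
  rewrite /mass exchange_big natr_sum; apply: ler_sum => v _.
  apply: le_trans (pull_le _ _ hl) _; rewrite -natr_sum ler_nat; apply: leq_sum => u _.
  by case: (doneS s u); rewrite ?mul1n ?mul0n.
have n0r : 0 <= (ndone s)%:R :> rat by [].
have hq : `|quadratic (entry_rat l) (sign_of s)| <= (ndone s)%:R ^+ 2.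
  have -> : quadratic (entry_rat l) (sign_of s) =
      \sum_v sign_of s v * pull (entry_rat l) (sign_of s) v.
    rewrite /quadratic exchange_big; apply: eq_bigr => v _; rewrite mulr_sumr.
    by apply: eq_bigr => u _ /=; ring.
  apply: le_trans (ler_norm_sum _ _ _) _.
  have -> : (ndone s)%:R ^+ 2 = \sum_(v < n) (doneS s v)%:R * (ndone s)%:R :> rat.
    by rewrite -mulr_suml -natr_sum expr2.
  apply: ler_sum => v _; rewrite normrM; apply: ler_pM => //.
  by rewrite /sign_of; case: (doneS s v); rewrite ?normr0 //; case: (oneS s 1 v); rewrite ?normrN1 ?normr1.
have hq2 : quadratic (entry_rat l) (sign_of s) ^+ 2 <= (ndone s)%:R ^+ 4.
  rewrite -(real_normK (num_real (quadratic _ _))) -[4%N]/(2 * 2)%N exprM.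
  by apply: lerXn2r; rewrite ?nnegrE ?exprn_ge0.
have hp : \sum_v free_of s v * pull (entry_rat l) (sign_of s) v ^+ 2 <=
    (ndone s)%:R * (mass l)%:R.
  apply: (@le_trans _ _ (\sum_v (ndone s)%:R * `|pull (entry_rat l) (sign_of s) v|)).
    apply: ler_sum => v _; rewrite -(real_normK (num_real (pull _ _ v))).
    have h := pb v; have h0 := normr_ge0 (pull (entry_rat l) (sign_of s) v).
    rewrite /free_of; case: (doneS s v) => /=; first by rewrite mul0r mulr_ge0.
    by rewrite mul1r expr2 ler_wpM2r.
  by rewrite -mulr_sumr ler_wpM2l.
have hr : \sum_u \sum_v entry_rat l u v * (free_of s u * free_of s v) <= (mass l)%:R.
  rewrite /mass natr_sum; apply: ler_sum => u _; rewrite natr_sum; apply: ler_sum => v _.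
  rewrite /free_of /entry_rat; case: (doneS s u); case: (doneS s v) => /=; rewrite ?mulr0 ?mul0r ?mulr0 ?mulr1 //.
by move: hq2 hp hr; lra.
Qed.
End Greedy.

(** * Attempts over cutoffs and partial cuts *)

Section Attempts.
Local Open Scope ring_scope.

Definition cutpart (s : arrays) a l := part (fun u v => oneS s a u != oneS s a v) l.
Definition satisfies (tau : rat) s a :=
  forall l, (l < k)%N -> tau * (mass l)%:R <= (cutpart s a l)%:R.

Lemma cutSE s a l : cutS M n inp s a l = cutpart s a l.
Proof.
rewrite /cutS SE //; apply: eq_bigr => u _; rewrite SE //; apply: eq_bigr => v _.
by rewrite eqbbE; case: (_ == _); rewrite ?muln0 ?muln1.
Qed.

Lemma cutpart_M s a l : (l < k)%N -> (cutpart s a l <= M)%N.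
Proof. by move=> hl; apply: leq_trans nnM; apply: leq_trans (part_le _ _) (mass_le hl). Qed.

Lemma betterSE s : prepared s -> betterS M n k inp s =
  [forall l : 'I_k, [exists l' : 'I_k,
     (cutpart s 0 l' * mass l <= cutpart s 1 l * mass l')%N]].
Proof.
move=> [h7 _ _]; rewrite /betterS SE // leqn0 sum_nat_eq0; apply: eq_forallb => l.
rewrite SE // lt0n sum_nat_eq0 negb_forall.
rewrite (eq_existsb (P2 := fun l' : 'I_k => (cutpart s 0 l' * mass l <= cutpart s 1 l * mass l')%N)).
  by case: existsP.
by move=> l'; rewrite !cutSE !mulE ?cutpart_M // !h7 //; case: ifP.
Qed.

Lemma keep_keeps s a u : a != 0%N -> keepS M n k inp s a u = s a u.
Proof. by move=> /negbTE h; rewrite /keepS; case: ifP => // _; rewrite /fill h. Qed.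

Lemma prepared_ext s s' : (forall a u, a \in [:: 7; 8]%N -> s' a u = s a u) ->
  prepared s -> prepared s'.
Proof. by move=> h [p1 p2 p3]; split=> [l hl||l hl]; rewrite h // ?p1 ?p2 ?p3. Qed.

Lemma keep_prepared s : prepared s -> prepared (keepS M n k inp s).
Proof.
by apply: prepared_ext => a u; rewrite !inE => /orP[] /eqP->; rewrite keep_keeps.
Qed.

Lemma keep_satisfies tau s : prepared s -> satisfies tau s 0 \/ satisfies tau s 1 ->
  satisfies tau (keepS M n k inp s) 0.
Proof.
move=> ps h; have := betterSE ps; rewrite /keepS.
have mp l : (l < k)%N -> 0 < (mass l)%:R :> rat by move=> hl; rewrite ltr0n mass0.
case: ifP => _ /esym; last first.
  move=> /negbT/forallPn[l /existsPn hl]; case: h => // h l' hl'.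
  have := hl (Ordinal hl'); rewrite -ltnNge => /ltnW; rewrite -(ler_nat rat) !natrM => h1.
  rewrite -(ler_pM2l (mp _ (ltn_ord l))) [leRHS]mulrC; apply: le_trans h1.
  by rewrite mulrA ler_wpM2r // mulrC h.
move=> /forallP hb l hl.
have -> : cutpart (fill M s 0 n [eta s 1%N]) 0 l = cutpart s 1 l.
  by apply: eq_part => u v hu hv; rewrite /oneS /fill /= (minn_idPl nM) hu hv.
case: h => [h|]; last by apply.
have /existsP[l' hl'] := hb (Ordinal hl).
move: hl'; rewrite -(ler_nat rat) !natrM => h1.
rewrite -(ler_pM2l (mp _ (ltn_ord l'))) [leRHS]mulrC; apply: le_trans h1.
by rewrite mulrA ler_wpM2r // mulrC h.
Qed.

Definition cutoff r := if (r < k)%N then mass r else 0%N.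
Definition small r u :=
  [exists l : 'I_k, (mass l <= cutoff r)%N && [exists v : 'I_n, (0 < A l u v)%N]].

Lemma inSSE s r u : prepared s -> (r <= k)%N -> inSS M n k inp s r u = small r u.
Proof.
move=> [h7 hk _] hr; have e7 : s 7%N r = cutoff r.
  by rewrite /cutoff; case: ltnP => h; [exact: h7 | rewrite -hk; congr (s _ _); lia].
rewrite /inSS SE // lt0n sum_nat_eq0 negb_forall; apply: eq_existsb => l /=.
rewrite h7 // e7; case: (mass l <= cutoff r)%N => //=.
rewrite SE // sum_nat_eq0 negb_forall; apply: eq_existsb => v /=; by rewrite lt0n.
Qed.

Lemma small_card r : (\sum_(u < n) small r u <= k * cutoff r)%N.
Proof.
apply: (@leq_trans (\sum_(u < n) \sum_(l < k) (mass l <= cutoff r) * \sum_(v < n) A l u v)%N).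
  apply: leq_sum => u _; case: (boolP (small r u)) => //= /existsP[l /andP[h1 /existsP[v hv]]].
  rewrite (bigD1 l) //= h1 mul1n (bigD1 v) //=; move: hv; rewrite /A; lia.
rewrite exchange_big /=; apply: (@leq_trans (\sum_(l < k) cutoff r)%N); last first.
  by rewrite sum_nat_const card_ord.
apply: leq_sum => l _; rewrite -big_distrr /=.
by case: (leqP (mass l) (cutoff r)) => h; rewrite ?mul0n ?mul1n.
Qed.

Definition start r a s : arrays :=
  let s1 := fill M s 1 n (fun u => if inSS M n k inp s r u
     then parityS (shiftS M n k inp s r a u) else 0%N) in
  fill M s1 2 n (fun u => if inSS M n k inp s1 r u then 1%N else 0%N).

Lemma parityE e : (1 <= parityS e)%N = odd e.
Proof.
rewrite /parityS addnn -{1}(odd_double_half e) addnK.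
by case: odd.
Qed.

Lemma start_facts r a s : prepared s -> (r <= k)%N ->
  [/\ prepared (start r a s), forall u, start r a s 0%N u = s 0%N u,
      forall u, (u < n)%N -> doneS (start r a s) u = small r u &
      forall u, (u < n)%N -> small r u ->
        oneS (start r a s) 1 u = odd (iter (\sum_(v < u) small r v)%N half a)].
Proof.
move=> ps hr; split=> //.
- move=> u hu; rewrite /doneS /start /fill /= (minn_idPl nM) hu.
  rewrite [inSS _ _ _ _ _ _ _](_ : _ = inSS M n k inp s r u) //.
  by rewrite inSSE //; case: small.
- move=> u hu su; rewrite /oneS /start /fill /= (minn_idPl nM) hu inSSE // su.
  rewrite parityE /shiftS SE ?(leq_trans (ltnW hu) nM) //.
  have e : (\sum_(v < u) (if inSS M n k inp s r v then 1 else 0) = \sum_(v < u) small r v)%N.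
    by apply: eq_bigr => v _; rewrite inSSE //; case: small.
  rewrite e (minn_idPl _); last first.
    apply: leq_trans nM; apply: leq_trans (ltnW hu); rewrite -[leqRHS]card_ord -sum1_card.
    by apply: leq_sum => v _; case: small.
  by congr (odd _); move: (\sum_(v < u) small r v)%N => m; elim: m => //= m ->.
Qed.

Lemma small_edge r l u v : (l < k)%N -> (mass l <= cutoff r)%N -> (u < n)%N -> (v < n)%N ->
  (0 < A l u v)%N -> small r u && small r v.
Proof.
move=> hl hm hu hv ha; apply/andP; split; apply/existsP; exists (Ordinal hl);
  rewrite /= hm /=; apply/existsP.
  by exists (Ordinal hv).
by exists (Ordinal hu); rewrite /= AC.
Qed.

Definition finished r a s := iteri (minn n M) (greedyS M n k inp) (start r a s).

(** Every edge of a small graph joins two small vertices, which are coloured from the start and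
    never recoloured. *)
Lemma small_potential r a s l : prepared s -> (r <= k)%N -> (l < k)%N ->
  (mass l <= cutoff r)%N ->
  graph_potential (finished r a s) l = graph_potential (start r a s) l.
Proof.
move=> ps hr hl hm; have [p0 _ d0 _] := start_facts a ps hr.
have [[_ _ e3 _] d1] := greedy_loop p0; rewrite -/(finished r a s) in e3 d1.
set s0 := start r a s in p0 d0 e3 *; set s1 := finished r a s in e3 d1 *.
have zero u v : ~~ (small r (u : 'I_n) && small r (v : 'I_n)) -> entry_rat l u v = 0.
  move=> h; apply/eqP; rewrite pnatr_eq0 -leqn0 leqNgt; apply: contra h.
  exact: small_edge.
have sg (u : 'I_n) : small r u -> sign_of s1 u = sign_of s0 u.
  by move=> hu; rewrite /sign_of; have [||-> ->] := e3 u => //; rewrite d0 // hu.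
have f0 (u : 'I_n) : small r u -> free_of s0 u = 0 by move=> hu; rewrite /free_of d0 // hu.
have f1 (u : 'I_n) : free_of s1 u = 0 by rewrite /free_of d1.
rewrite /graph_potential /potential; congr (_ ^+ 2 + _ * _ + _ * _).
- apply: eq_bigr => u _; apply: eq_bigr => v _.
  case: (boolP (small r u && small r v)) => [/andP[hu hv]|/zero->]; last by rewrite !mul0r.
  by rewrite !sg.
- rewrite big1 ?[RHS]big1 // => u _; last by rewrite f1 mul0r.
  case: (boolP (small r u)) => [/f0->|hu]; first by rewrite mul0r.
  rewrite [pull _ _ _]big1 ?expr0n ?mulr0 // => v _.
  by rewrite zero ?mul0r // (negbTE hu) andbF.
- rewrite big1 ?[RHS]big1 // => u _; rewrite big1 // => v _; last by rewrite f1 mul0r mulr0.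
  case: (boolP (small r u && small r v)) => [/andP[hu hv]|/zero->]; last by rewrite mul0r.
  by rewrite f0 // mul0r mulr0.
Qed.

(** Four times 2^18 k^2 = 1/e, with e the deficiency that separates the two regimes: large graphs
    then have imbalance at most e/4 and are cut to 1/2 - e/8. *)
Definition precision := (2 ^ 20 * k ^ 2)%N.

Lemma gap_precision : gap k = (32 * precision ^ 2 * k)%N.
Proof.
rewrite /gap /precision expnMn -!expnM.
have e2 : (2 ^ 5 * 2 ^ 40 = 2 ^ 45)%N := esym (expnD 2 5 40).
have e5 : (k ^ 4 * k = k ^ 5)%N := esym (expnSr k 4).
rewrite -[(2 * 2)%N]/4%N -[(20 * 2)%N]/40%N -[32%N]/(2 ^ 5)%N.
move: (2 ^ 5)%N (2 ^ 40)%N (2 ^ 45)%N e2 => a b c <-.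
by rewrite -e5 !mulnA.
Qed.

(** The constant 32 of the gap is spent here: N <= 2 c m turns 5 N^2 into 20 c^2 m^2. *)
Lemma imbalance_le (F : realFieldType) (p D c m K N : F) :
  0 < c -> 0 < K -> 0 < m -> 0 < p ->
  32%:R * p ^+ 2 * K * (c ^+ 2 * D ^+ 2) <= K * (5%:R * N ^+ 2) ->
  0 <= N -> N <= 2%:R * (c * m) -> p * D <= m.
Proof.
move=> c0 K0 m0 p0 h N0 n2.
have n4 : N ^+ 2 <= 4%:R * (c ^+ 2 * m ^+ 2).
  rewrite (_ : 4%:R * _ = (2%:R * (c * m)) ^+ 2); last by ring.
  by apply: lerXn2r; rewrite ?nnegrE // !mulr_ge0 // ltW.
have h2 : (p * D) ^+ 2 <= m ^+ 2.
  have kc : 0 < K * c ^+ 2 by rewrite mulr_gt0 ?exprn_gt0.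
  rewrite exprMn -(ler_pM2l kc).
  have h3 := ler_wpM2l (ltW K0) n4.
  have h4 : 0 <= K * c ^+ 2 * m ^+ 2 by rewrite mulr_ge0 ?sqr_ge0 ?ltW.
  by lra.
case: (leP (p * D) 0) => [h3|h3]; first exact: le_trans h3 (ltW m0).
by move: h2; rewrite ler_pXn2r ?nnegrE ?(ltW h3) ?(ltW m0).
Qed.

(* The potential of a small graph does not change, so the decrease of the total
   potential bears on the large graphs. *)
Lemma large_cut r a s l : prepared s -> (r <= k)%N -> (l < k)%N ->
  (forall l, (l < k)%N -> (cutoff r < mass l)%N ->
     (gap k * (k * cutoff r + 1) ^ 2 <= mass l)%N) ->
  (cutoff r < mass l)%N ->
  precision%:R * ((mass l)%:R - 2%:R * (cutpart (finished r a s) 1 l)%:R) <=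
    (mass l)%:R :> rat.
Proof.
move=> ps hr hl hgap hlarge; have [p0 _ d0 _] := start_facts a ps hr.
have [[_ e2 e3 _] d1] := greedy_loop p0; rewrite -/(finished r a s) in e2 e3 d1.
have sp l' := small_potential a (l := l') ps hr.
set s0 := start r a s in p0 d0 e2 e3 sp; set s1 := finished r a s in e2 e3 d1 sp *.
pose g : rat := (gap k)%:R.
have g0 : 0 < g.
  by rewrite ltr0n /gap muln_gt0 !expn_gt0 k0.
have N0 : 0 < (n * n)%N%:R :> rat by rewrite ltr0n muln_gt0 n0.
have cm l' : (cw l')%:R * (mass l')%:R <= (n * n)%N%:R :> rat.
  by rewrite -natrM ler_nat cw_mass.
have term l' : (l' < k)%N -> (cutoff r < mass l')%N ->
    g * ((cw l')%:R ^+ 2 * graph_potential s0 l') <= 5%:R * (n * n)%N%:R ^+ 2.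
  move=> hl' hlarge'; have h1 := graph_potential_le s0 hl'.
  set m : rat := (mass l')%:R in h1 *; set c : rat := (cw l')%:R.
  set q : rat := (ndone s0)%:R in h1.
  have q0 : 0 <= q by [].
  have m0 : 0 <= m by [].
  have c0 : 0 <= c by [].
  have gq : g * (q + 1) ^+ 2 <= m.
    rewrite /q natr1 -natrX -natrM ler_nat; apply: leq_trans (hgap l' hl' hlarge').
    rewrite leq_mul2l leq_exp2r // addn1 ltnS; apply/orP; right.
    apply: leq_trans (small_card r); apply: leq_sum => u _; by rewrite d0.
  have g1 : 1 <= g by rewrite ler1n -(ltr0n rat).
  have cml : c * m <= (n * n)%N%:R := cm l'.
  clearbody q m c g.
  pose t := (q + 1) ^+ 2.
  have t1 : 1 <= t by rewrite exprn_ege1 // lerDr.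
  have tq : q ^+ 4 <= t ^+ 2.
    rewrite /t -exprM; apply: lerXn2r; rewrite ?nnegrE ?addr_ge0 //.
    by rewrite lerDl.
  have tq2 : 4%:R * q + 2%:R <= 4%:R * t.
    by have := mulr_ge0 q0 q0; rewrite /t expr2; lra.
  have tm : t <= m.
    by apply: le_trans gq; rewrite -/t ler_peMl // (le_trans _ t1).
  (* Both terms are bounded through g t <= m, where t = (q + 1)^2: q^4 <= t^2 gives m^2, and 4q + 2
     <= 4t gives 4 m^2. *)
  have k1 : g * (q ^+ 4 + (4%:R * q + 2%:R) * m) <= 5%:R * m ^+ 2.
    have a1 : g * q ^+ 4 <= m * m.
      apply: le_trans (ler_wpM2l (ltW g0) tq) _.
      rewrite expr2 mulrA; apply: ler_pM => //; last by rewrite (le_trans _ t1).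
      by rewrite mulr_ge0 ?(ltW g0) // (le_trans _ t1).
    have a2 : g * ((4%:R * q + 2%:R) * m) <= 4%:R * (m * m).
      apply: (@le_trans _ _ (g * (4%:R * t * m))).
        by rewrite ler_pM2l // ler_wpM2r.
      have := ler_wpM2r m0 gq; rewrite -/t; lra.
    by rewrite mulrDr expr2; lra.
  apply: (@le_trans _ _ (5%:R * (c * m) ^+ 2)); last first.
    rewrite ler_pM2l //; apply: lerXn2r; rewrite ?nnegrE ?mulr_ge0 //; exact: cml.
  rewrite [leLHS]mulrCA exprMn [leRHS]mulrCA ler_wpM2l ?sqr_ge0 //.
  by apply: le_trans k1; rewrite ler_pM2l.
have sum_le : g * ((cw l)%:R ^+ 2 * graph_potential s1 l) <= k%:R * (5%:R * (n * n)%N%:R ^+ 2).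
  pose large (l' : 'I_k) := (cutoff r < mass l')%N.
  have pos l' : 0 <= (cw l')%:R ^+ 2 * graph_potential s1 l'.
    by rewrite mulr_ge0 ?sqr_ge0 // graph_potential_done // sqr_ge0.
  have b1 : (cw l)%:R ^+ 2 * graph_potential s1 l <=
      \sum_(l' < k | large l') (cw l')%:R ^+ 2 * graph_potential s1 l'.
    by rewrite (bigD1 (Ordinal hl)) //= lerDl sumr_ge0.
  have b2 : \sum_(l' < k | large l') (cw l')%:R ^+ 2 * graph_potential s1 l' <=
      \sum_(l' < k | large l') (cw l')%:R ^+ 2 * graph_potential s0 l'.
    move: e2; rewrite /total_potential (bigID large) [leRHS](bigID large) /=.
    rewrite (eq_bigr (fun l' : 'I_k => (cw l')%:R ^+ 2 * graph_potential s0 l') (P := fun l' => ~~ large l')).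
      by rewrite lerD2r.
    by move=> l'; rewrite /large -leqNgt => hs; rewrite sp.
  apply: le_trans (ler_wpM2l (ltW g0) (le_trans b1 b2)) _.
  rewrite mulr_sumr; apply: (@le_trans _ _ (\sum_(l' < k | large l') (5%:R * (n * n)%N%:R ^+ 2))).
    by apply: ler_sum => l' hs; apply: term.
  set c := 5%:R * _; have c0 : 0 <= c by rewrite mulr_ge0 ?sqr_ge0.
  rewrite (_ : k%:R * c = \sum_(l' < k) c); last by rewrite sumr_const card_ord mulr_natl.
  by rewrite big_mkcond; apply: ler_sum => l' _; case: ifP.
rewrite graph_potential_done // -/(cutpart s1 1 l) in sum_le.
apply: (@imbalance_le _ _ _ (cw l)%:R _ k%:R (n * n)%N%:R).
- by rewrite ltr0n /cw divn_gt0 ?mass0 // mass_le.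
- by rewrite ltr0n.
- by rewrite ltr0n mass0.
- by rewrite ltr0n /precision muln_gt0 !expn_gt0 k0.
- by move: sum_le; rewrite /g gap_precision natrM natrM natrX.
- exact: ltW.
- by rewrite -!natrM ler_nat ltnW // cw_mass2.
Qed.
End Attempts.

(** * Combining the two regimes *)

Section Correctness.
Local Open Scope ring_scope.

Lemma finished_facts r a s : prepared s -> (r <= k)%N ->
  prepared (finished r a s) /\ forall u, finished r a s 0%N u = s 0%N u.
Proof.
move=> ps hr; have [p0 h0 _ _] := start_facts a ps hr.
by have [[p1 _ _ p4] _] := greedy_loop p0; split=> // u; rewrite p4 h0.
Qed.

Lemma satisfies_ext tau s s' a : (forall u, s' a u = s a u) ->
  satisfies tau s a -> satisfies tau s' a.
Proof.
move=> h hs l hl; rewrite /cutpart (eq_part (Q := fun u v => oneS s a u != oneS s a v)) ?hs //.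
by move=> u v _ _; rewrite /oneS !h.
Qed.

Lemma attempt_prepared r a s : prepared s -> (r <= k)%N ->
  prepared (attemptS M n k inp r a s).
Proof. by move=> ps hr; have [p _] := finished_facts a ps hr; apply: keep_prepared. Qed.

Lemma attempt_satisfies tau r a s : prepared s -> (r <= k)%N ->
  satisfies tau s 0 \/ satisfies tau (finished r a s) 1 ->
  satisfies tau (attemptS M n k inp r a s) 0.
Proof.
move=> ps hr h; have [p e] := finished_facts a ps hr; apply: (keep_satisfies p).
by case: h => h; [left; apply: satisfies_ext h | right].
Qed.

(** The cutoff [r] comes from the pigeonhole principle and the bits of [a] spell [f] on the small
    vertices. Both are fixed before the state, as the attempt occurs in the middle of the run. Small
    graphs are then cut exactly as by [f]. *)
Lemma attempt_exists (f : nat -> bool) : (tower k <= M)%N ->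
  exists r a, [/\ (r <= k)%N, (a < M)%N & forall s, prepared s ->
    forall l, (l < k)%N ->
      cutpart (finished r a s) 1 l = part (fun u v => f u != f v) l \/
      precision%:R * ((mass l)%:R - 2%:R * (cutpart (finished r a s) 1 l)%:R) <=
        (mass l)%:R :> rat].
Proof.
move=> tM; pose m l := if (l < k)%N then mass l else 0%N.
have mE l : (l < k)%N -> m l = mass l by rewrite /m => ->.
have m0 l : (l < k)%N -> (0 < m l)%N by move=> hl; rewrite mE ?mass0.
have mk : m k = 0%N by rewrite /m ltnn.
have [r rk [h1 h2]] := cutoff_exists k0 m0 mk.
rewrite -[m r]/(cutoff r) in h1 h2.
have [a ha hb] := bits_exist (small r) f n.
exists r, a; split=> //.
  apply: leq_trans ha (leq_trans _ tM); rewrite leq_exp2l //.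
  exact: leq_trans (small_card r) h1.
move=> s ps l hl; case: (leqP (mass l) (cutoff r)) => hm; [left | right].
  have [p0 _ d0 b0] := start_facts a ps rk.
  have [[_ _ e3 _] _] := greedy_loop p0; rewrite -/(finished r a s) in e3.
  apply: eq_bigr => u _; apply: eq_bigr => v _.
  case: (posnP (A l u v)) => [->|av]; first by rewrite !mul0n.
  have /andP[su sv] := small_edge hl hm (ltn_ord u) (ltn_ord v) av.
  have [_ ->] : doneS (finished r a s) u /\ oneS (finished r a s) 1 u = oneS (start r a s) 1 u.
    by apply: e3; rewrite ?d0.
  have [_ ->] : doneS (finished r a s) v /\ oneS (finished r a s) 1 v = oneS (start r a s) 1 v.
    by apply: e3; rewrite ?d0.
  by rewrite !b0 // !hb.
apply: large_cut => // l' hl' hm'; rewrite -mE //; apply: h2 => //.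
by rewrite mE.
Qed.

Lemma greedy_phase_keeps tau s : prepared s -> satisfies tau s 0 ->
  satisfies tau (greedy_phaseS M n k inp s) 0.
Proof.
move=> ps hs.
pose P z := prepared z /\ satisfies tau z 0.
suff [] : P (greedy_phaseS M n k inp s) by [].
apply: (iteri_ind (P := P)) => // r y hr hy; apply: (iteri_ind (P := P)) => // a z _ [p q].
have rk : (r <= k)%N by move: hr; rewrite leq_min addn1 ltnS => /andP[].
by split; [exact: attempt_prepared | apply: attempt_satisfies => //; left].
Qed.

Lemma greedy_phase_correct tau (f : nat -> bool) s : (tower k <= M)%N -> prepared s ->
  (forall l, (l < k)%N -> tau * (mass l)%:R <= (part (fun u v => f u != f v) l)%:R) ->
  (forall l x, (l < k)%N -> precision%:R * ((mass l)%:R - 2%:R * x) <= (mass l)%:R ->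
     tau * (mass l)%:R <= x) ->
  satisfies tau (greedy_phaseS M n k inp s) 0.
Proof.
move=> tM ps hf hx; have [r [a [rk aM hra]]] := attempt_exists f tM.
have [[_ kM1 _ _ _] _] := bounds.
have rb i : (i < minn (k + 1) M)%N -> (i <= k)%N by rewrite leq_min addn1 ltnS => /andP[].
have good z : prepared z -> satisfies tau (finished r a z) 1.
  by move=> pz l hl; case: (hra z pz l hl) => [->|]; [exact: hf | exact: hx].
apply: (iteri_hit (P := fun _ => prepared) (i0 := r) (Q := fun s => satisfies tau s 0)) => //.
- by rewrite leq_min addn1 ltnS rk (leq_ltn_trans rk kM1).
- move=> i y /rb hi py; apply: (iteri_ind (P := prepared)) => // j z _ pz; exact: attempt_prepared.
- move=> y py.
  apply: (iteri_hit (P := fun _ => prepared) (i0 := a) (Q := fun s => satisfies tau s 0)) => //.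
  + by rewrite minnn.
  + by move=> j z _ pz; apply: attempt_prepared.
  + by move=> z pz; apply: attempt_satisfies => //; right; apply: good.
  + by move=> j z _ pz hz; apply: attempt_satisfies => //; left.
- move=> i y /rb hi py hy.
  pose P z := prepared z /\ satisfies tau z 0.
  suff [] : P (iteri (minn M M) (attemptS M n k inp i) y) by [].
  apply: (iteri_ind (P := P)) => // j z _ [pz hz].
  by split; [exact: attempt_prepared | apply: attempt_satisfies => //; left].
Qed.

Lemma preparation_prepared : prepared (preparationS M n k inp (fun _ _ => 0%N)).
Proof.
have e7 l : (l < k)%N -> fill M (fun _ _ => 0%N) 7 k
    (fun l => sumb M n (fun u => sumb M n (fun v => adjacency M n inp l u v))) 7 l = mass l.
  move=> hl; rewrite /fill /= (minn_idPl kM) hl SE //.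
  by apply: eq_bigr => u _; rewrite SE.
rewrite /preparationS /=; split.
- by move=> l hl; rewrite {1}/fill /= e7.
- by rewrite /fill /= (minn_idPl kM) ltnn.
- move=> l hl; rewrite {1}/fill /= (minn_idPl kM) hl (mulE _ nM) SE //.
  rewrite e7 // /cw -[RHS](sum_ltn (leq_div (n * n) (mass l))).
  apply: eq_bigr => i _; rewrite mulE; last by rewrite addn1; apply: leq_trans nnM.
  by rewrite addn1 -leq_divRL ?mass0 //; case: ltnP.
Qed.

(** [theta] stands for OPT, unknown to the program: both phases always run, and [keepS] never lowers
    the minimum. For theta >= 1 - e the spectral cut is enough, since 1/2 + e/8 <= 5/8 < 11/16;
    otherwise the greedy phase is. *)
Lemma algorithmS_correct (f : nat -> bool) (theta e : rat) : (tower k <= M)%N ->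
  0 <= theta -> theta <= 1 -> e * (2 ^ 18 * k ^ 2)%N%:R = 1 ->
  (forall l, (l < k)%N -> theta * (mass l)%:R <= (part (fun u v => f u != f v) l)%:R) ->
  satisfies ((2%:R^-1 + e / 8%:R) * theta) (algorithmS M n k inp (fun _ _ => 0%N)) 0.
Proof.
move=> tM t0 t1 he hf; set tau := _ * theta.
have [B BE] : exists B, B = (2 ^ 18 * k ^ 2)%N by exists (2 ^ 18 * k ^ 2)%N; reflexivity.
have b1 : (1 <= B)%N by rewrite BE muln_gt0 !expn_gt0 k0.
have precE : precision%:R = 4%:R * B%:R :> rat.
  have e2 : (2 ^ 20 = 2 ^ 2 * 2 ^ 18)%N := expnD 2 2 18.
  by rewrite BE /precision e2; move: (2 ^ 18)%N => x; rewrite -mulnA natrM.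
rewrite -BE in he.
pose b : rat := B%:R; have b1r : 1 <= b by rewrite ler1n.
rewrite -/b in he precE.
have b0 : 0 < b by lra.
have e0 : 0 < e by rewrite -(pmulr_lgt0 _ b0) he.
have e1 : e <= 1 by rewrite -(ler_pM2r b0) he mul1r.
have tau1 : tau <= theta.
  by rewrite /tau ler_piMl //; move: e1; lra.
have mp l : (l < k)%N -> 0 < (mass l)%:R :> rat by move=> hl; rewrite ltr0n mass0.
set s0 := (fun _ _ => 0%N) : arrays.
have p1 := preparation_prepared; rewrite /algorithmS.
set s1 := preparationS _ _ _ _ _ in p1 *.
have p2 : prepared (spectralS M n k inp s1).
  by apply: prepared_ext p1 => a u; rewrite !inE => /orP[] /eqP->; rewrite spectral_keeps.
have p3 := keep_prepared p2.
case: (leP (1 - e) theta) => ht.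
  apply: greedy_phase_keeps => //; apply: keep_satisfies => //; right => l hl.
  have hx l' : (l' < k)%N -> (2 ^ 18 * k ^ 2 * part (fun u v => f u == f v) l' <= mass l')%N.
    move=> hl'; rewrite -BE -(ler_nat rat) natrM -/b.
    have eqm : (part (fun u v => f u == f v) l')%:R + (part (fun u v => f u != f v) l')%:R = (mass l')%:R :> rat.
      rewrite -natrD partD; last by move=> u v _ _; case: (f u == f v).
      congr (_%:R); apply: eq_bigr => u _; apply: eq_bigr => v _.
      by case: (f u == f v); rewrite muln1.
    have h := hf l' hl'; have h2 := mp l' hl'.
    have h3 := ler_wpM2r (ltW h2) ht.
    have h4 : (part (fun u v => f u == f v) l')%:R <= e * (mass l')%:R by lra.
    by apply: le_trans (ler_wpM2l (ltW b0) h4) _; rewrite mulrA (mulrC b) he mul1r.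
  have := spectral_correct hx p1 (fun _ => erefl) hl.
  rewrite -(ler_nat rat) !natrM -/(cutpart (spectralS M n k inp s1) 1 l) => h.
  have tt : tau <= 11%:R / 16%:R.
    apply: le_trans (_ : (2%:R^-1 + e / 8%:R) * 1 <= _); last by lra.
    by rewrite /tau ler_wpM2l //; lra.
  have := ler_wpM2r (ltW (mp l hl)) tt; lra.
apply: (greedy_phase_correct (f := f)) => //.
  move=> l hl; apply: le_trans (hf l hl); apply: ler_wpM2r tau1; exact/ltW/mp.
move=> l x hl; rewrite precE => h.
have h1 := mp l hl; set m := (mass l)%:R in h h1 *.
have h2 : 4%:R * (m - 2%:R * x) <= e * m.
  rewrite -(ler_pM2r b0) (_ : e * m * b = e * b * m); last by ring.
  by rewrite he mul1r; move: h; lra.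
(* The product below equals 1/2 - 3e/8 - e^2/8, so e/4 is left over. *)
have h3 : tau <= 2%:R^-1 - e / 8%:R.
  apply: (@le_trans _ _ ((2%:R^-1 + e / 8%:R) * (1 - e))).
    by rewrite /tau ler_wpM2l ?(ltW ht) //; lra.
  have : 0 <= e * e by rewrite mulr_ge0 // ltW.
  by lra.
apply: le_trans (ler_wpM2r (ltW h1) h3) _; lra.
Qed.
End Correctness.
End Analysis.

(** * Encoded graphs *)

Section Graphs.
Variable n : nat.
Implicit Types (G : graph n) (f : cut n).

Lemma is_cut2 f (u v : 'I_n) : is_cut f [set u; v] = (f u != f v).
Proof.
apply/idP/idP => [/existsP[x /andP[hx /existsP[y /andP[hy]]]]|h].
  by move: hx hy; rewrite !inE => /orP[] /eqP-> /orP[] /eqP->; rewrite ?eqxx // eq_sym.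
by apply/existsP; exists u; rewrite set21 /=; apply/existsP; exists v; rewrite set22.
Qed.

Lemma card_edge_pairs (e : {set 'I_n}) : #|e| = 2 ->
  #|[pred p : 'I_n * 'I_n | [set p.1; p.2] == e]| = 2.
Proof.
move=> /eqP/cards2P[x [y [xy ->]]].
rewrite (eq_card (B := [set (x, y); (y, x)])).
  by rewrite cards2 xpair_eqE negb_and xy.
move=> [u v]; rewrite !inE /= !xpair_eqE; apply/eqP/orP => [h|].
  have hu : u \in [set x; y] by rewrite -h set21.
  have hv : v \in [set x; y] by rewrite -h set22.
  have hx : x \in [set u; v] by rewrite h set21.
  have hy : y \in [set u; v] by rewrite h set22.
  move: hu hv hx hy; rewrite !inE => /orP[] /eqP-> /orP[] /eqP->; rewrite ?eqxx ?orbb ?(negbTE xy) //=.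
  - by rewrite eq_sym (negbTE xy).
  - by left.
  - by right.
by move=> [] /andP[/eqP-> /eqP->] //; rewrite setUC.
Qed.

Lemma sum_pairs G (P : {set 'I_n} -> bool) :
  \sum_(u : 'I_n) \sum_(v : 'I_n) ([set u; v] \in edges G) * P [set u; v] =
  2 * #|[set e in edges G | P e]|.
Proof.
rewrite pair_bigA /=.
rewrite (partition_big (fun p : 'I_n * 'I_n => [set p.1; p.2]) xpredT) //=.
have card2 e : e \in edges G -> #|e| = 2.
  by move=> he; have /forallP/(_ e)/implyP/(_ he)/eqP := edges_card2 G.
rewrite mulnC -sum_nat_const [RHS]big_mkcond; apply: eq_bigr => e _ /=.
rewrite (eq_bigr (fun _ => (e \in edges G) * P e)); last by move=> p /eqP->.
rewrite sum_nat_const inE; case: (boolP (e \in edges G)) => [he|_]; last by rewrite muln0.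
rewrite card_edge_pairs; last exact: card2.
by case: (P e); rewrite ?muln0.
Qed.

Local Open Scope ring_scope.

Lemma val_cutE G f : val_cut f G =
  (#|[set e in edges G | is_cut f e]|)%:R / (#|edges G|)%:R.
Proof.
rewrite /val_cut (eq_bigl (mem [set e in edges G | is_cut f e])); last by move=> e; rewrite !inE.
by rewrite sumr_const mulr_natl.
Qed.

Lemma val_cut_ge0 G f : 0 <= val_cut f G.
Proof. by rewrite val_cutE divr_ge0. Qed.

Lemma min_val_ge0 k f (G : 'I_k -> graph n) : 0 <= min_val f G.
Proof. by apply: le_bigmin => // l _; apply: val_cut_ge0. Qed.

Lemma min_val_le k f (G : 'I_k -> graph n) l : min_val f G <= val_cut f (G l).
Proof. exact: bigmin_le. Qed.

Lemma opt_attained k (G : 'I_k -> graph n) : exists f, opt G = min_val f G.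
Proof.
rewrite /opt (@bigmax_eq_arg _ _ _ _ [ffun=> false]) //; last by move=> f _; apply: min_val_ge0.
by eexists; reflexivity.
Qed.

Lemma opt_ge0 k (G : 'I_k -> graph n) : 0 <= opt G.
Proof. by have [f ->] := opt_attained G; apply: min_val_ge0. Qed.

Lemma opt_le1 k (G : 'I_k -> graph n) : opt G <= 1.
Proof. by have [f ->] := opt_attained G; apply: bigmin_le_id. Qed.
End Graphs.

Section Encoding.
Variables (n k : nat) (G : 'I_k -> graph n).

Lemma nth_flatten_const (T1 T2 : Type) (f : T1 -> seq T2) m x0 y0 (s : seq T1) i j :
  (forall y, size (f y) = m) -> i < size s -> j < m ->
  nth x0 (flatten (map f s)) (i * m + j) = nth x0 (f (nth y0 s i)) j.
Proof.
move=> hf; elim: s i => [|y s IH] [|i] //= hi hj; rewrite nth_cat hf.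
  by rewrite mul0n add0n hj.
by rewrite mulSn -addnA ltnNge leq_addr /= addKn IH.
Qed.

Let block l := [seq nat_of_bool ([set i; j] \in edges (G l)) | i <- enum 'I_n, j <- enum 'I_n].

Lemma size_block l : size (block l) = n * n.
Proof. by rewrite size_allpairs !size_enum_ord. Qed.

Lemma encode_adj (l : 'I_k) (u v : 'I_n) :
  input (encode G) (2 + (n * (n * l + u) + v)) = ([set u; v] \in edges (G l)).
Proof.
rewrite /input /encode /= -/block.
have -> : n * (n * l + u) + v = l * (n * n) + (u * n + v) by lia.
rewrite (@nth_flatten_const _ _ block (n * n) 0 l) ?size_enum_ord //; last first.
- by have := ltn_ord u; have := ltn_ord v; nia.
- exact: size_block.
rewrite nth_ord_enum /block.
rewrite (@nth_flatten_const _ _ _ n 0 u) ?size_enum_ord //; last first.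
  by move=> y; rewrite size_map size_enum_ord.
by rewrite nth_ord_enum (nth_map v) ?size_enum_ord // nth_ord_enum.
Qed.

Lemma size_encode : size (encode G) = 2 + k * (n * n).
Proof.
rewrite /encode /= size_flatten /shape -map_comp.
rewrite (eq_map (g := fun _ => n * n)); last by move=> l /=; rewrite size_block.
rewrite -[k in RHS]size_enum_ord; congr (_.+2).
by elim: (enum 'I_k) => //= x s ->; rewrite mulSn.
Qed.

Lemma set11_edge l (u : 'I_n) : ([set u; u] \in edges (G l)) = false.
Proof.
apply/negP => h; have /forallP/(_ [set u; u])/implyP/(_ h) := edges_card2 (G l).
by rewrite setUid cards1.
Qed.

(** Below the diagonal the row index is at least 1, so the cell read has address at least n >= R and
    no register has overwritten it. The entries above the diagonal follow by symmetry, those on it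
    by the absence of loops. *)
Lemma A_edge M (l : 'I_k) (u v : 'I_n) : R <= n -> 2 + k * (n * n) <= M -> n <= M ->
  adjacency M n (input (encode G)) l u v = ([set u; v] \in edges (G l)).
Proof.
move=> Rn hM nM.
have entryE (x y : 'I_n) : y < x ->
    entryS M n (input (encode G)) l x y = ([set x; y] \in edges (G l)).
  move=> yx; rewrite /entryS /mul (minn_idPl nM) /inpS encode_adj.
  rewrite (_ : _ && _ = true) //; apply/andP; split.
    apply: leq_trans Rn _; apply: leq_trans (leq_addl _ _).
    apply: leq_trans (leq_addr _ _); rewrite leq_pmulr //; lia.
  apply: leq_trans hM; have := ltn_ord x; have := ltn_ord y; have := ltn_ord l; nia.
rewrite /adjacency -!ltnNge; case: (ltngtP v u) => h; first exact: entryE.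
  by rewrite entryE // setUC.
have e : v = u by apply: val_inj.
by rewrite e set11_edge.
Qed.
End Encoding.

Lemma fuel_bound n k : 0 < n -> 0 < k -> 2 ^ 20 * k ^ 2 * n ^ 4 <= fuel n k.
Proof.
move=> n0 k0; rewrite /fuel mulnC leq_mul2l; apply/orP; right; rewrite /tower.
apply: (@leq_trans (2 ^ 20 * (2 ^ k) ^ 2)).
  by rewrite leq_mul2l leq_exp2r ?leq_exp2 ?orbT.
rewrite -expnM -expnD leq_exp2l //; apply: leq_trans (leq_exp2 _).
apply: leq_trans (leq_exp2 _); lia.
Qed.

Lemma mass_edges n k (G : 'I_k -> graph n) M l : R <= n -> 2 + k * (n * n) <= M -> n <= M ->
  mass M n (input (encode G)) (l : 'I_k) = 2 * #|edges (G l)|.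
Proof.
move=> Rn hM nM; transitivity (2 * #|[set e in edges (G l) | true]|).
  rewrite -(sum_pairs _ (fun _ => true)); apply: eq_bigr => u _; apply: eq_bigr => v _.
  by rewrite muln1 A_edge.
by congr (_ * _); apply: eq_card => e; rewrite !inE andbT.
Qed.

Lemma part_edges n k (G : 'I_k -> graph n) M (l : 'I_k) (g : nat -> bool) (f : cut n) :
  R <= n -> 2 + k * (n * n) <= M -> n <= M -> (forall u : 'I_n, g u = f u) ->
  part M n (input (encode G)) (fun u v => g u != g v) l =
  2 * #|[set e in edges (G l) | is_cut f e]|.
Proof.
move=> Rn hM nM hg; rewrite -sum_pairs; apply: eq_bigr => u _; apply: eq_bigr => v _.
by rewrite A_edge // is_cut2 !hg.
Qed.

Local Open Scope ring_scope.

Theorem theorem1p5 :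
  exists (p : program) (c : rat) (C d n0 : nat),
    0 < c /\
    forall (n k : nat) (G : 'I_k -> graph n),
      (n0 <= n)%N -> (0 < k)%N -> (forall l : 'I_k, edges (G l) != set0) ->
      exists (t : nat) (m : memory),
        [/\ exec p (input (encode G)) t m,
            (t <= 2 ^ (2 ^ (2 ^ (C * k))) * n ^ d)%N
          & min_approx (2%:R^-1 + c / k%:R ^+ 2) G (output n m)].
Proof.
have [prog [C [d Hp]]] := machine algorithm_wf.
have [B [B1 BE]] : exists B : rat, 1 <= B /\
    forall k, B * k%:R ^+ 2 = (2 ^ 18 * k ^ 2)%N%:R.
  exists (2 ^ 18)%N%:R; split; first by rewrite ler1n expn_gt0.
  by move=> k; move: (2 ^ 18)%N => x; rewrite natrM natrX.
have B0 : 0 < B by lra.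
have B8 : 0 < 8%:R * B by lra.
(* The gain is e/8 with e = 1 / (2^18 k^2), so c = 1 / (8 * 2^18); n is large enough once it reaches
   the number [R] of registers. *)
exists prog, (8%:R * B)^-1, C, d, R; split; first by rewrite invr_gt0.
move=> n k G Rn k0 hE.
have n0 : (0 < n)%N by apply: leq_trans Rn.
set M := fuel n k.
have MB : (2 ^ 20 * k ^ 2 * n ^ 4 <= M)%N := fuel_bound n0 k0.
have nM : (n <= M)%N by have [[]] := bounds n0 k0 MB.
have hM : (2 + k * (n * n) <= M)%N.
  apply: leq_trans MB; rewrite -mulnA; apply: (@leq_trans (4 * (k ^ 2 * n ^ 4))%N).
    have k2 : (k <= k ^ 2)%N by rewrite -mulnn leq_pmulr.
    have n2 : (n * n <= n ^ 4)%N by rewrite mulnn leq_pexp2l.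
    have k1 : (0 < k ^ 2)%N by rewrite expn_gt0 k0.
    have n1 : (0 < n ^ 4)%N by rewrite expn_gt0 n0.
    have h1 := leq_mul k2 n2; have h2 : (0 < k ^ 2 * n ^ 4)%N by rewrite muln_gt0 k1.
    by move: (k ^ 2 * n ^ 4)%N h1 h2 => x; lia.
  by rewrite leq_mul2r (@leq_exp2l 2 2 20) // orbT.
have hsz : (size (encode G) <= M)%N by rewrite size_encode.
have [t [m [h1 h2 h3]]] := Hp n k (encode G) Rn k0 hsz erefl erefl.
exists t, m; split=> //.
set inp := input (encode G) in h3 *.
have [f fopt] := opt_attained G.
have massE (l : 'I_k) : mass M n inp l = (2 * #|edges (G l)|)%N by apply: mass_edges.
have e0 (l : 'I_k) : (0 < #|edges (G l)|)%N by rewrite card_gt0.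
have A01 l u v : (l < k)%N -> (u < n)%N -> (v < n)%N -> (adjacency M n inp l u v <= 1)%N.
  move=> hl hu hv; have := A_edge G (Ordinal hl) (Ordinal hu) (Ordinal hv) Rn hM nM.
  by rewrite /= => ->; case: (_ \in _).
have mass0 l : (l < k)%N -> (0 < mass M n inp l)%N.
  by move=> hl; rewrite (massE (Ordinal hl)) muln_gt0 e0.
pose g (u : nat) := if (insub u : option 'I_n) is Some v then f v else false.
have gE (u : 'I_n) : g u = f u by rewrite /g valK.
have tM : (tower k <= M)%N by rewrite /M /fuel leq_pmull // expn_gt0 n0.
have kp : 0 < k%:R :> rat by rewrite ltr0n.
pose e : rat := (B * k%:R ^+ 2)^-1.
have he : e * (2 ^ 18 * k ^ 2)%N%:R = 1.
  rewrite -BE /e; apply: mulVf; rewrite gt_eqF //.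
  by rewrite mulr_gt0 ?exprn_gt0.
have valE (l : 'I_k) (f' : cut n) (g' : nat -> bool) : (forall u : 'I_n, g' u = f' u) ->
    (part M n inp (fun u v => g' u != g' v) l)%:R = val_cut f' (G l) * (mass M n inp l)%:R :> rat.
  move=> hg; rewrite (part_edges _ _ Rn hM nM hg) massE val_cutE !natrM.
  by field; rewrite pnatr_eq0 -lt0n e0.
have hf l : (l < k)%N ->
    opt G * (mass M n inp l)%:R <= (part M n inp (fun u v => g u != g v) l)%:R.
  move=> hl; rewrite (valE (Ordinal hl) f g gE) ler_wpM2r // fopt; exact: min_val_le.
have := algorithmS_correct n0 k0 MB A01 mass0 tM (opt_ge0 G) (opt_le1 G) he hf.
set s := algorithmS _ _ _ _ _ => hs.
have cutE (u : 'I_n) : oneS s 0 u = output n m u.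
  by rewrite ffunE h3 // algorithmE -lt0n.
have tauE : 2%:R^-1 + (8%:R * B)^-1 / k%:R ^+ 2 = 2%:R^-1 + e / 8%:R.
  by congr (_ + _); rewrite /e; field; rewrite !gt_eqF.
rewrite /min_approx tauE; apply: le_bigmin => [|l _].
  (* The default value 1 of the minimum has to be compared as well: (1/2 + e/8) OPT is at most 1. *)
  have e1 : e <= 1.
    rewrite /e invf_le1 ?mulr_gt0 ?exprn_gt0 // -[leLHS]mulr1.
    by apply: ler_pM => //; rewrite ?exprn_ege1 // ler1n.
  have e00 : 0 < e by rewrite /e invr_gt0 mulr_gt0 // exprn_gt0.
  have := opt_le1 G; have := opt_ge0 G; nra.
have := hs l (ltn_ord l); rewrite /cutpart (valE l (output n m) _ cutE).
by rewrite ler_pM2r // ltr0n mass0.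
Qed.
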